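(* Let $X,Y$ be Banach spaces, let $A$ generate an exponentially stable strongly continuous semigroup $(T(t))_{t\ge 0}$ on $X$, and let $C: X_1\to Y$ be a bounded linear operator, where $X_1=D(A)$ is endowed with the graph norm of $A$. Assume that the kernel $a\in L^1_{\mathrm{loc}}(\mathbb{R}_+)$ is $1$-regular and sectorial of angle $\theta<\pi/2$, and let $(S(t))_{t\ge 0}$ be the solution family of the Volterra equation $x(t)=f(t)+\int_0^t a(t-s)Ax(s)\,ds$. If $C$ is finite-time admissible for the semigroup $(T(t))_{t\ge 0}$, then $C$ is finite-time admissible for the solution family $(S(t))_{t\ge 0}$.
   Context: Kernels: $a\in L^1_{\mathrm{loc}}(\mathbb{R}_+)$ is a scalar kernel of sub-exponential growth, so that its Laplace transform $\hat a(\lambda)$ exists for all $\lambda$ with $\operatorname{Re}\lambda>0$. Put $\Sigma_\theta=\{z\in\mathbb{C}\setminus\{0\}: |\arg z|<\theta\}$. The kernel $a$ is sectorial of angle $\theta\in(0,\pi)$ if $\hat a(\lambda)\in\Sigma_\theta$ for all $\operatorname{Re}\lambda>0$. It is $k$-regular if there is $K>0$ with $|\lambda^n\hat a^{(n)}(\lambda)|\le K|\hat a(\lambda)|$ for all $n=0,1,\dots,k$ and all $\operatorname{Re}\lambda>0$. Solution family: the family of bounded linear operators $(S(t))_{t\ge0}$ on $X$ such that (i) $S(0)=I$ and $S(\cdot)$ is strongly continuous on $\mathbb{R}_+$; (ii) $S(t)D(A)\subset D(A)$ and $AS(t)x=S(t)Ax$ for $x\in D(A)$, $t\ge0$; (iii)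 $S(t)x=x+\int_0^t a(t-s)AS(s)x\,ds$ for $x\in D(A)$, $t\ge 0$. Under the hypotheses of the claim the Volterra equation is parabolic (i.e. $\hat a(\lambda)\ne0$ and $1/\hat a(\lambda)\in\varrho(A)$ for $\operatorname{Re}\lambda>0$, where $-A$ is sectorial), and it is known that then a unique solution family exists. Finite-time admissibility: $C$ is finite-time admissible for $(S(t))_{t\ge0}$ (equivalently, for the Volterra equation) if there are constants $\eta,K>0$ such that $\left(\int_0^t\|CS(r)x\|^2\,dr\right)^{1/2}\le Ke^{\eta t}\|x\|$ for all $t\ge0$ and all $x\in D(A)$. Finite-time admissibility for $(T(t))_{t\ge0}$ is the same condition with $T$ in place of $S$ (the case $a\equiv1$). *)

(* Defs.v *)
From mathcomp Require Import all_boot all_order all_algebra.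
From mathcomp Require Import complex.
From mathcomp Require Import all_classical all_reals all_analysis.

Set Implicit Arguments.
Unset Strict Implicit.
Unset Printing Implicit Defensive.

Import Order.TTheory GRing.Theory Num.Theory.
Import numFieldNormedType.Exports.

Local Open Scope classical_set_scope.
Local Open Scope ring_scope.
Local Open Scope complex_scope.

(* The norm of a normed space over R[i] takes its values in R[i]; they are
   nonnegative reals, so taking the real part loses nothing. *)
Definition rnorm (R : realType) (V : normedModType R[i]) (v : V) : R :=
  complex.Re `|v|.

Definition cmod (R : realType) (z : R[i]) : R := complex.Re `|z|.

Definition cexp (R : realType) (z : R[i]) : R[i] :=
  (expR (complex.Re z) * cos (complex.Im z))
    +i* (expR (complex.Re z) * sin (complex.Im z)).

(* Principal argument, in ]-pi, pi]; the value at 0 is irrelevant. *)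
Definition carg (R : realType) (z : R[i]) : R :=
  let phi := acos (complex.Re z / cmod z) in
  if 0 <= complex.Im z then phi else - phi.

Definition sector (R : realType) (theta : R) : set R[i] :=
  [set z | z != 0 /\ `|carg z| < theta].

Definition cintegrable (R : realType) (D : set R) (f : R -> R[i]) : Prop :=
  lebesgue_measure.-integrable D (fun t => (complex.Re (f t))%:E) /\
  lebesgue_measure.-integrable D (fun t => (complex.Im (f t))%:E).

Definition cintegral (R : realType) (D : set R) (f : R -> R[i]) : R[i] :=
  (\int[lebesgue_measure]_(t in D) complex.Re (f t))
    +i* (\int[lebesgue_measure]_(t in D) complex.Im (f t)).

(* A step function sum_i 1_{B_i} v_i is given by the list of the (B_i, v_i);
   the B_i need not be disjoint. *)
Definition step_fun (R : realType) (X : normedModType R[i])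
    (s : seq (set R * X)) (r : R) : X :=
  \sum_(p <- s) (\1_(p.1) r)%:C *: p.2.

Definition step_fun_on (R : realType) (X : normedModType R[i])
    (D : set R) (s : seq (set R * X)) : Prop :=
  forall p, p \in s ->
    [/\ measurable p.1, p.1 `<=` D & (lebesgue_measure p.1 < +oo)%E].

Definition step_integral (R : realType) (X : normedModType R[i])
    (s : seq (set R * X)) : X :=
  \sum_(p <- s) (fine (lebesgue_measure p.1))%:C *: p.2.

(* f is Bochner integrable on D for the Lebesgue measure, with integral v. The
   almost everywhere convergence makes f strongly measurable. *)
Definition is_bochner_integral (R : realType) (X : normedModType R[i])
    (D : set R) (f : R -> X) (v : X) : Prop :=
  exists s : nat -> seq (set R * X),
    [/\ forall n, step_fun_on D (s n),
        {ae lebesgue_measure, forall r, D r ->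
          step_fun (s n) r @[n --> \oo] --> f r},
        (\int[lebesgue_measure]_(r in D)
           (rnorm (f r - step_fun (s n) r))%:E)%E @[n --> \oo] --> 0%E
      & step_integral (s n) @[n --> \oo] --> v].

(* Functions on the half-line R_+ are represented by functions on R whose
   values at negative reals are never used. *)
Definition L1loc (R : realType) (a : R -> R[i]) : Prop :=
  forall t : R, 0 <= t -> cintegrable `[0, t] a.

Definition subexponential_growth (R : realType) (a : R -> R[i]) : Prop :=
  forall eps : R, 0 < eps ->
    (\int[lebesgue_measure]_(t in `[0%R, +oo[)
       (expR (- (eps * t)) * cmod (a t))%:E < +oo)%E.

Definition laplace (R : realType) (a : R -> R[i]) (lambda : R[i]) : R[i] :=
  cintegral `[0, +oo[ (fun t => cexp (- (lambda * t%:C)) * a t).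

Definition sectorial_kernel (R : realType) (a : R -> R[i]) (theta : R) : Prop :=
  [/\ 0 < theta, theta < pi &
      forall lambda : R[i], 0 < complex.Re lambda ->
        sector theta (laplace a lambda)].

Definition regular_kernel (R : realType) (k : nat) (a : R -> R[i]) : Prop :=
  exists K : R, 0 < K /\
    forall (n : nat) (lambda : R[i]), (n <= k)%N -> 0 < complex.Re lambda ->
      cmod (lambda ^+ n *
            derive1n n (laplace a : R[i] -> (R[i])^o) lambda)
        <= K * cmod (laplace a lambda).

Record C0_semigroup (R : realType) (X : normedModType R[i])
    (T : R -> {linear X -> X}) : Prop := {
  C0_semigroup_continuous : forall t, 0 <= t -> continuous (T t) ;
  C0_semigroup_0 : forall x, T 0 x = x ;
  C0_semigroup_add : forall s t, 0 <= s -> 0 <= t ->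
    forall x, T (s + t) x = T s (T t x) ;
  C0_semigroup_strongly_continuous :
    forall x, {within `[0, +oo[, continuous (fun t => T t x)} }.

Definition exponentially_stable (R : realType) (X : normedModType R[i])
    (T : R -> {linear X -> X}) : Prop :=
  exists M omega : R, 0 < omega /\
    forall t x, 0 <= t -> rnorm (T t x) <= M * expR (- (omega * t)) * rnorm x.

(* An unbounded operator is given by its domain DA and a total function A
   whose values outside DA are never used. *)
Definition generates (R : realType) (X : normedModType R[i])
    (DA : set X) (A : X -> X) (T : R -> {linear X -> X}) : Prop :=
  [/\ C0_semigroup T,
      forall x, DA x <-> cvg ((h^-1)%:C *: (T h x - x) @[h --> (0 : R)^'+])
    & forall x, DA x ->
        (h^-1)%:C *: (T h x - x) @[h --> (0 : R)^'+] --> A x].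

(* C, restricted to DA, is linear and bounded for the graph norm of A. *)
Record bounded_linear_on_X1 (R : realType) (X Y : normedModType R[i])
    (DA : set X) (A : X -> X) (C : X -> Y) : Prop := {
  X1_linear : forall (k : R[i]) x y, DA x -> DA y ->
    C (k *: x + y) = k *: C x + C y ;
  X1_bounded : exists M : R, forall x, DA x ->
    rnorm (C x) <= M * (rnorm x + rnorm (A x)) }.

Record solution_family (R : realType) (X : normedModType R[i])
    (a : R -> R[i]) (DA : set X) (A : X -> X)
    (S : R -> {linear X -> X}) : Prop := {
  solution_family_continuous : forall t, 0 <= t -> continuous (S t) ;
  solution_family_0 : forall x, S 0 x = x ;
  solution_family_strongly_continuous :
    forall x, {within `[0, +oo[, continuous (fun t => S t x)} ;
  solution_family_domain : forall t x, 0 <= t -> DA x -> DA (S t x) ;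
  solution_family_commute : forall t x, 0 <= t -> DA x ->
    A (S t x) = S t (A x) ;
  solution_family_equation : forall t x, 0 <= t -> DA x ->
    exists2 v, is_bochner_integral `[0, t] (fun s => a (t - s) *: A (S s x)) v
             & S t x = x + v }.

Definition finite_time_admissible (R : realType) (X Y : normedModType R[i])
    (DA : set X) (C : X -> Y) (S : R -> {linear X -> X}) : Prop :=
  exists eta K : R, [/\ 0 < eta, 0 < K &
    forall t x, 0 <= t -> DA x ->
      ((\int[lebesgue_measure]_(r in `[0%R, t]) (rnorm (C (S r x)) ^+ 2)%:E)
         `^ 2^-1 <= (K * expR (eta * t) * rnorm x)%:E)%E].

(* Main.v *)
Require Import Defs.
From mathcomp Require Import all_boot all_order all_algebra.
From mathcomp Require Import complex.
From mathcomp Require Import all_classical all_reals all_analysis.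
From mathcomp Require Import measurable_realfun.
From mathcomp Require Import ring lra.

(** Put m(z) = 1/a^(z). Taking Laplace transforms in the Volterra equation gives
    S^(z) = (m(z)/z) (m(z) - A)^-1, and the resolvent is the Laplace transform of
    the semigroup at m(z). Hence, formally,

      C S(t)x = int_0^oo v(t, s) C T(s)x ds,
      v(t, s) = (1 / 2 pi i) int_(Re z = c) exp(zt) (m(z)/z) exp(-m(z)s) dz.

    Exponential stability and finite-time admissibility put C T(.)x in L^2 of
    the half-line with norm at most a constant times |x| ([halfline_energy]).
    By the Cauchy-Schwarz inequality in s it therefore suffices that v has finite
    energy with the weight exp(-2ct) in t. By Plancherel's inequality in t this
    energy is at most a constant times the integral over the line of
    |m/z|^2 / (2 Re m). Sectoriality of angle below pi/2 bounds Re m from below by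
    a multiple of |m|, so that |m|/|z|^2 remains ([line_kernel_energy]). It is
    integrable because |m(z)| is at most a multiple of |z|^rho with rho < 1
    ([sector_growth]): the mean of log |a^| over arcs of half-angle b between
    theta and pi/2 decreases at a rate bounded by the variation of arg a^ over the
    arc, at most 2 theta, and 1-regularity makes log |a^| oscillate boundedly on
    every arc.

    Three points make this rigorous. The integral defining v need not converge
    absolutely, so the multiplier (N/(z+N))^2 is inserted. It replaces C S(.)x by
    an average over its recent past, which tends to C S(t)x as N grows, while all
    kernel bounds are uniform in N; Fatou's lemma concludes
    ([integral_le_kernel_energy]).

    The growth of S is unknown, so S may have no Laplace transform. Orbits are
    truncated at a time tau > t; the transform then satisfies the expected formula
    up to an error of size exp(-tau Re z) ([volterra_laplace]), which disappears
    when the line of integration moves to infinity ([representation]).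

    Finally C is unbounded and the integrals are vector-valued. The analysis is
    done for scalar functions instead: for a functional phi that norms C S(t)x at
    the given t, stability and the Hahn-Banach theorem yield a bounded functional
    psi on X with psi o A = phi o C on the domain ([dual_observation]), and then
    phi(C S(r)x) = psi(S(r) A x), where the same holds for T
    ([solution_pointwise_energy]). *)

Set Implicit Arguments.
Unset Strict Implicit.
Unset Printing Implicit Defensive.

Import Order.TTheory GRing.Theory Num.Theory.
Import numFieldNormedType.Exports.

Local Open Scope classical_set_scope.
Local Open Scope ring_scope.
Local Open Scope complex_scope.

(** * Complex modulus and exponential *)

Section ComplexModulus.
Context {R : realType}.
Implicit Types (z w : R[i]) (x y : R).

Lemma ReD z w : complex.Re (z + w) = complex.Re z + complex.Re w.
Proof. by case: z; case: w. Qed.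
Lemma ImD z w : complex.Im (z + w) = complex.Im z + complex.Im w.
Proof. by case: z; case: w. Qed.
Lemma ReN z : complex.Re (- z) = - complex.Re z.
Proof. by case: z. Qed.
Lemma ImN z : complex.Im (- z) = - complex.Im z.
Proof. by case: z. Qed.
Lemma ReM z w : complex.Re (z * w) =
  complex.Re z * complex.Re w - complex.Im z * complex.Im w.
Proof. by case: z; case: w. Qed.
Lemma ImM z w : complex.Im (z * w) =
  complex.Re z * complex.Im w + complex.Im z * complex.Re w.
Proof. by case: z; case: w. Qed.
Lemma ReV z : complex.Re z^-1 =
  complex.Re z / (complex.Re z ^+ 2 + complex.Im z ^+ 2).
Proof. by case: z. Qed.
Lemma ImV z : complex.Im z^-1 =
  - complex.Im z / (complex.Re z ^+ 2 + complex.Im z ^+ 2).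
Proof. by case: z => a b /=; rewrite mulNr. Qed.

Definition ReImE := (ReD, ImD, ReN, ImN, ReM, ImM).

Lemma complex_ext z w : complex.Re z = complex.Re w ->
  complex.Im z = complex.Im w -> z = w.
Proof. by case: z; case: w => a b c d /= -> ->. Qed.

Lemma cmodE z : cmod z = Num.sqrt (complex.Re z ^+ 2 + complex.Im z ^+ 2).
Proof. by rewrite /cmod normc_def. Qed.
Lemma cmodC z : (cmod z)%:C = `|z|.
Proof. by rewrite /cmod normc_def. Qed.
Lemma sqr_cmod z : cmod z ^+ 2 = complex.Re z ^+ 2 + complex.Im z ^+ 2.
Proof. by rewrite cmodE sqr_sqrtr// addr_ge0// sqr_ge0. Qed.
Lemma cmod_ge0 z : 0 <= cmod z.
Proof. by rewrite cmodE sqrtr_ge0. Qed.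
Lemma cmodM z w : cmod (z * w) = cmod z * cmod w.
Proof. by apply: complexI; rewrite rmorphM/= !cmodC normrM. Qed.
Lemma cmodV z : cmod z^-1 = (cmod z)^-1.
Proof. by apply: complexI; rewrite fmorphV/= !cmodC normfV. Qed.
Lemma cmodX z n : cmod (z ^+ n) = cmod z ^+ n.
Proof. by apply: complexI; rewrite rmorphXn/= !cmodC normrX. Qed.
Lemma cmodD z w : cmod (z + w) <= cmod z + cmod w.
Proof. by rewrite -lecR rmorphD/= !cmodC ler_normD. Qed.
Lemma cmodN z : cmod (- z) = cmod z.
Proof. by rewrite /cmod normrN. Qed.
Lemma cmodB z w : cmod (z - w) = cmod (w - z).
Proof. by rewrite /cmod distrC. Qed.
Lemma cmod0 : cmod (0 : R[i]) = 0.
Proof. by rewrite /cmod normr0. Qed.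
Lemma cmod_eq0 z : (cmod z == 0) = (z == 0).
Proof. by rewrite -(inj_eq (@complexI R)) cmodC normr_eq0. Qed.
Lemma cmod_gt0 z : (0 < cmod z) = (z != 0).
Proof. by rewrite lt_neqAle cmod_ge0 andbT eq_sym cmod_eq0. Qed.
Lemma cmodR x : cmod x%:C = `|x|.
Proof. by rewrite cmodE/= expr0n/= addr0 sqrtr_sqr. Qed.
Lemma cmod_real x : 0 <= x -> cmod x%:C = x.
Proof. by move=> x0; rewrite cmodR ger0_norm. Qed.

Lemma absRe_le z : `|complex.Re z| <= cmod z.
Proof.
by rewrite cmodE -sqrtr_sqr ler_sqrt ?addr_ge0 ?sqr_ge0// lerDl sqr_ge0.
Qed.
Lemma absIm_le z : `|complex.Im z| <= cmod z.
Proof.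
by rewrite cmodE -sqrtr_sqr ler_sqrt ?addr_ge0 ?sqr_ge0// lerDr sqr_ge0.
Qed.
Lemma Re_le_cmod z : complex.Re z <= cmod z.
Proof. exact: le_trans (ler_norm _) (absRe_le z). Qed.
Lemma cmod_le z : cmod z <= `|complex.Re z| + `|complex.Im z|.
Proof.
rewrite cmodE -[leRHS]ger0_norm ?addr_ge0// -sqrtr_sqr ler_sqrt ?sqr_ge0//.
rewrite sqrrD !real_normK ?num_real// -addrA lerD2l lerDr mulrn_wge0//.
Qed.

Lemma cmod_cexp z : cmod (cexp z) = expR (complex.Re z).
Proof.
rewrite cmodE/= !exprMn -mulrDr cos2Dsin2 mulr1 sqrtr_sqr.
by rewrite ger0_norm ?expR_ge0.
Qed.
Lemma cexpD z w : cexp (z + w) = cexp z * cexp w.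
Proof.
case: z => a b; case: w => c d; apply: complex_ext;
  by rewrite /= expRD (cosD, sinD); ring.
Qed.
Lemma cexp0 : cexp (0 : R[i]) = 1.
Proof. by rewrite /cexp/= expR0 cos0 sin0 mulr1 mulr0. Qed.
Lemma cexpR x : cexp x%:C = (expR x)%:C.
Proof. by rewrite /cexp/= cos0 sin0 mulr1 mulr0. Qed.

End ComplexModulus.

(** * Integrals of complex-valued functions *)

Section IntegrableReal.
Context d (T : measurableType d) (R : realType) (mu : {measure set T -> \bar R}).
Context (D : set T) (mD : measurable D).

Lemma integrable_realZ (c : R) (f : T -> R) : mu.-integrable D (EFin \o f) ->
  mu.-integrable D (fun x => (c * f x)%:E).
Proof. by move=> fi; under eq_fun do rewrite EFinM; exact: integrableZl. Qed.

Lemma integrable_realD (f g : T -> R) : mu.-integrable D (EFin \o f) ->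
  mu.-integrable D (EFin \o g) -> mu.-integrable D (fun x => (f x + g x)%:E).
Proof. by move=> fi gi; under eq_fun do rewrite EFinD; exact: integrableD. Qed.

Lemma EFin_Rintegral (f : T -> R) : mu.-integrable D (EFin \o f) ->
  (\int[mu]_(x in D) f x)%:E = (\int[mu]_(x in D) (f x)%:E)%E.
Proof. by move=> fi; rewrite /Rintegral fineK// integrable_fin_num. Qed.

End IntegrableReal.

Section ComplexIntegral.
Context d (T : measurableType d) (R : realType) (mu : {measure set T -> \bar R}).
Implicit Types (D : set T) (f g : T -> R[i]) (u v : T -> R).

Definition cmeas D f : Prop :=
  measurable_fun D (fun x => complex.Re (f x)) /\
  measurable_fun D (fun x => complex.Im (f x)).

Definition cintble D f : Prop :=
  mu.-integrable D (fun x => (complex.Re (f x))%:E) /\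
  mu.-integrable D (fun x => (complex.Im (f x))%:E).

(** Defined over an arbitrary measure, because Fubini's theorem is needed for
    it on product spaces; for Lebesgue measure it is the complex integral in
    which Laplace transforms are expressed. *)
Definition cint D f : R[i] :=
  (\int[mu]_(x in D) complex.Re (f x)) +i* (\int[mu]_(x in D) complex.Im (f x)).

Lemma cmeasS D E f : measurable E -> D `<=` E -> cmeas E f -> cmeas D f.
Proof. by move=> mE DE [mR mI]; split; apply: measurable_funS mE DE _. Qed.

Lemma cmeas_cst D (c : R[i]) : cmeas D (fun _ => c).
Proof. by split; exact: measurable_cst. Qed.

Lemma cmeas_real D u : measurable_fun D u -> cmeas D (fun x => (u x)%:C).
Proof. by move=> mu_; split => //=; exact: measurable_cst. Qed.

Lemma cmeasD D f g : cmeas D f -> cmeas D g -> cmeas D (fun x => f x + g x).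
Proof.
move=> [fR fI] [gR gI]; split.
  under eq_fun do rewrite ReD; exact: measurable_funD.
by under eq_fun do rewrite ImD; exact: measurable_funD.
Qed.

Lemma cmeasN D f : cmeas D f -> cmeas D (fun x => - f x).
Proof.
move=> [fR fI]; split.
  under eq_fun do rewrite ReN; exact: measurable_funN.
by under eq_fun do rewrite ImN; exact: measurable_funN.
Qed.

Lemma cmeasB D f g : cmeas D f -> cmeas D g -> cmeas D (fun x => f x - g x).
Proof. by move=> ? ?; apply: cmeasD => //; exact: cmeasN. Qed.

Lemma cmeasM D f g : cmeas D f -> cmeas D g -> cmeas D (fun x => f x * g x).
Proof.
move=> [fR fI] [gR gI]; split.
  by under eq_fun do rewrite ReM; apply: measurable_funB; exact: measurable_funM.
by under eq_fun do rewrite ImM; apply: measurable_funD; exact: measurable_funM.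
Qed.

Lemma cmeas_cexp D f : cmeas D f -> cmeas D (fun x => cexp (f x)).
Proof.
move=> [fR fI]; split => /=; apply: measurable_funM.
- exact: measurableT_comp (@measurable_expR R) fR.
- exact: (measurableT_comp (continuous_measurable_fun (@continuous_cos R)) fI).
- exact: measurableT_comp (@measurable_expR R) fR.
- exact: (measurableT_comp (continuous_measurable_fun (@continuous_sin R)) fI).
Qed.

Lemma cmeas_sqr_cmod D f : cmeas D f -> measurable_fun D (fun x => cmod (f x) ^+ 2).
Proof.
move=> [fR fI]; under eq_fun do rewrite sqr_cmod.
by apply: measurable_funD; exact: measurable_funX.
Qed.

Lemma cmeas_cmod D f : cmeas D f -> measurable_fun D (fun x => cmod (f x)).
Proof.
move=> mf; under eq_fun do rewrite -(ger0_norm (cmod_ge0 _)) -sqrtr_sqr.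
apply: (measurableT_comp (continuous_measurable_fun (@sqrt_continuous R))).
exact: cmeas_sqr_cmod.
Qed.

Lemma cintble_meas D f : cintble D f -> cmeas D f.
Proof. by move=> [iR iI]; split; apply/measurable_EFinP/(measurable_int mu). Qed.

Lemma eq_cintble D f g : measurable D -> {in D, f =1 g} ->
  cintble D f -> cintble D g.
Proof.
by move=> mD fg [iR iI]; split; [move: iR|move: iI];
  apply: eq_integrable => // x xD; rewrite fg.
Qed.

Lemma cintble_le D f u : measurable D -> cmeas D f ->
  mu.-integrable D (EFin \o u) -> (forall x, D x -> cmod (f x) <= u x) ->
  cintble D f.
Proof.
move=> mD [fR fI] iu fu; split; apply: (le_integrable mD _ _ iu);
  do 1? [exact/measurable_EFinP]; move=> x /fu Dx /=;
  rewrite lee_fin (le_trans _ (le_trans Dx (ler_norm _)))//.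
  exact: absRe_le.
exact: absIm_le.
Qed.

Lemma cintble_cmod D f : measurable D -> cintble D f ->
  mu.-integrable D (fun x => (cmod (f x))%:E).
Proof.
move=> mD fi; have [fR fI] := fi.
have : mu.-integrable D
    (fun x => (`|complex.Re (f x)|%:E + `|complex.Im (f x)|%:E)%E).
  by apply: integrableD => //; exact: integrable_norm.
apply: le_integrable => //; first exact/measurable_EFinP/cmeas_cmod/cintble_meas.
move=> x Dx /=; rewrite lee_fin ger0_norm ?cmod_ge0// ger0_norm ?addr_ge0//.
exact: cmod_le.
Qed.

Lemma cintbleS D E f : measurable E -> measurable D -> D `<=` E ->
  cintble E f -> cintble D f.
Proof. by move=> mE mD DE [? ?]; split; apply: (integrableS mE mD DE). Qed.

Lemma cintble_real D u : mu.-integrable D (EFin \o u) ->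
  cintble D (fun x => (u x)%:C).
Proof. by move=> ui; split => //=; exact: integrable0. Qed.

Lemma cintbleD D f g : measurable D -> cintble D f -> cintble D g ->
  cintble D (fun x => f x + g x).
Proof.
move=> mD [fR fI] [gR gI]; split.
  by under eq_fun do rewrite ReD EFinD; exact: integrableD.
by under eq_fun do rewrite ImD EFinD; exact: integrableD.
Qed.

Lemma cintbleZ D (c : R[i]) f : measurable D -> cintble D f ->
  cintble D (fun x => c * f x).
Proof.
move=> mD fi; apply: (@cintble_le _ _ (fun x => cmod c * cmod (f x))) => //.
- by apply: cmeasM; [exact: cmeas_cst|exact: cintble_meas].
- rewrite /comp; under eq_fun do rewrite EFinM.
  exact/integrableZl/cintble_cmod.
- by move=> x _; rewrite cmodM.
Qed.

Lemma cintbleN D f : measurable D -> cintble D f -> cintble D (fun x => - f x).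
Proof.
by move=> mD /(cintbleZ (- 1) mD); under eq_fun do rewrite mulN1r.
Qed.

Lemma cintbleB D f g : measurable D -> cintble D f -> cintble D g ->
  cintble D (fun x => f x - g x).
Proof. by move=> mD fi gi; apply: cintbleD => //; exact: cintbleN. Qed.

Lemma cintbleM_bounded D f g (M : R) : measurable D -> cintble D f ->
  cmeas D g -> (forall x, D x -> cmod (g x) <= M) ->
  cintble D (fun x => g x * f x).
Proof.
move=> mD fi mg gM.
apply: (@cintble_le _ _ (fun x => M * cmod (f x))) => //.
- by apply: cmeasM => //; exact: cintble_meas.
- rewrite /comp; under eq_fun do rewrite EFinM.
  exact/integrableZl/cintble_cmod.
- by move=> x Dx; rewrite cmodM ler_wpM2r ?cmod_ge0// gM.
Qed.

Lemma eq_cint D f g : {in D, f =1 g} -> cint D f = cint D g.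
Proof.
by move=> fg; rewrite /cint; congr (_ +i* _); apply: eq_Rintegral => x xD;
  rewrite fg.
Qed.

Lemma cintD D f g : measurable D -> cintble D f -> cintble D g ->
  cint D (fun x => f x + g x) = cint D f + cint D g.
Proof.
move=> mD [fR fI] [gR gI]; apply: complex_ext; rewrite /= -RintegralD//.
  by apply: eq_Rintegral => x _; rewrite ReD.
by apply: eq_Rintegral => x _; rewrite ImD.
Qed.

Lemma cintZ D (c : R[i]) f : measurable D -> cintble D f ->
  cint D (fun x => c * f x) = c * cint D f.
Proof.
move=> mD [fR fI]; have iZ (k : R) h : mu.-integrable D (fun x => (h x)%:E) ->
    mu.-integrable D (EFin \o (fun x => k * h x)).
  by move=> hi; rewrite /comp; under eq_fun do rewrite EFinM; exact: integrableZl.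
apply: complex_ext; rewrite /= ReImE /=.
  rewrite -!RintegralZl// -RintegralB//; try exact: iZ.
  by apply: eq_Rintegral => x _; rewrite ReM.
rewrite -!RintegralZl// -RintegralD//; try exact: iZ.
by apply: eq_Rintegral => x _; rewrite ImM.
Qed.

Lemma cintZr D (c : R[i]) f : measurable D -> cintble D f ->
  cint D (fun x => f x * c) = cint D f * c.
Proof.
move=> mD fi; rewrite mulrC -cintZ//; apply: eq_cint => x _.
by rewrite mulrC.
Qed.

Lemma cintN D f : measurable D -> cintble D f ->
  cint D (fun x => - f x) = - cint D f.
Proof.
move=> mD fi; rewrite -mulN1r -cintZ//; apply: eq_cint => x _.
by rewrite mulN1r.
Qed.

Lemma cintB D f g : measurable D -> cintble D f -> cintble D g ->
  cint D (fun x => f x - g x) = cint D f - cint D g.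
Proof.
by move=> mD fi gi; rewrite cintD ?cintN//; exact: cintbleN.
Qed.

Lemma cint_real D u : cint D (fun x => (u x)%:C) = (\int[mu]_(x in D) u x)%:C.
Proof. by apply: complex_ext => //=; rewrite /Rintegral integral0. Qed.

(** Rotating the integral onto the positive half-line turns its modulus into
    the integral of a real part. *)
Lemma cmod_cint_le D f : measurable D -> cintble D f ->
  cmod (cint D f) <= \int[mu]_(x in D) cmod (f x).
Proof.
move=> mD fi; set z := cint D f; have [z0|z0] := eqVneq z 0.
  by rewrite z0 cmod0 Rintegral_ge0// => x _; exact: cmod_ge0.
have cz0 : 0 < cmod z by rewrite cmod_gt0.
have fmi := cintble_cmod mD fi.
rewrite -(ler_pM2l cz0) -RintegralZl//.
have -> : cmod z * cmod z = complex.Re (conjc z * z).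
  by rewrite -expr2 sqr_cmod; case: (z) => a b /=; rewrite mulNr opprK !expr2.
rewrite {2}/z -cintZ//=; apply: le_Rintegral => //.
- by have [] := cintbleZ (conjc z) mD fi.
- by rewrite /comp; under eq_fun do rewrite EFinM; exact: integrableZl.
- move=> x _; rewrite (le_trans (Re_le_cmod _))// cmodM.
  by rewrite (_ : cmod (conjc z) = cmod z)// !cmodE; case: (z) => a b /=; rewrite sqrrN.
Qed.

Lemma cint_mkcond D f : cint D f = cint setT (fun x => if x \in D then f x else 0).
Proof.
apply: complex_ext; rewrite /= Rintegral_mkcond; apply: eq_Rintegral => x _;
  by rewrite patchE; case: ifP.
Qed.

Lemma cintble_mkcond D f : measurable D ->
  cintble D f <-> cintble setT (fun x => if x \in D then f x else 0).
Proof.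
move=> mD; rewrite /cintble !(integrable_mkcond _ mD).
suff E (p : R[i] -> R) : p 0 = 0 -> ((fun x => (p (f x))%:E) \_ D) =
   (fun x => (p (if x \in D then f x else 0))%:E) by rewrite !E.
by move=> p0; apply/funext => x; rewrite patchE; case: ifP => // _; rewrite p0.
Qed.

Lemma cmeas_mkcond D f : measurable D ->
  cmeas D f -> cmeas setT (fun x => if x \in D then f x else 0).
Proof.
move=> mD [mR mI].
have E (p : R[i] -> R) : p 0 = 0 -> measurable_fun D (fun x => p (f x)) ->
    measurable_fun setT (fun x => p (if x \in D then f x else 0)).
  move=> p0 mp; have -> : (fun x => p (if x \in D then f x else 0)) =
      (fun x => p (f x)) \_ D.
    by apply/funext => x; rewrite patchE; case: ifP => // _; rewrite p0.
  exact/(measurable_restrictT _ mD).1.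
by split; exact: E.
Qed.

End ComplexIntegral.

Section Fubini.
Context d1 d2 (T1 : measurableType d1) (T2 : measurableType d2) (R : realType).
Context (m1 : {sigma_finite_measure set T1 -> \bar R})
          (m2 : {sigma_finite_measure set T2 -> \bar R}).

Lemma Rintegrable_fubini (f : T1 * T2 -> R) :
  (m1 \x m2)%E.-integrable setT (EFin \o f) ->
  m1.-integrable setT (fun x => (\int[m2]_y f (x, y))%:E).
Proof.
move=> fi; have Fi := integrable_fubini_F fi.
have mF := measurable_int _ Fi.
apply: (le_integrable measurableT _ _ Fi).
  by apply/measurable_EFinP; apply: (measurableT_comp (fine_measurable measurableT)).
by move=> x _; rewrite /Rintegral /fubini_F/=;
  case: (integral _ _ _) => [r| |] //=; rewrite ?normr0// leey.
Qed.

Lemma Rintegral_fubiniE (f : T1 * T2 -> R) :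
  (m1 \x m2)%E.-integrable setT (EFin \o f) ->
  (\int[m1]_x (\int[m2]_y f (x, y))%:E = \int[m1]_x \int[m2]_y (f (x, y))%:E)%E.
Proof.
move=> fi; have Fi := integrable_fubini_F fi.
apply: ae_eq_integral => //.
- exact: measurable_int (Rintegrable_fubini fi).
- exact: measurable_int Fi.
- have := integrable_ae measurableT Fi; apply: filterS => x /(_ I) Fx _.
  by rewrite fineK.
Qed.
End Fubini.

Lemma integrable_swap d1 d2 (T1 : measurableType d1) (T2 : measurableType d2)
    (R : realType) (m1 : {sigma_finite_measure set T1 -> \bar R})
    (m2 : {sigma_finite_measure set T2 -> \bar R}) (f : T1 * T2 -> R) :
  (m1 \x m2)%E.-integrable setT (EFin \o f) ->
  (m2 \x m1)%E.-integrable setT (fun z => (f (z.2, z.1))%:E).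
Proof.
move=> fi; have mf := measurable_int _ fi.
have mf' : measurable_fun setT (fun z : T2 * T1 => (f (z.2, z.1))%:E).
  apply: (measurableT_comp mf).
  by apply/measurable_fun_pairP; split;
    [exact: measurable_snd|exact: measurable_fst].
by apply/(integrable12ltyP _ _ mf'); exact/(integrable21ltyP _ _ mf).1.
Qed.

Section ComplexFubini.
Context d1 d2 (T1 : measurableType d1) (T2 : measurableType d2) (R : realType).
Context (m1 : {sigma_finite_measure set T1 -> \bar R})
          (m2 : {sigma_finite_measure set T2 -> \bar R}).
Implicit Type f : T1 * T2 -> R[i].

Lemma Rintegral_fubini (f : T1 * T2 -> R) :
  (m1 \x m2)%E.-integrable setT (EFin \o f) ->
  \int[m1]_x \int[m2]_y f (x, y) = \int[m2]_y \int[m1]_x f (x, y).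
Proof.
move=> fi; rewrite [LHS]/Rintegral [RHS]/Rintegral; congr fine.
rewrite Rintegral_fubiniE//.
by rewrite (Rintegral_fubiniE (integrable_swap fi)) (Fubini fi).
Qed.

Lemma cintble_prod f (U : T1 * T2 -> R) : cmeas setT f ->
  measurable_fun setT U -> (forall z, cmod (f z) <= U z) ->
  (\int[m1]_x \int[m2]_y (U (x, y))%:E < +oo)%E ->
  cintble (m1 \x m2)%E setT f.
Proof.
move=> mf mU fU Uoo.
apply: (@cintble_le _ _ _ _ _ _ U) => //.
have mU' : measurable_fun setT (EFin \o U) by exact/measurable_EFinP.
apply/(integrable12ltyP _ _ mU').
have U0 z : 0 <= U z by exact: le_trans (cmod_ge0 _) (fU z).
by under eq_integral do under eq_integral do rewrite /= ger0_norm//.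
Qed.

Lemma cintble_fubini f : cintble (m1 \x m2)%E setT f ->
  cintble m1 setT (fun x => cint m2 setT (fun y => f (x, y))).
Proof.
case=> fR fI; split.
  exact: (@Rintegrable_fubini _ _ _ _ _ m1 m2 (fun z => complex.Re (f z))).
exact: (@Rintegrable_fubini _ _ _ _ _ m1 m2 (fun z => complex.Im (f z))).
Qed.

Lemma cint_fubini f : cintble (m1 \x m2)%E setT f ->
  cint m1 setT (fun x => cint m2 setT (fun y => f (x, y))) =
  cint m2 setT (fun y => cint m1 setT (fun x => f (x, y))).
Proof.
case=> fR fI; apply: complex_ext.
  exact: (@Rintegral_fubini (fun z => complex.Re (f z))).
exact: (@Rintegral_fubini (fun z => complex.Im (f z))).
Qed.

Lemma cintble_swap f : cintble (m1 \x m2)%E setT f ->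
  cintble (m2 \x m1)%E setT (fun z => f (z.2, z.1)).
Proof.
case=> fR fI; split.
  exact: (@integrable_swap _ _ _ _ _ _ _ (fun z => complex.Re (f z))).
exact: (@integrable_swap _ _ _ _ _ _ _ (fun z => complex.Im (f z))).
Qed.

End ComplexFubini.

Section MeasurableSection.
Context d1 d2 (T1 : measurableType d1) (T2 : measurableType d2) (R : realType).
Context (m2 : {sigma_finite_measure set T2 -> \bar R}).

(** Splitting into positive and negative parts reduces the signed case to
    Tonelli. *)
Lemma measurable_Rintegral_param (f : T1 * T2 -> R) : measurable_fun setT f ->
  (forall x, m2.-integrable setT (fun y => (f (x, y))%:E)) ->
  measurable_fun setT (fun x => \int[m2]_y f (x, y)).
Proof.
move=> mf fi.
have pi_ x : m2.-integrable setT (fun y => (f^\+ (x, y))%:E).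
  by have := integrable_funrpos measurableT (fi x); rewrite /comp.
have ni x : m2.-integrable setT (fun y => (f^\- (x, y))%:E).
  by have := integrable_funrneg measurableT (fi x); rewrite /comp.
have -> : (fun x => \int[m2]_y f (x, y)) =
    (fun x => \int[m2]_y f^\+ (x, y) - \int[m2]_y f^\- (x, y)).
  apply/funext => x; rewrite -(RintegralB measurableT (pi_ x) (ni x)).
  by apply: eq_Rintegral => y _; rewrite -[in LHS](funrposBneg f).
apply: measurable_funB; apply: (measurableT_comp (fine_measurable measurableT)).
  apply: (@measurable_fun_fubini_tonelli_F _ _ _ _ _ m2 (EFin \o f^\+)).
    by apply/measurable_EFinP; exact: measurable_funrpos.
  by move=> z; rewrite lee_fin.
apply: (@measurable_fun_fubini_tonelli_F _ _ _ _ _ m2 (EFin \o f^\-)).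
  by apply/measurable_EFinP; exact: measurable_funrneg.
by move=> z; rewrite lee_fin.
Qed.

Lemma cmeas_cint_param (f : T1 * T2 -> R[i]) : cmeas setT f ->
  (forall x, cintble m2 setT (fun y => f (x, y))) ->
  cmeas setT (fun x => cint m2 setT (fun y => f (x, y))).
Proof.
move=> [mR mI] fi; split.
  apply: (@measurable_Rintegral_param (fun z => complex.Re (f z))) => // x.
  by have [] := fi x.
apply: (@measurable_Rintegral_param (fun z => complex.Im (f z))) => // x.
by have [] := fi x.
Qed.
End MeasurableSection.

(** * Translations, convolutions and Fubini over the plane *)

Section Translation.
Context {R : realType}.
Notation mu := (@lebesgue_measure R).

Lemma lebesgue_measure_shift (b : R) (A : set R) : measurable A ->
  pushforward mu ((fun x => x + b) : R -> measurableTypeR R) A = mu A.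
Proof.
have mb : measurable_fun setT (fun x : R => x + b) by exact: measurable_funD.
move=> mA; apply/esym; apply: lebesgue_measure_unique => // X [[x y] /= xy <-].
rewrite /pushforward.
have -> : (fun t => t + b) @^-1` `]x, y] = `]x - b, y - b]%classic.
  by apply/seteqP; split => t /=; rewrite !in_itv/= ltrBlDr lerBrDr.
rewrite !lebesgue_measure_itv/= !lte_fin ltrD2r.
by case: ifP => // _; rewrite -!EFinB; congr _%:E; ring.
Qed.

Lemma ge0_integral_shift (b : R) (f : R -> \bar R) :
  measurable_fun setT f -> (forall x, 0 <= f x)%E ->
  (\int[mu]_x f (x + b)%R = \int[mu]_x f x)%E.
Proof.
have mb : measurable_fun setT (fun x : R => x + b) by exact: measurable_funD.
move=> mf f0.
have := @ge0_integral_pushforward _ _ (measurableTypeR R) (measurableTypeR R) R _ mb mu setT f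
  measurableT mf.
rewrite preimage_setT => <-; last by move=> x _; exact: f0.
by apply: eq_measure_integral => A mA _; exact: lebesgue_measure_shift.
Qed.

Lemma integrable_shift (b : R) (f : R -> R) :
  mu.-integrable setT (EFin \o f) ->
  mu.-integrable setT (fun x => (f (x + b))%:E).
Proof.
have mb : measurable_fun setT (fun x : R => x + b) by exact: measurable_funD.
move=> /integrableP[mf foo]; apply/integrableP; split.
  exact: (measurableT_comp mf mb).
rewrite (ge0_integral_shift b (f := fun x => `|(EFin \o f) x|%E))//.
exact: measurableT_comp.
Qed.

Lemma Rintegral_shift (b : R) (f : R -> R) : mu.-integrable setT (EFin \o f) ->
  \int[mu]_x f (x + b) = \int[mu]_x f x.
Proof.
have mb : measurable_fun setT (fun x : R => x + b) by exact: measurable_funD.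
move=> fi; rewrite /Rintegral; congr fine.
have := @integral_pushforward _ _ (measurableTypeR R) (measurableTypeR R) R _ mb mu setT
  (fun x => (f x)%:E) (measurable_int _ fi).
rewrite preimage_setT => /(_ (integrable_shift b fi) measurableT) <-.
by apply: eq_measure_integral => A mA _; exact: lebesgue_measure_shift.
Qed.

Lemma cintble_shift (b : R) (f : R -> R[i]) : cintble mu setT f ->
  cintble mu setT (fun x => f (x + b)).
Proof. by case=> fR fI; split; [move: fR|move: fI] => /integrable_shift; exact. Qed.

Lemma cint_shift (b : R) (f : R -> R[i]) : cintble mu setT f ->
  cint mu setT (fun x => f (x + b)) = cint mu setT f.
Proof.
case=> fR fI; apply: complex_ext => /=.
  exact: (Rintegral_shift b (f := fun x => complex.Re (f x))).
exact: (Rintegral_shift b (f := fun x => complex.Im (f x))).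
Qed.

End Translation.

Section MeasurablePlane.
Context {R : realType}.

Lemma measurable_on_fst (f : R -> R) : measurable_fun setT f ->
  measurable_fun setT (fun z : R * R => f z.1).
Proof. by move=> mf; exact: (measurableT_comp mf measurable_fst). Qed.

Lemma measurable_on_snd (f : R -> R) : measurable_fun setT f ->
  measurable_fun setT (fun z : R * R => f z.2).
Proof. by move=> mf; exact: (measurableT_comp mf measurable_snd). Qed.

Lemma cmeas_on_fst (f : R -> R[i]) : cmeas setT f ->
  cmeas setT (fun z : R * R => f z.1).
Proof.
by move=> [mR mI]; split; [exact: (measurable_on_fst mR)|exact: (measurable_on_fst mI)].
Qed.

Lemma cmeas_on_snd (f : R -> R[i]) : cmeas setT f ->
  cmeas setT (fun z : R * R => f z.2).
Proof.
by move=> [mR mI]; split; [exact: (measurable_on_snd mR)|exact: (measurable_on_snd mI)].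
Qed.

End MeasurablePlane.

Section FubiniPlane.
Context {R : realType}.
Notation mu := (@lebesgue_measure R).

Lemma tonelli_plane (f : R -> R -> \bar R) :
  measurable_fun setT (fun z : R * R => f z.1 z.2) ->
  (forall x y, 0 <= f x y)%E ->
  (\int[mu]_x \int[mu]_y f x y = \int[mu]_y \int[mu]_x f x y)%E.
Proof.
by move=> mf f0; exact: (@fubini_tonelli _ _ _ _ _ mu mu (fun z : R * R => f z.1 z.2)).
Qed.

Lemma cintble_plane (f : R -> R -> R[i]) (U : R -> R -> R) :
  cmeas setT (fun z : R * R => f z.1 z.2) ->
  measurable_fun setT (fun z : R * R => U z.1 z.2) ->
  (forall x y, cmod (f x y) <= U x y) ->
  (\int[mu]_x \int[mu]_y (U x y)%:E < +oo)%E ->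
  cintble (mu \x mu)%E setT (fun z : R * R => f z.1 z.2).
Proof.
move=> mf mU fU Uoo.
by apply: (@cintble_prod _ _ _ _ _ mu mu _ (fun z : R * R => U z.1 z.2)).
Qed.

Lemma cint_plane (f : R -> R -> R[i]) :
  cintble (mu \x mu)%E setT (fun z : R * R => f z.1 z.2) ->
  cint mu setT (fun x => cint mu setT (fun y => f x y)) =
  cint mu setT (fun y => cint mu setT (fun x => f x y)).
Proof.
exact: (@cint_fubini _ _ _ _ _ mu mu (fun z : R * R => f z.1 z.2)).
Qed.

Lemma cintble_plane1 (f : R -> R -> R[i]) :
  cintble (mu \x mu)%E setT (fun z : R * R => f z.1 z.2) ->
  cintble mu setT (fun x => cint mu setT (fun y => f x y)).
Proof.
exact: (@cintble_fubini _ _ _ _ _ mu mu (fun z : R * R => f z.1 z.2)).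
Qed.

Lemma cmeas_cint_plane (f : R -> R -> R[i]) :
  cmeas setT (fun z : R * R => f z.1 z.2) ->
  (forall x, cintble mu setT (fun y => f x y)) ->
  cmeas setT (fun x => cint mu setT (fun y => f x y)).
Proof.
exact: (@cmeas_cint_param _ _ (measurableTypeR R) (measurableTypeR R) R mu
  (fun z => f z.1 z.2)).
Qed.

End FubiniPlane.

Lemma cintble_plane_prod {R : realType} (f : R -> R -> R[i]) (U V : R -> R) :
  cmeas setT (fun z : R * R => f z.1 z.2) ->
  (forall x y, cmod (f x y) <= U x * V y) ->
  (forall x, 0 <= U x) -> (forall y, 0 <= V y) ->
  (@lebesgue_measure R).-integrable setT (EFin \o U) ->
  (@lebesgue_measure R).-integrable setT (EFin \o V) ->
  cintble (lebesgue_measure \x lebesgue_measure)%E setT (fun z : R * R => f z.1 z.2).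
Proof.
move=> mf fUV U0 V0 iU iV.
have mU : measurable_fun setT U by apply/measurable_EFinP; exact: measurable_int iU.
have mV : measurable_fun setT V by apply/measurable_EFinP; exact: measurable_int iV.
apply: (cintble_plane (U := fun x y => U x * V y)) => //.
  by apply: measurable_funM; [exact: measurable_on_fst|exact: measurable_on_snd].
have E x : (\int[@lebesgue_measure R]_y (U x * V y)%:E =
    (U x)%:E * \int[lebesgue_measure]_y (V y)%:E)%E.
  under eq_integral do rewrite EFinM.
  rewrite ge0_integralZl//; first exact/measurable_EFinP.
    by move=> y _; rewrite lee_fin.
  by rewrite lee_fin.
under eq_integral => x _ do rewrite E.
rewrite ge0_integralZr//; last 3 first.
- exact/measurable_EFinP.
- by move=> x _; rewrite lee_fin.
- by apply: integral_ge0 => x _; rewrite lee_fin.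
rewrite lte_mul_pinfty//.
- by apply: integral_ge0 => x _; rewrite lee_fin.
- exact: integrable_fin_num.
- exact: integrable_lty.
Qed.

Section Convolution.
Context {R : realType}.
Notation mu := (@lebesgue_measure R).
Implicit Types f g : R -> R[i].

Lemma cmeas_conv f g : cmeas setT f -> cmeas setT g ->
  cmeas setT (fun z : R * R => f (z.1 - z.2) * g z.2).
Proof.
move=> [fR fI] [gR gI].
have mB : measurable_fun setT (fun z : R * R => z.1 - z.2).
  by apply: measurable_funB; [exact: measurable_fst|exact: measurable_snd].
apply: cmeasM; split.
- exact: (measurableT_comp fR mB).
- exact: (measurableT_comp fI mB).
- exact: (measurableT_comp gR measurable_snd).
- exact: (measurableT_comp gI measurable_snd).
Qed.

Lemma ge0_integral_conv (f g : R -> R) : measurable_fun setT f ->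
  measurable_fun setT g -> (forall x, 0 <= f x) -> (forall x, 0 <= g x) ->
  (\int[mu]_x \int[mu]_y (f (x - y) * g y)%:E =
   (\int[mu]_x (f x)%:E) * \int[mu]_x (g x)%:E)%E.
Proof.
move=> mf mg f0 g0.
have mB : measurable_fun setT (fun z : R * R => z.1 - z.2).
  by apply: measurable_funB; [exact: measurable_fst|exact: measurable_snd].
rewrite (tonelli_plane (f := fun x y => (f (x - y) * g y)%:E))//=.
- under eq_integral => y _.
    under eq_integral do rewrite EFinM muleC.
    rewrite ge0_integralZl//; last 3 first.
      apply/measurable_EFinP; apply: (measurableT_comp mf).
      exact: measurable_funB.
      by move=> x _; rewrite lee_fin.
      by rewrite lee_fin.
    rewrite (ge0_integral_shift (- y) (f := fun x => (f x)%:E)); last 2 first.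
      exact/measurable_EFinP.
      by move=> x; rewrite lee_fin.
    rewrite muleC.
  over.
  rewrite ge0_integralZl//; first exact/measurable_EFinP.
  by move=> x _; rewrite lee_fin.
  by apply: integral_ge0 => x _; rewrite lee_fin.
- apply/measurable_EFinP; apply: measurable_funM.
    exact: (measurableT_comp mf mB).
  exact: (measurableT_comp mg measurable_snd).
- by move=> x y; rewrite lee_fin mulr_ge0.
Qed.

Lemma cintble_conv f g : cintble mu setT f -> cintble mu setT g ->
  cintble (mu \x mu)%E setT (fun z : R * R => f (z.1 - z.2) * g z.2).
Proof.
move=> fi gi; have mf := cintble_meas fi; have mg := cintble_meas gi.
apply: (@cintble_plane _ (fun x y => f (x - y) * g y)
  (fun x y => cmod (f (x - y)) * cmod (g y))).
- exact: cmeas_conv.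
- have := cmeas_cmod (cmeas_conv mf mg).
  by under eq_fun do rewrite cmodM.
- by move=> x y; rewrite cmodM.
- rewrite (ge0_integral_conv (f := fun x => cmod (f x)) (g := fun x => cmod (g x)));
    try by move=> x; exact: cmod_ge0.
  + have fin h : cintble mu setT h -> (\int[mu]_x (cmod (h x))%:E < +oo)%E.
      by move=> hi; apply: integrable_lty => //; exact: cintble_cmod.
    by rewrite lte_mul_pinfty//; [apply: integral_ge0 => x _; rewrite lee_fin cmod_ge0|
      rewrite ge0_fin_numE ?fin// integral_ge0// => x _; rewrite lee_fin cmod_ge0|exact: fin].
  + exact: cmeas_cmod.
  + exact: cmeas_cmod.
Qed.

Lemma cint_conv f g : cintble mu setT f -> cintble mu setT g ->
  cint mu setT (fun x => cint mu setT (fun y => f (x - y) * g y)) =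
  cint mu setT f * cint mu setT g.
Proof.
move=> fi gi.
rewrite (cint_plane (f := fun x y => f (x - y) * g y)); last exact: cintble_conv.
under [LHS]eq_cint => y _.
  rewrite /= cintZr//; last exact: (cintble_shift (- y) fi).
  rewrite (cint_shift (- y) fi).
over.
by rewrite cintZ.
Qed.
End Convolution.

(** * Derivatives of real and of complex functions of a real variable *)

Section RealDerivative.
Context {R : realType}.
Implicit Types (u v : R -> R) (x a b : R).

Lemma rderivD u v x a b : is_derive x 1 u a -> is_derive x 1 v b ->
  is_derive x 1 (fun t => u t + v t) (a + b).
Proof. by move=> du dv; exact: (is_deriveD du dv). Qed.

Lemma rderivB u v x a b : is_derive x 1 u a -> is_derive x 1 v b ->
  is_derive x 1 (fun t => u t - v t) (a - b).
Proof. by move=> du dv; exact: (is_deriveB du dv). Qed.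

Lemma rderivN u x a : is_derive x 1 u a -> is_derive x 1 (fun t => - u t) (- a).
Proof. by move=> du; exact: (is_deriveN du). Qed.

Lemma rderivM u v x a b : is_derive x 1 u a -> is_derive x 1 v b ->
  is_derive x 1 (fun t => u t * v t) (u x * b + a * v x).
Proof.
move=> du dv; have -> : (fun t => u t * v t) = u * v by [].
have -> : u x * b + a * v x = u x *: b + v x *: a.
  by rewrite /GRing.scale/= [a * _]mulrC.
exact: is_deriveM.
Qed.

Lemma rderivZ (c : R) u x a : is_derive x 1 u a ->
  is_derive x 1 (fun t => c * u t) (c * a).
Proof.
move=> du; have := rderivM (is_derive_cst c x 1) du.
by rewrite mul0r addr0.
Qed.

Lemma rderivV u x a : u x != 0 -> is_derive x 1 u a ->
  is_derive x 1 (fun t => (u t)^-1) (- a / u x ^+ 2).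
Proof.
move=> u0 du; apply: (is_derive_eq (is_deriveV u0 du)).
by rewrite /GRing.scale/= mulNr mulNr mulrC.
Qed.

Lemma rderiv_comp u v x a b : is_derive (v x) 1 u a -> is_derive x 1 v b ->
  is_derive x 1 (fun t => u (v t)) (a * b).
Proof. by move=> du dv; exact: (is_derive1_comp du dv). Qed.

Lemma rderiv_exp u x a : is_derive x 1 u a ->
  is_derive x 1 (fun t => expR (u t)) (expR (u x) * a).
Proof. exact: rderiv_comp. Qed.

Lemma rderiv_continuous u x a : is_derive x 1 u a -> {for x, continuous u}.
Proof.
by move=> [du _]; apply: differentiable_continuous; exact/derivable1_diffP.
Qed.

End RealDerivative.

Section ComplexDerivative.
Context {R : realType}.
Implicit Types (f g : R -> R[i]) (x t : R) (k l : R[i]).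

Definition cderiv f x l : Prop :=
  is_derive x 1 (fun t => complex.Re (f t)) (complex.Re l) /\
  is_derive x 1 (fun t => complex.Im (f t)) (complex.Im l).

Lemma cderiv_eq f x k l : k = l -> cderiv f x k -> cderiv f x l.
Proof. by move=> ->. Qed.

Lemma cderiv_cst x k : cderiv (fun _ => k) x 0.
Proof. by split; exact: is_derive_cst. Qed.

Lemma cderiv_real (u : R -> R) x (l : R) : is_derive x 1 u l ->
  cderiv (fun t => (u t)%:C) x l%:C.
Proof. by move=> du; split => //=; exact: is_derive_cst. Qed.

Lemma cderiv_id x : cderiv (fun t => t%:C) x 1.
Proof. by apply: (cderiv_real (u := id)); exact: is_derive_id. Qed.

Lemma cderivD f g x k l : cderiv f x k -> cderiv g x l ->
  cderiv (fun t => f t + g t) x (k + l).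
Proof.
move=> [fR fI] [gR gI]; split; rewrite ?ReImE;
  under eq_fun do rewrite ?ReImE; exact: is_deriveD.
Qed.

Lemma cderivN f x k : cderiv f x k -> cderiv (fun t => - f t) x (- k).
Proof.
move=> [fR fI]; split; rewrite ?ReImE;
  under eq_fun do rewrite ?ReImE; exact: is_deriveN.
Qed.

Lemma cderivM f g x k l : cderiv f x k -> cderiv g x l ->
  cderiv (fun t => f t * g t) x (f x * l + k * g x).
Proof.
move=> [fR fI] [gR gI]; split; rewrite !ReImE; under eq_fun do rewrite !ReImE.
  apply: (is_derive_eq (rderivB (rderivM fR gR) (rderivM fI gI))).
  by ring.
apply: (is_derive_eq (rderivD (rderivM fR gI) (rderivM fI gR))).
by ring.
Qed.

Lemma cderivZ (c : R[i]) f x k : cderiv f x k ->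
  cderiv (fun t => c * f t) x (c * k).
Proof.
move=> df; apply: cderiv_eq (cderivM (cderiv_cst x c) df).
by rewrite mul0r addr0.
Qed.

Lemma cderivV f x k : f x != 0 -> cderiv f x k ->
  cderiv (fun t => (f t)^-1) x (- k / f x ^+ 2).
Proof.
move=> fx0 [fR fI].
have n0 : complex.Re (f x) ^+ 2 + complex.Im (f x) ^+ 2 != 0.
  by rewrite -sqr_cmod sqrf_eq0 cmod_eq0.
have n1 : complex.Re (f x) * complex.Re (f x) +
    complex.Im (f x) * complex.Im (f x) != 0 by rewrite -!expr2.
have dn := rderivD (rderivM fR fR) (rderivM fI fI).
have {}dn := rderivV (u := fun t => _) n1 dn.
have dR := rderivM fR dn.
have dI := rderivM (rderivN fI) dn.
split.
  under eq_fun do rewrite ReV !expr2.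
  apply: (is_derive_eq dR).
  rewrite ReM ReV ImV ReN ImN.
  move: n0; rewrite !expr2 !ReM !ImM.
  move: (complex.Re (f x)) (complex.Im (f x)) => a b n0.
  have -> : (a * a - b * b) * (a * a - b * b) + (a * b + b * a) * (a * b + b * a)
    = (a * a + b * b) ^+ 2 by ring.
  by field; rewrite n0.
under eq_fun do rewrite ImV !expr2.
apply: (is_derive_eq dI).
rewrite ImM ReV ImV ReN ImN.
move: n0; rewrite !expr2 !ReM !ImM.
move: (complex.Re (f x)) (complex.Im (f x)) => a b n0.
have -> : (a * a - b * b) * (a * a - b * b) + (a * b + b * a) * (a * b + b * a)
  = (a * a + b * b) ^+ 2 by ring.
by field; rewrite n0.
Qed.

Lemma cderiv_cexp f x k : cderiv f x k ->
  cderiv (fun t => cexp (f t)) x (k * cexp (f x)).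
Proof.
move=> [fR fI].
have dc := rderiv_comp (is_derive_cos _) fI.
have ds := rderiv_comp (is_derive_sin _) fI.
split; rewrite /= ?ReImE/=.
  apply: (is_derive_eq (rderivM (rderiv_exp fR) dc)).
  by ring.
apply: (is_derive_eq (rderivM (rderiv_exp fR) ds)).
by ring.
Qed.

Lemma cderiv_continuous f x k : cderiv f x k ->
  {for x, continuous (fun t => complex.Re (f t))} /\
  {for x, continuous (fun t => complex.Im (f t))}.
Proof.
by move=> [[dR _] [dI _]]; split; apply: differentiable_continuous;
  exact/derivable1_diffP.
Qed.

End ComplexDerivative.

(** * Integration of derivatives over the half-line *)

Section HalfLine.
Context {R : realType}.
Notation mu := (@lebesgue_measure R).
Implicit Types (f F : R -> R).

Lemma cvg_integral_halfline f : mu.-integrable `[0, +oo[ (EFin \o f) ->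
  (\int[mu]_(x in `[0%R, n.+1%:R]) f x) @[n --> \oo] -->
    \int[mu]_(x in `[0%R, +oo[) f x.
Proof.
move=> fi; have mf : measurable_fun (`[0, +oo[ : set R) f.
  by apply/measurable_EFinP; exact: (measurable_int _ fi).
have sub (n : nat) : `[0, n.+1%:R]%classic `<=` (`[0, +oo[%classic : set R).
  by move=> x /=; rewrite !in_itv/= => /andP[-> _].
have fi0 : (\int[mu]_(x in `[0%R, +oo[) (f x)%:E)%E \is a fin_num.
  exact: integrable_fin_num.
have Hc : (\int[mu]_(x in `[0%R, +oo[)
    ((fun x => (f x)%:E) \_ (`[0%R, n.+1%:R%R] : set R)) x)%E @[n --> \oo] -->
    (\int[mu]_(x in `[0%R, +oo[) (f x)%:E)%E.
  apply: (@dominated_cvg _ _ _ mu _ _ _ _ (fun x => `|f x|%:E)) => //.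
  - move=> n; apply/(measurable_restrict _ _ _).1 => //.
    by apply: measurable_funS (measurable_int _ fi).
  - move=> x /=; rewrite in_itv/= andbT => x0.
    apply: cvg_near_cst.
    near=> n; rewrite patchE ifT// inE/= in_itv/= x0/=.
    by near: n; apply: filterS (nbhs_infty_ger x) => n /le_trans; apply;
      rewrite ler_nat.
  - exact: integrable_norm.
  - move=> n x _; rewrite patchE; case: ifP => _ //=.
    by rewrite normr0 lee_fin.
rewrite -(fineK fi0) in Hc; move/fine_cvg : Hc; apply: cvg_trans.
apply: near_eq_cvg.
apply: nearW => n /=; rewrite /Rintegral; congr fine.
by rewrite -integral_mkcondr setIC setIidl.
Unshelve. all: end_near. Qed.

Lemma FTC_halfline f F (l : R) :
  {within `[0, +oo[, continuous f} ->
  (forall x : R, 0 < x -> is_derive x 1 F (f x)) ->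
  F x @[x --> 0^'+] --> F 0 ->
  mu.-integrable `[0, +oo[ (EFin \o f) ->
  (F n%:R) @[n --> \oo] --> l ->
  \int[mu]_(x in `[0%R, +oo[) f x = l - F 0.
Proof.
move=> cf dF cF fi Fl.
have E (n : nat) : \int[mu]_(x in `[0%R, n.+1%:R]) f x = F n.+1%:R - F 0.
  rewrite /Rintegral (@continuous_FTC2 _ _ F)//.
  - apply: continuous_subspaceW cf => x /=.
    by rewrite !in_itv/= => /andP[-> _].
  - split => //.
    + by move=> x; rewrite in_itv/= => /andP[x0 _]; have [] := dF _ x0.
    + apply: cvg_at_left_filter; apply: rderiv_continuous (dF _ _) => //.
  - by move=> x; rewrite in_itv/= => /andP[x0 _]; rewrite derive1E; have [] := dF _ x0.
have L1 := cvg_integral_halfline fi.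
have L2 : (F n.+1%:R - F 0) @[n --> \oo] --> l - F 0.
  apply: cvgB; last exact: cvg_cst.
  by move: Fl; rewrite -(cvg_shiftS (fun n => F n%:R)).
have {}L2 : (\int[mu]_(x in `[0%R, n.+1%:R]) f x) @[n --> \oo] --> l - F 0.
  by apply: cvg_trans L2; apply: near_eq_cvg; apply: nearW => n; rewrite E.
exact: (cvg_unique _ L1 L2).
Qed.

End HalfLine.

Section ComplexHalfLine.
Context {R : realType}.
Notation mu := (@lebesgue_measure R).
Implicit Types (f F : R -> R[i]) (c x : R) (z : R[i]).

Definition ccontinuous f : Prop :=
  continuous (fun x => complex.Re (f x)) /\ continuous (fun x => complex.Im (f x)).

Lemma cderiv_ccontinuous f (f' : R -> R[i]) :
  (forall x, cderiv f x (f' x)) -> ccontinuous f.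
Proof. by move=> df; split => x; have [] := cderiv_continuous (df x). Qed.

Lemma ccontinuous_cmeas f (D : set R) : measurable D -> ccontinuous f -> cmeas D f.
Proof.
by move=> mD [cR cI]; split; apply: measurable_funTS;
  exact: continuous_measurable_fun.
Qed.

Lemma cvg_cmod0 (u : nat -> R[i]) : cmod (u n) @[n --> \oo] --> (0 : R) ->
  complex.Re (u n) @[n --> \oo] --> (0 : R) /\
  complex.Im (u n) @[n --> \oo] --> (0 : R).
Proof.
have sq (v : nat -> R) : (forall n, `|v n| <= cmod (u n)) ->
    cmod (u n) @[n --> \oo] --> (0 : R) -> v n @[n --> \oo] --> (0 : R).
  move=> vu u0; apply/cvgr0Pnorm_lt => e e0.
  move/cvgr0Pnorm_lt : u0 => /(_ e e0); apply: filterS => n.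
  by rewrite ger0_norm ?cmod_ge0//; exact: le_lt_trans (vu n).
by move=> u0; split; apply: sq u0 => n; [exact: absRe_le|exact: absIm_le].
Qed.

Lemma cint_FTC_halfline f F : 
  {within `[0, +oo[, continuous (fun x => complex.Re (f x))} ->
  {within `[0, +oo[, continuous (fun x => complex.Im (f x))} ->
  (forall x, 0 < x -> cderiv F x (f x)) ->
  complex.Re (F x) @[x --> 0^'+] --> complex.Re (F 0) ->
  complex.Im (F x) @[x --> 0^'+] --> complex.Im (F 0) ->
  cintble mu `[0, +oo[ f -> (cmod (F n%:R)) @[n --> \oo] --> (0 : R) ->
  cint mu `[0, +oo[ f = - F 0.
Proof.
move=> cR cI dF FR FI [iR iI] /cvg_cmod0[lR lI].
apply: complex_ext; rewrite /= ?ReN ?ImN -[RHS]sub0r.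
  by apply: (FTC_halfline cR _ FR iR lR) => x /dF[].
by apply: (FTC_halfline cI _ FI iI lI) => x /dF[].
Qed.

Lemma cint_FTC_halflineT f F : ccontinuous f ->
  (forall x, cderiv F x (f x)) ->
  cintble mu `[0, +oo[ f -> (cmod (F n%:R)) @[n --> \oo] --> (0 : R) ->
  cint mu `[0, +oo[ f = - F 0.
Proof.
move=> [cR cI] dF fi F0; apply: cint_FTC_halfline => //.
- exact: continuous_subspaceT.
- exact: continuous_subspaceT.
- by apply: cvg_at_right_filter; have [] := cderiv_continuous (dF 0).
- by apply: cvg_at_right_filter; have [] := cderiv_continuous (dF 0).
Qed.

Lemma cvg_expRM c : 0 < c -> expR (- (c * n%:R)) @[n --> \oo] --> (0 : R).
Proof.
move=> c0; apply/cvgr0Pnorm_lt => e e0.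
have := @cvgr_expR R; move/cvgr0Pnorm_lt => /(_ e e0)[M [_ HM]].
near=> n; apply: HM => /=.
rewrite mulrC -ltr_pdivrMr//; near: n; exact: nbhs_infty_gtr.
Unshelve. all: end_near. Qed.

Lemma rderiv_expM c x : is_derive x 1 (fun t => expR (- (c * t))) (- c * expR (- (c * x))).
Proof.
have dl : is_derive x 1 (fun t => - (c * t)) (- c).
  have := rderivN (rderivM (is_derive_cst c x 1) (is_derive_id x 1)).
  by rewrite mul0r addr0 mulr1.
by have := rderiv_exp dl; rewrite mulrC.
Qed.

Lemma continuous_expM c : continuous (fun t => expR (- (c * t))).
Proof. by move=> x; exact: rderiv_continuous (rderiv_expM c x). Qed.

Lemma ge0_integral_expM c : 0 < c ->
  (\int[mu]_(x in `[0%R, +oo[) (expR (- (c * x)))%:E = (c^-1)%:E)%E.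
Proof.
move=> c0.
have dF x : is_derive x 1 (fun t => - (c^-1 * expR (- (c * t)))) (expR (- (c * x))).
  have := rderivN (rderivM (is_derive_cst c^-1 x 1) (rderiv_expM c x)).
  by rewrite mul0r addr0 mulNr mulrN opprK mulrA mulVf ?gt_eqF// mul1r.
rewrite (@ge0_continuous_FTC2y _ _ (fun t => - (c^-1 * expR (- (c * t)))) _ 0).
- by rewrite mulr0 oppr0 expR0 mulr1 EFinN sub0e oppeK.
- by move=> x _; exact: expR_ge0.
- by apply: continuous_subspaceT; exact: continuous_expM.
- rewrite -oppr0; apply: cvgN; rewrite -[X in _ --> X](mulr0 c^-1).
  apply: cvgM; first exact: cvg_cst.
  apply/cvgr0Pnorm_lt => e e0.
  have := @cvgr_expR R; move/cvgr0Pnorm_lt => /(_ e e0)[M [_ HM]].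
  near=> x; apply: HM => /=.
  by rewrite mulrC -ltr_pdivrMr//; near: x; apply: nbhs_pinfty_gt; rewrite num_real.
- by move=> x _; have [] := dF x.
- by apply: cvg_at_right_filter; exact: rderiv_continuous (dF 0).
- by move=> x _; rewrite derive1E; have [] := dF x.
Unshelve. all: end_near. Qed.

Lemma integrable_expM c : 0 < c ->
  mu.-integrable `[0, +oo[ (fun x => (expR (- (c * x)))%:E).
Proof.
move=> c0; apply/integrableP; split.
  apply/measurable_EFinP/measurable_funTS.
  by apply: continuous_measurable_fun; exact: continuous_expM.
under eq_integral do rewrite /= ger0_norm ?expR_ge0//.
by rewrite ge0_integral_expM// ltry.
Qed.

Lemma Rintegral_expM c : 0 < c ->
  \int[mu]_(x in `[0%R, +oo[) expR (- (c * x)) = c^-1.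
Proof. by move=> c0; rewrite /Rintegral ge0_integral_expM. Qed.

Lemma xexp_le c x : 0 < c -> 0 <= x ->
  x * expR (- (c * x)) <= 2 / c * expR (- (c / 2 * x)).
Proof.
move=> c0 x0.
have -> : expR (- (c * x)) = expR (- (c / 2 * x)) * expR (- (c / 2 * x)).
  by rewrite -expRD; congr expR; field.
rewrite mulrA ler_wpM2r ?expR_ge0// expRN ler_pdivrMr ?expR_gt0//.
rewrite -ler_pdivrMl ?divr_gt0// invf_div.
apply: le_trans (expR_ge1Dx _); rewrite -[leLHS]add0r lerD//.
Qed.

Lemma integrable_xexpM c : 0 < c ->
  mu.-integrable `[0, +oo[ (fun x => (x * expR (- (c * x)))%:E).
Proof.
move=> c0; have c20 : 0 < c / 2 by rewrite divr_gt0.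
apply: (le_integrable _ _ _ (integrableZl _ (2 / c) (integrable_expM c20))) => //.
  apply/measurable_EFinP/measurable_funTS/measurable_funM => //.
  by apply: continuous_measurable_fun; exact: continuous_expM.
move=> x /=; rewrite in_itv/= andbT => x0.
rewrite lee_fin !ger0_norm ?mulr_ge0 ?expR_ge0//; first exact: xexp_le.
by rewrite invr_ge0 ltW.
Qed.

Lemma cderiv_expc z x : cderiv (fun t => cexp (- (z * t%:C))) x
  (- z * cexp (- (z * x%:C))).
Proof.
by apply: cderiv_cexp; have := cderivN (cderivZ z (cderiv_id x)); rewrite mulr1.
Qed.

Lemma Re_mulC z x : complex.Re (z * x%:C) = complex.Re z * x.
Proof. by rewrite ReM/= mulr0 subr0. Qed.

Lemma cmod_expc z x : cmod (cexp (- (z * x%:C))) = expR (- (complex.Re z * x)).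
Proof. by rewrite cmod_cexp ReN Re_mulC. Qed.

Lemma ccontinuous_expc z : ccontinuous (fun t => cexp (- (z * t%:C))).
Proof. exact: cderiv_ccontinuous (cderiv_expc z). Qed.

Lemma cintble_expc z : 0 < complex.Re z ->
  cintble mu `[0, +oo[ (fun x => cexp (- (z * x%:C))).
Proof.
move=> z0; apply: (cintble_le _ _ (integrable_expM z0)) => //.
  exact: ccontinuous_cmeas (ccontinuous_expc z).
by move=> x _; rewrite cmod_expc.
Qed.

Lemma cint_expc z : 0 < complex.Re z ->
  cint mu `[0, +oo[ (fun x => cexp (- (z * x%:C))) = z^-1.
Proof.
move=> z0; have zn0 : z != 0.
  by apply: contraTneq z0 => ->; rewrite ltxx.
rewrite (@cint_FTC_halflineT _ (fun x => - (z^-1 * cexp (- (z * x%:C))))).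
- by rewrite mulr0 oppr0 cexp0 mulr1 opprK.
- exact: ccontinuous_expc.
- move=> x; have := cderivN (cderivZ z^-1 (cderiv_expc z x)).
  by rewrite mulNr mulrN opprK mulrA mulVf// mul1r.
- exact: cintble_expc.
- have L : cmod z^-1 * expR (- (complex.Re z * n%:R)) @[n --> \oo] --> (0 : R).
    rewrite -[X in _ --> X](mulr0 (cmod z^-1)).
    by apply: cvgM; [exact: cvg_cst|exact: cvg_expRM].
  apply: cvg_trans L; apply: near_eq_cvg; apply: nearW => n.
  by rewrite cmodN cmodM cmod_expc.
Qed.

Lemma cintble_xexpc z : 0 < complex.Re z ->
  cintble mu `[0, +oo[ (fun x => x%:C * cexp (- (z * x%:C))).
Proof.
move=> z0; apply: (cintble_le _ _ (integrable_xexpM z0)) => //.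
  apply: cmeasM; first by apply: cmeas_real; exact: measurable_id.
  exact: ccontinuous_cmeas (ccontinuous_expc z).
move=> x /=; rewrite in_itv/= andbT => x0.
by rewrite cmodM cmod_expc cmod_real.
Qed.

Lemma cint_xexpc z : 0 < complex.Re z ->
  cint mu `[0, +oo[ (fun x => x%:C * cexp (- (z * x%:C))) = z ^- 2.
Proof.
move=> z0; have zn0 : z != 0.
  by apply: contraTneq z0 => ->; rewrite ltxx.
have dF x : cderiv (fun x => - ((z^-1 * x%:C + z ^- 2) * cexp (- (z * x%:C)))) x
    (x%:C * cexp (- (z * x%:C))).
  have d1 : cderiv (fun x => z^-1 * x%:C + z ^- 2) x z^-1.
    have := cderivD (cderivZ z^-1 (cderiv_id x)) (cderiv_cst x (z ^- 2)).
    by rewrite mulr1 addr0.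
  have := cderivN (cderivM d1 (cderiv_expc z x)); apply: cderiv_eq.
  by field.
rewrite (cint_FTC_halflineT _ dF).
- by rewrite !mulr0 add0r oppr0 cexp0 mulr1 opprK.
- by apply: cderiv_ccontinuous => x; apply: (cderivM (cderiv_id x) (cderiv_expc z x)).
- exact: cintble_xexpc.
- have c20 : 0 < complex.Re z / 2 by rewrite divr_gt0.
  pose B (n : nat) : R := cmod z^-1 * (2 / complex.Re z * expR (- (complex.Re z / 2 * n%:R)))
    + cmod (z ^- 2) * expR (- (complex.Re z * n%:R)).
  apply: (@squeeze_cvgr _ _ _ _ (fun _ => 0) B).
  + apply: nearW => n; rewrite cmod_ge0/= cmodN cmodM cmod_expc.
    rewrite (le_trans (ler_wpM2r (expR_ge0 _) (cmodD _ _)))// mulrDl lerD//.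
    rewrite cmodM cmod_real// -[leLHS]mulrA.
    by apply: ler_wpM2l; [exact: cmod_ge0|exact: xexp_le].
  + exact: cvg_cst.
  + rewrite /B -[X in _ --> X](addr0 0); apply: cvgD.
      rewrite -[X in _ --> X](mulr0 (cmod z^-1)); apply: cvgM; first exact: cvg_cst.
      rewrite -[X in _ --> X](mulr0 (2 / complex.Re z)).
      by apply: cvgM; [exact: cvg_cst|exact: cvg_expRM].
    rewrite -[X in _ --> X](mulr0 (cmod (z ^- 2))).
    by apply: cvgM; [exact: cvg_cst|exact: cvg_expRM].
Qed.

End ComplexHalfLine.

(** * Reflection and dominated convergence *)

Section Reflection.
Context {R : realType}.
Notation mu := (@lebesgue_measure R).

Lemma ge0_integral_reflect (b : R) (f : R -> \bar R) :
  measurable_fun setT f -> (forall x, 0 <= f x)%E ->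
  (\int[mu]_x f (b - x)%R = \int[mu]_x f x)%E.
Proof.
have mN : measurable_fun setT (fun x : R => - x) by exact: measurable_funN.
move=> mf f0.
have mfb : measurable_fun setT (fun x : R => f (b + x)).
  by apply: (measurableT_comp mf); exact: measurable_funD.
have := @ge0_integral_pushforward _ _ (measurableTypeR R) (measurableTypeR R) R _
  mN mu setT (fun x => f (b + x)) measurableT mfb.
rewrite preimage_setT => H.
rewrite -[LHS]H; last by move=> x _; exact: f0.
transitivity (\int[mu]_x f (b + x)%R)%E.
  by apply: eq_measure_integral => A mA _; exact: lebesgue_measureN.
by under eq_integral do rewrite addrC; exact: ge0_integral_shift.
Qed.

Lemma integrable_reflect (b : R) (f : R -> R) :
  mu.-integrable setT (EFin \o f) ->
  mu.-integrable setT (fun x => (f (b - x))%:E).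
Proof.
have mb : measurable_fun setT (fun x : R => b - x) by exact: measurable_funB.
move=> /integrableP[mf foo]; apply/integrableP; split.
  exact: (measurableT_comp mf mb).
rewrite (ge0_integral_reflect b (f := fun x => `|(EFin \o f) x|%E))//.
exact: measurableT_comp.
Qed.

Lemma Rintegral_reflect (b : R) (f : R -> R) : mu.-integrable setT (EFin \o f) ->
  \int[mu]_x f (b - x) = \int[mu]_x f x.
Proof.
have mN : measurable_fun setT (fun x : R => - x) by exact: measurable_funN.
move=> fi; rewrite /Rintegral; congr fine.
have fbi := integrable_shift b fi.
have := @integral_pushforward _ _ (measurableTypeR R) (measurableTypeR R) R _ mN mu setT
  (fun x => (f (x + b))%:E) (measurable_int _ fbi).
have E : (fun x => (f (b - x))%:E) = (fun x => (f (x + b))%:E) \o -%R.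
  by apply/funext => x /=; rewrite addrC.
rewrite preimage_setT -E => /(_ (integrable_reflect b fi) measurableT) <-.
transitivity (\int[mu]_x (f (x + b))%:E)%E.
  by apply: eq_measure_integral => A mA _; exact: lebesgue_measureN.
have := Rintegral_shift b fi; rewrite /Rintegral => H.
rewrite -[LHS]fineK ?integrable_fin_num// -[RHS]fineK ?integrable_fin_num//.
by rewrite H.
Qed.

Lemma cintble_reflect (b : R) (f : R -> R[i]) : cintble mu setT f ->
  cintble mu setT (fun x => f (b - x)).
Proof. by case=> fR fI; split; [move: fR|move: fI] => /(integrable_reflect b); exact. Qed.

Lemma Rintegral_split0 (f : R -> R) : mu.-integrable setT (EFin \o f) ->
  \int[mu]_x f x = \int[mu]_(x in `[0%R, +oo[) f x + \int[mu]_(x in `[0%R, +oo[) f (- x).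
Proof.
move=> fi.
have -> : (setT : set R) = `[0, +oo[%classic `|` `]-oo, 0[%classic.
  apply/seteqP; split => // x _; rewrite /= !in_itv/= andbT.
  by case: (leP 0 x) => ?; [left|right].
rewrite Rintegral_setU//; last 2 first.
  by apply: (integrableS _ _ _ fi) => //; exact: measurableU.
  by apply/disj_setPS => x [/=]; rewrite !in_itv/= andbT leNgt => /negP.
congr (_ + _).
have fNi : mu.-integrable setT (EFin \o (fun x => f (- x))).
  by have := integrable_reflect 0 fi; under eq_fun do rewrite sub0r.
rewrite -Rintegral_itv_obnd_cbnd; last exact: integrableS fNi.
rewrite [LHS]Rintegral_mkcond [RHS]Rintegral_mkcond.
rewrite -(Rintegral_reflect 0); last first.
  rewrite -restrict_EFin; apply/integrable_restrict => //.
  by rewrite setTI; exact: integrableS fi.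
apply: eq_Rintegral => x _; rewrite sub0r !patchE.
have -> : (- x \in (`]-oo, 0[%classic : set R)) = (x \in (`]0, +oo[%classic : set R)).
  by apply/idP/idP; rewrite !inE/= !in_itv/= oppr_lt0 andbT.
by [].
Qed.

Lemma cint_split0 (f : R -> R[i]) : cintble mu setT f ->
  cint mu setT f = cint mu `[0, +oo[ f + cint mu `[0, +oo[ (fun x => f (- x)).
Proof.
case=> fR fI; apply: complex_ext; rewrite ?ReImE/=.
  exact: (Rintegral_split0 (f := fun x => complex.Re (f x))).
exact: (Rintegral_split0 (f := fun x => complex.Im (f x))).
Qed.

End Reflection.

Section ComplexConvergence.
Context {R : realType}.
Implicit Types (u v : nat -> R[i]) (k l : R[i]).

Definition ccvg u l : Prop := cmod (u n - l) @[n --> \oo] --> (0 : R).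

Lemma ccvgP u l : ccvg u l <-> forall e : R, 0 < e -> \forall n \near \oo, cmod (u n - l) <= e.
Proof.
split=> [/cvgr0Pnorm_le H e /H|H].
  by apply: filterS => n; rewrite ger0_norm ?cmod_ge0.
apply/cvgr0Pnorm_le => e /H; apply: filterS => n.
by rewrite ger0_norm ?cmod_ge0.
Qed.

Lemma ccvg_ReIm u l : complex.Re (u n) @[n --> \oo] --> complex.Re l ->
  complex.Im (u n) @[n --> \oo] --> complex.Im l -> ccvg u l.
Proof.
move=> uR uI; apply/ccvgP => e e0; have e20 : 0 < e / 2 by rewrite divr_gt0.
move/cvgrPdist_le : uR => /(_ _ e20) uR; move/cvgrPdist_le : uI => /(_ _ e20) uI.
near=> n; apply: le_trans (cmod_le _) _.
rewrite [leRHS]splitr !ReImE lerD//.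
  by rewrite distrC; near: n.
by rewrite distrC; near: n.
Unshelve. all: end_near. Qed.

Lemma ccvg_unique u k l : ccvg u k -> ccvg u l -> k = l.
Proof.
move=> /ccvgP uk /ccvgP ul; apply/eqP; rewrite -subr_eq0 -cmod_eq0 eq_le cmod_ge0 andbT.
apply/ler_addgt0Pl => e e0; rewrite addr0; have e20 : 0 < e / 2 by rewrite divr_gt0.
have [n [h1 h2]] := filter_ex (filterI (uk _ e20) (ul _ e20)).
have -> : k - l = (u n - l) - (u n - k) by ring.
rewrite (le_trans (cmodD _ _))// cmodN [leRHS]splitr lerD//.
Qed.

Lemma cint_dominated d (T : measurableType d) (mu : {measure set T -> \bar R})
    (D : set T) (f_ : nat -> T -> R[i]) (f : T -> R[i]) (g : T -> R) :
  measurable D -> (forall n, cmeas D (f_ n)) ->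
  (forall x, D x -> ccvg (f_ ^~ x) (f x)) ->
  mu.-integrable D (EFin \o g) ->
  (forall n x, D x -> cmod (f_ n x) <= g x) ->
  ccvg (fun n => cint mu D (f_ n)) (cint mu D f).
Proof.
move=> mD mf ff gi fg.
have main (p : R[i] -> R) : (forall z, `|p z| <= cmod z) ->
    (forall z w, p (z - w) = p z - p w) ->
    (forall n, measurable_fun D (fun x => p (f_ n x))) ->
    (\int[mu]_(x in D) p (f_ n x)) @[n --> \oo] --> \int[mu]_(x in D) p (f x).
  move=> pb pD mp.
  have pf x : D x -> p (f_ n x) @[n --> \oo] --> p (f x).
    move=> /ff fx; apply/cvgrPdist_le => e e0.
    move/ccvgP : fx => /(_ e e0); apply: filterS => n.
    by apply: le_trans; rewrite distrC -pD; exact: pb.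
  have mpf : measurable_fun D (fun x => p (f x)).
    by apply: (measurable_fun_cvg (h := fun n x => p (f_ n x))).
  have pfg x : D x -> `|p (f x)| <= g x.
    move=> Dx; have : `|p (f_ n x)| @[n --> \oo] --> `|p (f x)|.
      by apply: cvg_norm; exact: pf.
    move=> /cvg_lim <-//; apply: limr_le.
      by apply/cvg_ex; exists `|p (f x)|; apply: cvg_norm; exact: pf.
    by apply: nearW => n; exact: le_trans (pb _) (fg n x Dx).
  have Hi : mu.-integrable D (fun x => (p (f x))%:E).
    apply: (le_integrable mD _ _ gi); first exact/measurable_EFinP.
    by move=> x Dx /=; rewrite lee_fin (le_trans (pfg x Dx))// ler_norm.
  have H : (\int[mu]_(x in D) (p (f_ n x))%:E)%E @[n --> \oo] -->
      (\int[mu]_(x in D) (p (f x))%:E)%E.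
    apply: (@dominated_cvg _ _ _ mu D mD _ _ (EFin \o g)) => //.
    - by move=> n; exact/measurable_EFinP.
    - by move=> x Dx; apply: cvg_EFin; [exact: nearW|exact: pf].
    - by move=> n x Dx /=; rewrite lee_fin; exact: le_trans (pb _) (fg n x Dx).
  by rewrite -(fineK (integrable_fin_num mD Hi)) in H; exact: (fine_cvg H).
apply: ccvg_ReIm.
  by apply: main => [z|z w|n]; [exact: absRe_le|rewrite !ReImE|exact: (mf n).1].
by apply: main => [z|z w|n]; [exact: absIm_le|rewrite !ReImE|exact: (mf n).2].
Qed.

End ComplexConvergence.

(** * The Poisson kernel, Fourier inversion and Plancherel *)

Section Poisson.
Context {R : realType}.
Notation mu := (@lebesgue_measure R).
Implicit Types (x y e t w : R).

Definition osc x : R[i] := cexp (0 +i* x).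

Lemma cmod_osc x : cmod (osc x) = 1.
Proof. by rewrite cmod_cexp/= expR0. Qed.

Lemma oscD x y : osc (x + y) = osc x * osc y.
Proof. by rewrite /osc -cexpD; congr cexp; apply: complex_ext; rewrite ReImE/= ?addr0. Qed.

Lemma osc0 : osc 0 = 1. Proof. exact: cexp0. Qed.

Lemma cmeas_osc d (T : measurableType d) (D : set T) (u : T -> R) :
  measurable_fun D u -> cmeas D (fun s => osc (u s)).
Proof. by move=> mu_; apply: cmeas_cexp; split => //=; exact: measurable_cst. Qed.

Lemma cmod_conj (z : R[i]) : cmod (conjc z) = cmod z.
Proof. by rewrite !cmodE; case: z => a b /=; rewrite sqrrN. Qed.

Lemma conj_osc x : conjc (osc x) = osc (- x).
Proof. by rewrite /osc /cexp/= cosN sinN mulrN. Qed.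

Lemma cmeas_conj d (T : measurableType d) (D : set T) (f : T -> R[i]) :
  cmeas D f -> cmeas D (fun s => conjc (f s)).
Proof.
move=> [fR fI]; split.
  by have -> : (fun s => complex.Re (conjc (f s))) = (fun s => complex.Re (f s))
    by apply/funext => s; case: (f s).
have -> : (fun s => complex.Im (conjc (f s))) = (fun s => - complex.Im (f s))
  by apply/funext => s; case: (f s).
exact: measurable_funN.
Qed.

Definition pois e y : R := 2 * e / (e ^+ 2 + y ^+ 2).

Lemma pois_den_gt0 e y : 0 < e -> 0 < e ^+ 2 + y ^+ 2.
Proof. by move=> e0; rewrite ltr_wpDr ?sqr_ge0// exprn_gt0. Qed.

Lemma pois_ge0 e y : 0 < e -> 0 <= pois e y.
Proof. by move=> e0; rewrite divr_ge0 ?mulr_ge0 ?ltW ?pois_den_gt0// ltW. Qed.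

Lemma continuous_pois e : 0 < e -> continuous (pois e).
Proof.
move=> e0 y; have d0 : e ^+ 2 + y * y != 0 by rewrite -expr2 gt_eqF ?pois_den_gt0.
have d1 := rderivD (is_derive_cst (e ^+ 2) y 1) (rderivM (is_derive_id y 1) (is_derive_id y 1)).
have d2 := rderivM (is_derive_cst (2 * e) y 1) (rderivV (u := fun t => _) d0 d1).
exact: rderiv_continuous d2.
Qed.

Lemma ge0_integral_pois e : 0 < e -> (\int[mu]_y (pois e y)%:E = (2 * pi)%:E)%E.
Proof.
move=> e0; rewrite ge0_symfun_integralT//; last 3 first.
- by move=> y; exact: pois_ge0.
- exact: continuous_pois.
- by move=> y; rewrite /pois/= sqrrN.
have -> : [set x : R | 0 <= x] = `[0, +oo[%classic.
  by apply/seteqP; split => x/=; rewrite in_itv/= andbT.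
have dF y : is_derive y 1 (fun y => 2 * atan (e^-1 * y)) (pois e y).
  have d1 := rderivZ e^-1 (is_derive_id y 1).
  have d2 := rderiv_comp (is_derive1_atan _) d1.
  apply: (is_derive_eq (rderivZ 2 d2)).
  rewrite /pois mulr1 /=.
  have := pois_den_gt0 y e0; rewrite lt0r => /andP[d0 _].
  have d3 : 1 + (e^-1 * y) ^+ 2 != 0 by rewrite gt_eqF// ltr_wpDr ?sqr_ge0.
  have -> : 1 + (e^-1 * y) ^+ 2 = (e ^+ 2 + y ^+ 2) / e ^+ 2.
    by rewrite exprMn exprVn mulrDl divff ?expf_neq0 ?gt_eqF// [_ * y ^+ 2]mulrC.
  by field; rewrite d0 gt_eqF.
rewrite (@ge0_continuous_FTC2y _ _ (fun y => 2 * atan (e^-1 * y)) _ (2 * (pi / 2))).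
- by rewrite mulr0 atan0 mulr0 sube0 -EFinM; congr _%:E; field.
- by move=> y _; exact: pois_ge0.
- exact: continuous_subspaceT (continuous_pois e0).
- apply: cvgM; first exact: cvg_cst.
  apply: (cvg_comp _ _ _ (@cvgy_atan R)).
  by apply/cvgryPge => A; near=> y; rewrite ler_pdivlMl//.
- by move=> y _; have [] := dF y.
- by apply: cvg_at_right_filter; exact: rderiv_continuous (dF 0).
- by move=> y _; rewrite derive1E; have [] := dF y.
Unshelve. all: end_near. Qed.

Lemma integrable_pois e : 0 < e -> mu.-integrable setT (EFin \o pois e).
Proof.
move=> e0; apply/integrableP; split.
  apply/measurable_EFinP; apply: continuous_measurable_fun.
  exact: continuous_pois.
under eq_integral do rewrite /= ger0_norm ?pois_ge0//.
by rewrite ge0_integral_pois// ltry.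
Qed.

Lemma Rintegral_pois e : 0 < e -> \int[mu]_y pois e y = 2 * pi.
Proof. by move=> e0; rewrite /Rintegral ge0_integral_pois. Qed.

Lemma continuous_expNabs e : continuous (fun x => expR (- (e * `|x|))).
Proof.
move=> x; apply: continuous_comp; last exact: continuous_expR.
apply: continuousN; apply: continuousM; first exact: cst_continuous.
exact: norm_continuous.
Qed.

Lemma ge0_integral_expNabs e : 0 < e ->
  (\int[mu]_x (expR (- (e * `|x|)))%:E = (2 / e)%:E)%E.
Proof.
move=> e0; rewrite ge0_symfun_integralT//; last 2 first.
- exact: continuous_expNabs.
- by move=> x /=; rewrite normrN.
have -> : [set x : R | 0 <= x] = `[0, +oo[%classic.
  by apply/seteqP; split => x/=; rewrite in_itv/= andbT.
rewrite EFinM -(ge0_integral_expM e0); congr (_ * _)%E.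
apply: eq_integral => x; rewrite inE/= in_itv/= andbT => x0.
by rewrite ger0_norm.
Qed.

Lemma integrable_expNabs e : 0 < e ->
  mu.-integrable setT (fun x => (expR (- (e * `|x|)))%:E).
Proof.
move=> e0; apply/integrableP; split.
  apply/measurable_EFinP; apply: continuous_measurable_fun.
  exact: continuous_expNabs.
under eq_integral do rewrite /= ger0_norm ?expR_ge0//.
by rewrite ge0_integral_expNabs// ltry.
Qed.

Lemma cintble_osc_expNabs e y : 0 < e ->
  cintble mu setT (fun x => osc (x * y) * (expR (- (e * `|x|)))%:C).
Proof.
move=> e0; apply: (cintble_le _ _ (integrable_expNabs e0)) => //.
  apply: cmeasM; first by apply: cmeas_osc; exact: measurable_funM.
  apply: cmeas_real; apply: continuous_measurable_fun.
  exact: continuous_expNabs.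
by move=> x _; rewrite cmodM cmod_osc mul1r cmod_real ?expR_ge0.
Qed.

(** The two half-lines contribute 1/(e + iy) and its conjugate, whose sum is
    the Poisson kernel. *)
Lemma cint_osc_expNabs e y : 0 < e ->
  cint mu setT (fun x => osc (x * y) * (expR (- (e * `|x|)))%:C) = (pois e y)%:C.
Proof.
move=> e0; rewrite cint_split0; last exact: cintble_osc_expNabs.
have E1 : {in (`[0, +oo[%classic : set R),
    (fun x => osc (x * y) * (expR (- (e * `|x|)))%:C) =1
    (fun x => cexp (- ((e +i* (- y)) * x%:C)))}.
  move=> x; rewrite inE/= in_itv/= andbT => x0.
  rewrite ger0_norm// -cexpR -cexpD; congr cexp.
  by apply: complex_ext; rewrite !ReImE/=; ring.
have E2 : {in (`[0, +oo[%classic : set R),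
    (fun x => osc (- x * y) * (expR (- (e * `|- x|)))%:C) =1
    (fun x => cexp (- ((e +i* y) * x%:C)))}.
  move=> x; rewrite inE/= in_itv/= andbT => x0.
  rewrite normrN ger0_norm// -cexpR -cexpD; congr cexp.
  by apply: complex_ext; rewrite !ReImE/=; ring.
rewrite (@eq_cint _ _ _ mu _ _ _ E1) (@eq_cint _ _ _ mu _ _ _ E2) !cint_expc//.
have := pois_den_gt0 y e0; rewrite lt0r => /andP[d0 _].
apply: complex_ext; rewrite !ReImE ?ReV ?ImV/= ?sqrrN /pois; by field.
Qed.

End Poisson.

Section ApproximateIdentity.
Context {R : realType}.
Notation mu := (@lebesgue_measure R).

Lemma Rintegral_le_of_le (f g : R -> R) : measurable_fun setT f ->
  mu.-integrable setT (EFin \o g) -> (forall x, 0 <= f x <= g x) ->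
  mu.-integrable setT (EFin \o f) /\ \int[mu]_x f x <= \int[mu]_x g x.
Proof.
move=> mf gi fg; have fi : mu.-integrable setT (EFin \o f).
  apply: (le_integrable measurableT _ _ gi); first exact/measurable_EFinP.
  move=> x _ /=; have /andP[f0 fgx] := fg x.
  by rewrite lee_fin !ger0_norm// (le_trans f0).
by split => //; apply: le_Rintegral => // x _; have /andP[] := fg x.
Qed.

(** Split the error at distance d from u: inside, g is close to g(u); outside,
    g is bounded by M and the kernels have little mass. Two kernels are used,
    the Poisson kernel for Fourier inversion and the damping density for the
    final limit, whence the free mass m. *)
Lemma approx_identity (k : nat -> R -> R) (g : R -> R[i]) (m M u : R) :
  (forall n y, 0 <= k n y) -> (forall n, mu.-integrable setT (EFin \o k n)) ->
  (forall n, \int[mu]_y k n y = m) ->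
  (forall d : R, 0 < d -> exists2 tau : nat -> R, tau n @[n --> \oo] --> (0 : R) &
    forall n, \int[mu]_y (if d <= `|y| then k n y else 0) <= tau n) ->
  cmeas setT g -> (forall x, cmod (g x) <= M) ->
  (forall e : R, 0 < e -> exists2 d : R, 0 < d &
     forall x, `|x - u| < d -> cmod (g x - g u) <= e) ->
  ccvg (fun n => cint mu setT (fun t => (k n (u - t))%:C * g t)) (m%:C * g u).
Proof.
move=> k0 ki km ktail mg gM gc.
have m0 : 0 <= m by rewrite -(km 0%N); apply: Rintegral_ge0.
have M0 : 0 <= M by exact: le_trans (cmod_ge0 _) (gM u).
have kui n : cintble mu setT (fun t => (k n (u - t))%:C).
  by apply: cintble_real; exact: integrable_reflect.
have kgi n (h : R -> R[i]) (B : R) : cmeas setT h -> (forall x, cmod (h x) <= B) ->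
    cintble mu setT (fun t => (k n (u - t))%:C * h t).
  move=> mh hB; have := cintbleM_bounded measurableT (kui n) mh (fun x _ => hB x).
  by under eq_fun do rewrite mulrC.
apply/ccvgP => e e0.
pose e' := e / (2 * (m + 1)).
have e'0 : 0 < e' by rewrite divr_gt0// mulr_gt0// ltr_wpDl.
have [d d0 gd] := gc e' e'0.
have [tau tau0 kt] := ktail d d0.
have e''0 : 0 < e / (4 * (M + 1)) by rewrite divr_gt0// mulr_gt0// ltr_wpDl.
move/cvgr0Pnorm_le : tau0 => /(_ _ e''0); apply: filterS => n taun.
have -> : m%:C * g u = cint mu setT (fun t => (k n (u - t))%:C * g u).
  rewrite cintZr// cint_real; congr (_%:C * _).
  by rewrite (Rintegral_reflect u (f := k n)).
rewrite -cintB//; last 2 first.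
  exact: kgi gM.
  by apply: (kgi n _ M) => //; exact: cmeas_cst.
have kgui : cintble mu setT (fun t => (k n (u - t))%:C * (g t - g u)).
  apply: (kgi n _ (M + M)); first by apply: cmeasB => //; exact: cmeas_cst.
  by move=> x; rewrite (le_trans (cmodD _ _))// cmodN lerD.
rewrite (_ : cint _ _ _ = cint mu setT (fun t => (k n (u - t))%:C * (g t - g u))); last first.
  by apply: eq_cint => t _; rewrite mulrBr.
apply: le_trans (cmod_cint_le _ kgui) _ => //.
pose kd y := if d <= `|y| then k n y else 0.
have mk : measurable_fun setT (k n) by apply/measurable_EFinP; exact: measurable_int (ki n).
have mkd : measurable_fun setT kd.
  by apply: measurable_fun_ifT => //; apply: measurable_fun_ler.
have [kdi kdle] : mu.-integrable setT (EFin \o kd) /\ \int[mu]_y kd y <= m.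
  rewrite -(km n); apply: Rintegral_le_of_le => // x.
  by rewrite /kd; case: ifP => _; rewrite k0 ?lexx.
pose G y := e' * k n y + (M + M) * kd y.
have Gi : mu.-integrable setT (EFin \o G).
  by apply: integrable_realD => //; exact: integrable_realZ.
apply: (@le_trans _ _ (\int[mu]_y G y)).
  rewrite -(Rintegral_reflect u Gi); apply: le_Rintegral => //.
  - exact: cintble_cmod.
  - exact: integrable_reflect.
  - move=> t _; rewrite cmodM cmod_real// /G /kd; case: ifPn => [du|].
      apply: (@le_trans _ _ (k n (u - t) * (M + M))).
        rewrite ler_wpM2l//; apply: le_trans (cmodD _ _) _.
        by rewrite cmodN lerD.
      by rewrite [leRHS]addrC mulrC lerDl mulr_ge0// ltW.
    rewrite -ltNge => du; rewrite mulr0 addr0 mulrC ler_wpM2r//.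
    by apply: gd; rewrite distrC.
rewrite RintegralD//; last 2 first.
- exact: integrable_realZ.
- exact: integrable_realZ.
rewrite !RintegralZl// km [leRHS]splitr lerD//.
  rewrite /e' -mulrA ler_pM2l// ler_pdivrMl ?mulr_gt0// ?ltr_wpDl//.
  by lra.
apply: (@le_trans _ _ ((M + M) * (e / (4 * (M + 1))))).
  rewrite ler_wpM2l ?addr_ge0// (le_trans (kt n))//.
  by rewrite (le_trans (ler_norm _)).
have M1 : 0 < M + 1 by rewrite ltr_wpDl.
rewrite mulrA ler_pdivrMr ?mulr_gt0//.
by nra.
Qed.

End ApproximateIdentity.

Section FourierInversion.
Context {R : realType}.
Notation mu := (@lebesgue_measure R).

Lemma cvg_harmonicM (c : R) : c * n.+1%:R^-1 @[n --> \oo] --> (0 : R).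
Proof.
rewrite -[X in _ --> X](mulr0 c); apply: cvgM; first exact: cvg_cst.
exact: cvg_harmonic.
Qed.

Lemma pois_tail (d : R) : 0 < d -> exists2 tau : nat -> R,
  tau n @[n --> \oo] --> (0 : R) & forall n, 
    \int[mu]_y (if d <= `|y| then pois n.+1%:R^-1 y else 0) <= tau n.
Proof.
move=> d0; exists (fun n => (2 * pi * ((1 + d ^+ 2) / d ^+ 2)) * n.+1%:R^-1).
  exact: cvg_harmonicM.
move=> n; set e : R := n.+1%:R^-1; have e0 : 0 < e by rewrite invr_gt0.
have mp (c : R) : 0 < c -> measurable_fun setT (pois c).
  by move=> c0; apply: continuous_measurable_fun; exact: continuous_pois.
have dd0 : 0 < d ^+ 2 by rewrite exprn_gt0.
have K0 : 0 <= (1 + d ^+ 2) / d ^+ 2 by rewrite divr_ge0 ?addr_ge0 ?sqr_ge0.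
have mpd : measurable_fun setT (fun y : R => if d <= `|y| then pois e y else 0).
  by apply: measurable_fun_ifT; [apply: measurable_fun_ler|exact: mp|].
have pw y : 0 <= (if d <= `|y| then pois e y else 0) <=
    ((1 + d ^+ 2) / d ^+ 2 * e) * pois 1 y.
  case: ifPn => [dy|_]; last first.
    by rewrite lexx/= mulr_ge0 ?pois_ge0// mulr_ge0// ltW.
  rewrite pois_ge0//= /pois expr1n mulr1.
  have y2 : d ^+ 2 <= y ^+ 2.
    by rewrite -[leRHS]real_normK ?num_real// lerXn2r ?nnegrE// ltW.
  have p1 : 0 < e ^+ 2 + y ^+ 2 by exact: pois_den_gt0.
  have p2 : 0 < 1 + y ^+ 2 by rewrite ltr_wpDr ?sqr_ge0.
  have -> : (1 + d ^+ 2) / d ^+ 2 * e * (2 / (1 + y ^+ 2)) =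
    (2 * e) * ((1 + d ^+ 2) / (d ^+ 2 * (1 + y ^+ 2))).
    by field; rewrite !gt_eqF.
  rewrite ler_pM2l ?mulr_gt0// -div1r ler_pdivrMr// mulrAC ler_pdivlMr ?mulr_gt0// mul1r.
  have : 0 <= e ^+ 2 by rewrite sqr_ge0.
  by nra.
have [_ H] := Rintegral_le_of_le mpd
  (integrable_realZ measurableT _ (integrable_pois ltr01)) pw.
apply: le_trans H _; rewrite RintegralZl//; last exact: integrable_pois.
by rewrite Rintegral_pois// le_eqVlt; apply/orP; left; apply/eqP; ring.
Qed.

(** Inserting exp(-e|w|) in the outer integral replaces g by its Poisson
    average, by Fubini's theorem. Now e tends to 0: one side converges by
    dominated convergence, the other because the Poisson kernel is an
    approximate identity. *)
Lemma fourier_inversion (g : R -> R[i]) (M u : R) :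
  cintble mu setT g -> (forall x, cmod (g x) <= M) ->
  (forall e : R, 0 < e -> exists2 d : R, 0 < d &
     forall x, `|x - u| < d -> cmod (g x - g u) <= e) ->
  cintble mu setT (fun w => cint mu setT (fun t => osc (- (w * t)) * g t)) ->
  cint mu setT (fun w => osc (w * u) * cint mu setT (fun t => osc (- (w * t)) * g t))
    = (2 * pi)%:C * g u.
Proof.
move=> gi gM gc; set G := (fun w : R => cint mu setT (fun t => osc (- (w * t)) * g t)) => Gi.
have mg := cintble_meas gi.
pose I n := cint mu setT (fun w => (expR (- (n.+1%:R^-1 * `|w|)))%:C * (osc (w * u) * G w)).
have mosc (h : R -> R) : measurable_fun setT h -> cmeas setT (fun w => osc (h w)).
  exact: cmeas_osc.
have L1 : ccvg I (cint mu setT (fun w => osc (w * u) * G w)).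
  apply: (@cint_dominated _ _ _ mu setT
    (fun n w => (expR (- (n.+1%:R^-1 * `|w|)))%:C * (osc (w * u) * G w)) _
    (fun w => cmod (G w))).
  - exact: measurableT.
  - move=> n; apply: cmeasM.
      apply: cmeas_real; apply: continuous_measurable_fun; exact: continuous_expNabs.
    apply: cmeasM; last exact: cintble_meas Gi.
    by apply: mosc; exact: measurable_funM.
  - move=> w _; rewrite -[X in ccvg _ X]mul1r.
    have H : expR (- (n.+1%:R^-1 * `|w|)) @[n --> \oo] --> (1 : R).
      rewrite [X in _ --> X](_ : 1 = expR (- (0 * `|w|))); last first.
        by rewrite mul0r oppr0 expR0.
      apply: continuous_cvg; first exact: continuous_expR.
      apply: cvgN; apply: cvgM; last exact: cvg_cst.
      exact: cvg_harmonic.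
    have H2 : cmod (osc (w * u) * G w) * `|expR (- (n.+1%:R^-1 * `|w|)) - 1|
        @[n --> \oo] --> (0 : R).
      rewrite -[X in _ --> X](mulr0 (cmod (osc (w * u) * G w))).
      apply: cvgM; first exact: cvg_cst.
      have H3 : (expR (- (n.+1%:R^-1 * `|w|)) - 1) @[n --> \oo] --> (1 - 1 : R).
        by apply: cvgB => //; exact: cvg_cst.
      by move/cvg_norm : H3; rewrite subrr normr0.
    apply: cvg_trans H2; apply: near_eq_cvg; apply: nearW => n.
    by rewrite -mulrBl [RHS]cmodM mulrC -cmodR rmorphB rmorph1.
  - exact: cintble_cmod.
  - move=> n w _; rewrite !cmodM cmod_osc mul1r ler_piMl ?cmod_ge0//.
    by rewrite cmod_real ?expR_ge0// expR_le1 oppr_le0 mulr_ge0.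
have L2 : ccvg I ((2 * pi)%:C * g u).
  have H := @approx_identity _ (fun n => pois n.+1%:R^-1) g (2 * pi) M u
    _ _ _ pois_tail mg gM gc.
  apply: cvg_trans (H _ _ _); last 3 first.
  - by move=> n y; apply: pois_ge0; rewrite invr_gt0.
  - by move=> n; apply: integrable_pois; rewrite invr_gt0.
  - by move=> n; apply: Rintegral_pois; rewrite invr_gt0.
  apply: near_eq_cvg; apply: nearW => n; congr (cmod (_ - _)).
  set e : R := n.+1%:R^-1; have e0 : 0 < e by rewrite invr_gt0.
  pose h (w t : R) := (expR (- (e * `|w|)))%:C * (osc (w * (u - t)) * g t).
  transitivity (cint mu setT (fun t => cint mu setT (fun w => h w t))).
    apply: eq_cint => t _; rewrite /h.
    have -> : (fun w => (expR (- (e * `|w|)))%:C * (osc (w * (u - t)) * g t)) =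
        (fun w => (osc (w * (u - t)) * (expR (- (e * `|w|)))%:C) * g t).
      by apply/funext => w; ring.
    by rewrite cintZr//; [rewrite cint_osc_expNabs|exact: cintble_osc_expNabs].
  rewrite -cint_plane.
    apply: eq_cint => w _; rewrite /h /G -cintZ//; last first.
      apply: (cintbleM_bounded _ gi (M := 1)) => //.
        by apply: mosc; apply: measurable_funN; exact: measurable_funM.
      by move=> t _; rewrite cmod_osc.
    rewrite -cintZ//.
      apply: eq_cint => t _; rewrite mulrBr oscD; ring.
    apply: cintbleZ => //.
    apply: (cintbleM_bounded _ gi (M := 1)) => //.
      by apply: mosc; apply: measurable_funN; exact: measurable_funM.
    by move=> t _; rewrite cmod_osc.
  have mexp : measurable_fun setT (fun w : R => expR (- (e * `|w|))).
    by apply: continuous_measurable_fun; exact: continuous_expNabs.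
  apply: (cintble_plane_prod (U := fun w => expR (- (e * `|w|)))
    (V := fun t => cmod (g t))).
  - rewrite /h; apply: cmeasM.
      by apply: cmeas_real; exact: measurable_on_fst mexp.
    apply: cmeasM; last exact: cmeas_on_snd.
    apply: cmeas_osc; apply: measurable_funM; first exact: measurable_fst.
    by apply: measurable_funB => //; exact: measurable_snd.
  - by move=> w t; rewrite /h !cmodM cmod_osc mul1r cmod_real ?expR_ge0.
  - by move=> w; exact: expR_ge0.
  - by move=> t; exact: cmod_ge0.
  - exact: integrable_expNabs.
  - exact: cintble_cmod.
exact: ccvg_unique L1 L2.
Qed.

End FourierInversion.

Section Plancherel.
Context {R : realType}.
Notation mu := (@lebesgue_measure R).

Lemma measurable_mulr (t : R) : measurable_fun setT (fun w : R => w * t).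
Proof. exact: measurable_funM. Qed.

Lemma cintbleM_osc (F : R -> R[i]) (h : R -> R) : cintble mu setT F ->
  measurable_fun setT h -> cintble mu setT (fun w => F w * osc (h w)).
Proof.
move=> Fi mh; have mo := cmeas_osc mh.
have := cintbleM_bounded measurableT Fi mo (M := 1).
under eq_fun do rewrite mulrC; apply => w _.
by rewrite cmod_osc.
Qed.

Lemma cmeas_cint_osc (F : R -> R[i]) : cintble mu setT F ->
  cmeas setT (fun t => cint mu setT (fun w => F w * osc (w * t))).
Proof.
move=> Fi; have mF := cintble_meas Fi.
apply: (cmeas_cint_plane (f := fun t w => F w * osc (w * t))).
  apply: cmeasM; first exact: cmeas_on_snd.
  by apply: cmeas_osc; apply: measurable_funM;
    [exact: measurable_snd|exact: measurable_fst].
by move=> t /=; exact: cintbleM_osc Fi (measurable_mulr t).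
Qed.

(** With the weight exp(-e|t|) the quadratic integral of the Fourier transform
    of F is the quadratic form of the Poisson kernel at F, and that kernel has
    mass 2 pi. *)
Lemma plancherel_weighted (F : R -> R[i]) (e : R) : 0 < e ->
  cintble mu setT F -> mu.-integrable setT (fun w => (cmod (F w) ^+ 2)%:E) ->
  (\int[mu]_t (expR (- (e * `|t|)) *
     cmod (cint mu setT (fun w => F w * osc (w * t))) ^+ 2)%:E <=
   (2 * pi * \int[mu]_w cmod (F w) ^+ 2)%:E)%E.
Proof.
move=> e0 Fi F2i; have mF := cintble_meas Fi.
set f := fun t : R => cint mu setT (fun w => F w * osc (w * t)).
set L := \int[mu]_w cmod (F w).
have fL t : cmod (f t) <= L.
  apply: le_trans (cmod_cint_le _ _) _ => //.
    exact: cintbleM_osc Fi (measurable_mulr t).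
  rewrite le_eqVlt; apply/orP; left; apply/eqP; apply: eq_Rintegral => w _.
  by rewrite cmodM cmod_osc mulr1.
have L0 : 0 <= L by apply: Rintegral_ge0 => w _; exact: cmod_ge0.
have mf : cmeas setT f by exact: cmeas_cint_osc.
have mexp : measurable_fun setT (fun t : R => expR (- (e * `|t|))).
  by apply: continuous_measurable_fun; exact: continuous_expNabs.
pose g t := (expR (- (e * `|t|)))%:C * conjc (f t).
have mg : cmeas setT g by apply: cmeasM; [exact: cmeas_real|exact: cmeas_conj].
have gb t : cmod (g t) <= L * expR (- (e * `|t|)).
  by rewrite cmodM cmod_conj cmod_real ?expR_ge0// mulrC ler_wpM2r ?expR_ge0.
have Li : mu.-integrable setT (EFin \o (fun t : R => L * expR (- (e * `|t|)))).
  by apply: integrable_realZ => //; exact: integrable_expNabs.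
have gi : cintble mu setT g.
  by apply: (cintble_le _ _ Li) => // t _; exact: gb.
(* the weighted quadratic integral as a pairing of f with g *)
have E1 : (\int[mu]_t (expR (- (e * `|t|)) * cmod (f t) ^+ 2)) =
    complex.Re (cint mu setT (fun w => F w * cint mu setT (fun t => osc (w * t) * g t))).
  have -> : cint mu setT (fun w => F w * cint mu setT (fun t => osc (w * t) * g t)) =
      cint mu setT (fun w => cint mu setT (fun t => F w * osc (w * t) * g t)).
    apply: eq_cint => w _; rewrite -cintZ//; last first.
      have := cintbleM_osc gi (h := fun t => w * t) (measurable_funM (measurable_cst w) (@measurable_id _ _ _)).
      by under eq_fun do rewrite mulrC.
    by apply: eq_cint => t _; rewrite mulrA.
  rewrite cint_plane; last first.
    apply: (cintble_plane_prod (f := fun w t => F w * osc (w * t) * g t)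
      (U := fun w => cmod (F w))
      (V := fun t => L * expR (- (e * `|t|)))) => //.
    - apply: cmeasM; last exact: cmeas_on_snd.
      apply: cmeasM; first exact: cmeas_on_fst.
      by apply: cmeas_osc; apply: measurable_funM;
        [exact: measurable_fst|exact: measurable_snd].
    - by move=> w t; rewrite cmodM [cmod (F w * _)]cmodM cmod_osc mulr1 ler_wpM2l ?cmod_ge0.
    - by move=> w; exact: cmod_ge0.
    - by move=> t; rewrite mulr_ge0 ?expR_ge0.
    - exact: cintble_cmod.
  rewrite [RHS]/=; apply: eq_Rintegral => t _.
  transitivity (complex.Re (cint mu setT (fun w => F w * osc (w * t) * g t))); last by [].
  have -> : cint mu setT (fun w => F w * osc (w * t) * g t) = f t * g t.
    by rewrite cintZr//; exact: cintbleM_osc Fi (measurable_mulr t).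
  rewrite /g sqr_cmod; case: (f t) => a b /=; ring.
have Pi_ := integrable_pois e0.
(* the transform of g is the Poisson average of the conjugate of F *)
have E2 w : cint mu setT (fun t => osc (w * t) * g t) =
    cint mu setT (fun v => (pois e (w - v))%:C * conjc (F v)).
  have cf t : conjc (f t) = cint mu setT (fun v => conjc (F v) * osc (- (v * t))).
    have FI := (cintbleM_osc Fi (measurable_mulr t)).2.
    apply: complex_ext; rewrite /f /cint/=.
      apply: eq_Rintegral => v _; rewrite -conj_osc; case: (F v) => a b.
      by case: (osc _) => c d' /=; ring.
    rewrite -mulN1r -RintegralZl//; apply: eq_Rintegral => v _.
    rewrite -conj_osc; case: (F v) => a b.
    by case: (osc _) => c d' /=; ring.
  pose h (t v : R) := (osc (t * (w - v)) * (expR (- (e * `|t|)))%:C) * conjc (F v).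
  have Fci : cintble mu setT (fun v => conjc (F v)).
    apply: (cintble_le _ _ (cintble_cmod measurableT Fi)) => //.
      exact: cmeas_conj.
    by move=> v _; rewrite cmod_conj.
  transitivity (cint mu setT (fun t => cint mu setT (fun v => h t v))).
    apply: eq_cint => t _; rewrite /g cf mulrA -cintZ//; last first.
      by apply: cintbleM_osc => //; apply: measurable_funN; exact: measurable_mulr.
    apply: eq_cint => v _; rewrite /h mulrBr oscD [t * w]mulrC [t * v]mulrC; ring.
  rewrite cint_plane.
    apply: eq_cint => v _; rewrite /h cintZr//; first by rewrite cint_osc_expNabs.
    exact: cintble_osc_expNabs.
  apply: (cintble_plane_prod (f := h) (U := fun t => expR (- (e * `|t|)))
    (V := fun v => cmod (F v))).
  - apply: cmeasM; last exact: cmeas_on_snd (cmeas_conj mF).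
    apply: cmeasM; last by apply: cmeas_real; exact: measurable_on_fst mexp.
    apply: cmeas_osc; apply: measurable_funM; first exact: measurable_fst.
    by apply: measurable_funB => //; exact: measurable_snd.
  - move=> t v; rewrite /h !cmodM cmod_osc mul1r cmod_conj cmod_real ?expR_ge0//.
  - by move=> t; exact: expR_ge0.
  - by move=> v; exact: cmod_ge0.
  - exact: integrable_expNabs.
  - exact: cintble_cmod.
have LHSE : (\int[mu]_t (expR (- (e * `|t|)) * cmod (f t) ^+ 2)%:E =
    (\int[mu]_t (expR (- (e * `|t|)) * cmod (f t) ^+ 2))%:E)%E.
  rewrite /Rintegral fineK// integrable_fin_num//.
  apply: (Rintegral_le_of_le _ (integrable_realZ measurableT L Li) _).1.
    by apply: measurable_funM => //; exact: cmeas_sqr_cmod mf.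
  move=> t; rewrite mulr_ge0 ?expR_ge0 ?sqr_ge0// andTb.
  rewrite [leRHS]mulrA -expr2 [leLHS]mulrC.
  by rewrite ler_wpM2r ?expR_ge0// lerXn2r ?nnegrE ?cmod_ge0.
rewrite LHSE lee_fin E1.
have gti w : cintble mu setT (fun t => osc (w * t) * g t).
  have := cintbleM_osc gi (h := fun t => w * t)
    (measurable_funM (measurable_cst w) (@measurable_id _ _ _)).
  by under eq_fun do rewrite mulrC.
pose c w := cint mu setT (fun t => osc (w * t) * g t).
have mc : cmeas setT c.
  apply: (cmeas_cint_plane (f := fun w t => osc (w * t) * g t)) => //.
  apply: cmeasM; last exact: cmeas_on_snd.
  by apply: cmeas_osc; apply: measurable_funM;
    [exact: measurable_fst|exact: measurable_snd].
have cb w : cmod (c w) <= \int[mu]_t cmod (g t).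
  apply: le_trans (cmod_cint_le _ (gti w)) _ => //.
  rewrite le_eqVlt; apply/orP; left; apply/eqP; apply: eq_Rintegral => t _.
  by rewrite cmodM cmod_osc mul1r.
have Fci : cintble mu setT (fun w => F w * c w).
  have := cintbleM_bounded measurableT Fi mc (fun w _ => cb w).
  by under eq_fun do rewrite mulrC.
pose p2 (w : R) : \bar R := (\int[mu]_v (pois e (w - v) * cmod (F v) ^+ 2)%:E)%E.
have mF2 : measurable_fun setT (fun v : R => cmod (F v) ^+ 2) by exact: cmeas_sqr_cmod.
have mpois : measurable_fun setT (pois e).
  by apply: continuous_measurable_fun; exact: continuous_pois.
have mpv w : measurable_fun setT (fun v : R => pois e (w - v)).
  by apply: (measurableT_comp mpois); exact: measurable_funB.
have p20 w : (0 <= p2 w)%E.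
  by apply: integral_ge0 => v _; rewrite lee_fin mulr_ge0 ?sqr_ge0 ?pois_ge0.
have mp2 : measurable_fun setT p2.
  apply: (@measurable_fun_fubini_tonelli_F _ _ (measurableTypeR R) (measurableTypeR R)
    _ mu (fun z : R * R => (pois e (z.1 - z.2) * cmod (F z.2) ^+ 2)%:E)).
    apply/measurable_EFinP; apply: measurable_funM.
      apply: (measurableT_comp mpois); apply: measurable_funB;
        [exact: measurable_fst|exact: measurable_snd].
    exact: (measurable_on_snd mF2).
  by move=> z; rewrite lee_fin mulr_ge0 ?sqr_ge0 ?pois_ge0.
have Ip2 : (\int[mu]_w p2 w = (2 * pi * \int[mu]_w cmod (F w) ^+ 2)%:E)%E.
  rewrite /p2 (ge0_integral_conv (f := pois e) (g := fun v => cmod (F v) ^+ 2))//.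
  - rewrite ge0_integral_pois// [RHS]EFinM; congr (_ * _)%E.
    by rewrite /Rintegral fineK// integrable_fin_num.
  - by move=> y; exact: pois_ge0.
  - by move=> y; exact: sqr_ge0.
have Ipw w : (\int[mu]_v (pois e (w - v))%:E = (2 * pi)%:E)%E.
  rewrite (ge0_integral_reflect w (f := fun v => (pois e v)%:E)) ?ge0_integral_pois//.
    exact/measurable_EFinP.
  by move=> v; rewrite lee_fin pois_ge0.
(* the inequality 2 |F w| |F v| <= |F w|^2 + |F v|^2 separates the variables *)
have key w : ((cmod (F w * c w))%:E <=
    2^-1%:E * ((2 * pi * cmod (F w) ^+ 2)%:E + p2 w))%E.
  have pFi : cintble mu setT (fun v => (pois e (w - v))%:C * conjc (F v)).
    apply: (cintbleM_bounded (M := 2 / e)) => //.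
    - apply: (cintble_le _ _ (cintble_cmod measurableT Fi)) => //.
        exact: cmeas_conj.
      by move=> v _; rewrite cmod_conj.
    - exact: (cmeas_real (mpv w)).
    - move=> v _; rewrite cmod_real ?pois_ge0// /pois ler_pdivrMr ?pois_den_gt0//.
      rewrite mulrAC ler_pdivlMr// -mulrA -expr2 ler_wpM2l// lerDl sqr_ge0//.
  have cle : cmod (c w) <= \int[mu]_v cmod ((pois e (w - v))%:C * conjc (F v)).
    by rewrite /c E2; exact: cmod_cint_le.
  apply: (@le_trans _ _ (cmod (F w) * \int[mu]_v cmod ((pois e (w - v))%:C * conjc (F v)))%:E).
    by rewrite lee_fin cmodM ler_wpM2l ?cmod_ge0.
  rewrite EFinM /Rintegral fineK ?integrable_fin_num//; last exact: cintble_cmod pFi.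
  rewrite -ge0_integralZl//; last 3 first.
  - by apply/measurable_EFinP; exact: cmeas_cmod (cintble_meas pFi).
  - by move=> v _; rewrite lee_fin cmod_ge0.
  - by rewrite lee_fin cmod_ge0.
  have mpF : measurable_fun setT (fun v : R => pois e (w - v) * cmod (F v) ^+ 2).
    exact: measurable_funM (mpv w) mF2.
  have mpw : measurable_fun setT (fun v : R => pois e (w - v) * cmod (F w) ^+ 2).
    exact: measurable_funM (mpv w) (measurable_cst _).
  have -> : ((2 * pi * cmod (F w) ^+ 2)%:E + p2 w =
      \int[mu]_v ((pois e (w - v) * cmod (F w) ^+ 2)%:E +
        (pois e (w - v) * cmod (F v) ^+ 2)%:E))%E.
    rewrite ge0_integralD//.
    - under [X in _ = (X + _)%E]eq_integral do rewrite EFinM.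
      rewrite ge0_integralZr//.
      + by rewrite Ipw -EFinM.
      + by apply/measurable_EFinP; exact: mpv.
      + by move=> v _; rewrite lee_fin pois_ge0.
      + by rewrite lee_fin sqr_ge0.
    - by move=> v _; rewrite lee_fin mulr_ge0 ?pois_ge0 ?sqr_ge0.
    - by apply/measurable_EFinP; exact: mpw.
    - by move=> v _; rewrite lee_fin mulr_ge0 ?pois_ge0 ?sqr_ge0.
    - by apply/measurable_EFinP; exact: mpF.
  have mD : measurable_fun setT (fun v : R => ((pois e (w - v) * cmod (F w) ^+ 2)%:E +
        (pois e (w - v) * cmod (F v) ^+ 2)%:E)%E).
    by apply: emeasurable_funD; apply/measurable_EFinP; [exact: mpw|exact: mpF].
  rewrite -ge0_integralZl//; last first.
    by move=> v _; rewrite -EFinD lee_fin addr_ge0// mulr_ge0 ?pois_ge0 ?sqr_ge0.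
  apply: ge0_le_integral => //.
  - by move=> v _; rewrite -EFinM lee_fin mulr_ge0 ?cmod_ge0.
  - apply/measurable_EFinP; apply: measurable_funM => //.
    exact: cmeas_cmod (cintble_meas pFi).
  - exact: measurable_funeM.
  - move=> v _; rewrite -EFinM -EFinD -EFinM lee_fin cmodM cmod_conj cmod_real ?pois_ge0//.
    have := sqr_ge0 (cmod (F w) - cmod (F v)); have := pois_ge0 (w - v) e0.
    move: (pois e _) (cmod (F w)) (cmod (F v)) => p a b p0 ab.
    have -> : 2^-1 * (p * a ^+ 2 + p * b ^+ 2) = p * (2^-1 * (a ^+ 2 + b ^+ 2)) by ring.
    by rewrite mulrCA ler_wpM2l//; move: ab; rewrite sqrrB; lra.
rewrite -lee_fin; apply: (@le_trans _ _ (\int[mu]_w cmod (F w * c w))%:E).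
  by rewrite lee_fin (le_trans (Re_le_cmod _))//; exact: cmod_cint_le Fci.
rewrite EFin_Rintegral; [|exact: measurableT|exact: cintble_cmod Fci].
apply: (@le_trans _ _ (\int[mu]_w (2^-1%:E * ((2 * pi * cmod (F w) ^+ 2)%:E + p2 w)))%E).
  apply: ge0_le_integral => //.
  - by move=> w _; rewrite lee_fin cmod_ge0.
  - by apply/measurable_EFinP; exact: cmeas_cmod (cintble_meas Fci).
  - apply: measurable_funeM; apply: emeasurable_funD => //.
    by apply/measurable_EFinP; exact: measurable_funM.
rewrite ge0_integralZl//; last 2 first.
- apply: emeasurable_funD => //.
  by apply/measurable_EFinP; exact: measurable_funM.
- by move=> w _; rewrite adde_ge0// lee_fin mulr_ge0 ?sqr_ge0// mulr_ge0// pi_ge0.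
rewrite ge0_integralD//; last 2 first.
- by move=> w _; rewrite lee_fin mulr_ge0 ?sqr_ge0// mulr_ge0// pi_ge0.
- by apply/measurable_EFinP; exact: measurable_funM.
rewrite Ip2.
have -> : (\int[mu]_w (2 * pi * cmod (F w) ^+ 2)%:E =
    (2 * pi * \int[mu]_w cmod (F w) ^+ 2)%:E)%E.
  rewrite -RintegralZl// /Rintegral fineK// integrable_fin_num//.
  exact: integrable_realZ.
rewrite -EFinD -EFinM lee_fin; move: (2 * pi * _) => z.
by have -> : 2^-1 * (z + z) = z by field.
Qed.

Lemma limn_einf_le (u : nat -> \bar R) (c : \bar R) :
  (forall n, u n <= c)%E -> (limn_einf u <= c)%E.
Proof.
move=> uc; rewrite limn_einf_lim; apply: lime_le; first exact: is_cvg_einfs.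
apply: nearW => n; apply: le_trans (uc n).
by apply: ereal_inf_lbound; exists n => /=.
Qed.

(** Let the weight tend to 1. Fatou's lemma gives this inequality only, which
    is the half of Plancherel's theorem that bounds a function by its
    transform. *)
Lemma plancherel_le (F : R -> R[i]) :
  cintble mu setT F -> mu.-integrable setT (fun w => (cmod (F w) ^+ 2)%:E) ->
  (\int[mu]_t (cmod (cint mu setT (fun w => F w * osc (w * t))) ^+ 2)%:E <=
   (2 * pi * \int[mu]_w cmod (F w) ^+ 2)%:E)%E.
Proof.
move=> Fi F2i; set f := fun t : R => cint mu setT (fun w => F w * osc (w * t)).
have mf : cmeas setT f by exact: cmeas_cint_osc.
pose h (n : nat) (t : R) : \bar R := (expR (- (n.+1%:R^-1 * `|t|)) * cmod (f t) ^+ 2)%:E.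
have mh n : measurable_fun setT (h n).
  apply/measurable_EFinP; apply: measurable_funM; last exact: cmeas_sqr_cmod.
  by apply: continuous_measurable_fun; exact: continuous_expNabs.
have h0 n t : setT t -> (0 <= h n t)%E.
  by move=> _; rewrite lee_fin mulr_ge0 ?expR_ge0 ?sqr_ge0.
have := @fatou _ _ _ mu setT measurableT h mh h0.
have hlim t : limn_einf (h ^~ t) = (cmod (f t) ^+ 2)%:E.
  have H : h n t @[n --> \oo] --> (cmod (f t) ^+ 2)%:E.
    apply: cvg_EFin; first exact: nearW.
    rewrite -[X in _ --> X]mul1r; apply: cvgM; last exact: cvg_cst.
    rewrite [X in _ --> X](_ : 1 = expR (- (0 * `|t|))); last first.
      by rewrite mul0r oppr0 expR0.
    apply: continuous_cvg; first exact: continuous_expR.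
    apply: cvgN; apply: cvgM; last exact: cvg_cst.
    exact: cvg_harmonic.
  exact: (cvg_limn_einf_sup H).1.
under eq_integral do rewrite hlim.
move=> /le_trans; apply; apply: limn_einf_le => n.
by apply: plancherel_weighted => //; rewrite invr_gt0.
Qed.

End Plancherel.

(** * Shifting vertical lines of integration *)

Section LineShift.
Context {R : realType}.
Notation mu := (@lebesgue_measure R).

(** A Cauchy-Riemann equation turns the derivative of the integral of P over a
    segment into the variation of the conjugate function Q along it. *)
Lemma is_derive_segment_integral (P Q A : R -> R -> R) (u v c d M x : R) :
  c < d -> x \in `]u, v[ ->
  (forall x y : R, x \in `]u, v[ -> y \in `[c, d] -> is_derive x 1 (P ^~ y) (A x y)) ->
  (forall x y : R, x \in `]u, v[ -> y \in `[c, d] -> is_derive y 1 (Q x) (A x y)) ->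
  (forall x : R, x \in `]u, v[ -> {within `[c, d], continuous (P x)}) ->
  (forall x : R, x \in `]u, v[ -> {within `[c, d], continuous (A x)}) ->
  (forall x y : R, x \in `]u, v[ -> y \in `[c, d] -> `|A x y| <= M) ->
  is_derive x 1 (fun x => \int[mu]_(y in `[c, d]) P x y) (Q x d - Q x c).
Proof.
move=> cd xuv dP dQ cP cA AM.
have M0 : 0 <= M.
  by apply: le_trans (normr_ge0 _) (AM x c xuv _); rewrite in_itv/= lexx ltW.
have Ix : (`]u, v[%classic : set R) x by [].
have int_P (z : R) : (`]u, v[%classic : set R) z -> mu.-integrable `[c, d] (EFin \o P z).
  by move=> Iz; apply: continuous_compact_integrable; [exact: segment_compact|exact: cP].
have der_P (z y : R) : (`]u, v[%classic : set R) z -> `[c, d]%classic y ->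
    derivable (P^~ y) z 1.
  by move=> Iz Jy; have [] := dP z y Iz Jy.
have der_PA (z y : R) : (`]u, v[%classic : set R) z -> `[c, d]%classic y ->
    partial1of2 P z y = A z y.
  by move=> Iz Jy; rewrite partial1of2E; have [_ ->] := dP z y Iz Jy.
have int_M : mu.-integrable `[c, d] (EFin \o cst M).
  apply: continuous_compact_integrable; first exact: segment_compact.
  by apply: continuous_subspaceT; exact: cst_continuous.
have ub (z y : R) : (`]u, v[%classic : set R) z -> `[c, d]%classic y ->
    `|partial1of2 P z y| <= cst M y.
  by move=> Iz Jy; rewrite der_PA//; exact: AM.
have H1 := @derivable_under_integral R _ (measurableTypeR R) mu P `[c, d]%classic
  (measurable_itv _) x u v Ix int_P der_P (cst M)
  (fun _ => M0) int_M ub.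
have H2 := @differentiation_under_integral R _ (measurableTypeR R) mu P `[c, d]%classic
  (measurable_itv _) x u v Ix int_P der_P (cst M)
  (fun _ => M0) int_M ub.
apply: DeriveDef => //; rewrite -derive1E H2.
transitivity (\int[mu]_(y in `[c, d]) A x y).
  by apply: eq_Rintegral => y; rewrite inE => Jy; exact: der_PA.
rewrite /Rintegral (@continuous_FTC2 _ _ (Q x))//; first exact: cA.
- split.
  + move=> y /= yI; have yJ : y \in `[c, d] by exact: subset_itv_oo_cc yI.
    by have [] := dQ x y xuv yJ.
  + apply: cvg_at_right_filter; apply: rderiv_continuous (dQ x c xuv _).
    by rewrite in_itv/= lexx ltW.
  + apply: cvg_at_left_filter; apply: rderiv_continuous (dQ x d xuv _).
    by rewrite in_itv/= lexx ltW.
- move=> y yI; have yJ : y \in `[c, d] by exact: subset_itv_oo_cc yI.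
  by rewrite derive1E; have [_ ->] := dQ x y xuv yJ.
Qed.

Lemma cvg_integral_line (f : R -> R) : mu.-integrable setT (EFin \o f) ->
  (\int[mu]_(x in `[- n.+1%:R, n.+1%:R]) f x) @[n --> \oo] --> \int[mu]_x f x.
Proof.
move=> fi.
have fi0 : (\int[mu]_x (f x)%:E)%E \is a fin_num by exact: integrable_fin_num.
have Hc : (\int[mu]_x
    ((fun x => (f x)%:E) \_ (`[(- n.+1%:R)%R, n.+1%:R%R] : set R)) x)%E @[n --> \oo] -->
    (\int[mu]_x (f x)%:E)%E.
  apply: (@dominated_cvg _ _ _ mu _ _ _ _ (fun x => `|f x|%:E)) => //.
  - move=> n; apply/(measurable_restrict _ _ _).1 => //.
    by apply: measurable_funS (measurable_int _ fi).
  - move=> x _; apply: cvg_near_cst.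
    near=> n; rewrite patchE ifT// inE/= in_itv/= -ler_norml.
    by near: n; apply: filterS (nbhs_infty_ger `|x|) => n /le_trans; apply;
      rewrite ler_nat.
  - exact: integrable_norm.
  - move=> n x _; rewrite patchE; case: ifP => _ //=.
    by rewrite normr0 lee_fin.
rewrite -(fineK fi0) in Hc; move/fine_cvg : Hc; apply: cvg_trans.
apply: near_eq_cvg; apply: nearW => n /=.
by rewrite /Rintegral; congr fine; rewrite [RHS]integral_mkcond.
Unshelve. all: end_near. Qed.

(** The integral over a segment of the line has derivative Q(x, n) - Q(x, -n)
    in the abscissa x, which the majorant g makes small uniformly in x. *)
Lemma real_line_shift (P Q A : R -> R -> R) (u v M a b : R) (g : R -> R) :
  a <= b -> a \in `]u, v[ -> b \in `]u, v[ ->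
  (forall x y : R, x \in `]u, v[ -> is_derive x 1 (P ^~ y) (A x y)) ->
  (forall x y : R, x \in `]u, v[ -> is_derive y 1 (Q x) (A x y)) ->
  (forall x : R, x \in `]u, v[ -> continuous (P x)) ->
  (forall x : R, x \in `]u, v[ -> continuous (A x)) ->
  (forall x y : R, x \in `]u, v[ -> `|A x y| <= M) ->
  (forall x y : R, x \in `]u, v[ -> `|P x y| <= g y) ->
  (forall x y : R, x \in `]u, v[ -> `|Q x y| <= g y) ->
  mu.-integrable setT (EFin \o g) ->
  (g n.+1%:R) @[n --> \oo] --> (0 : R) -> (g (- n.+1%:R)) @[n --> \oo] --> (0 : R) ->
  \int[mu]_y P a y = \int[mu]_y P b y.
Proof.
move=> ab auv buv dP dQ cP cA AM Pg Qg gi g0 g0'.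
have sub x : x \in `[a, b] -> x \in `]u, v[.
  move: auv buv; rewrite !in_itv/= => /andP[ua _] /andP[_ bv] /andP[ax xb].
  by rewrite (lt_le_trans ua ax) (le_lt_trans xb bv).
have Pi_ x : x \in `]u, v[ -> mu.-integrable setT (EFin \o P x).
  move=> xuv; apply: (le_integrable measurableT _ _ gi).
    by apply/measurable_EFinP; apply: continuous_measurable_fun; exact: cP.
  by move=> y _ /=; rewrite lee_fin (le_trans (Pg x y xuv))// ler_norm.
pose Phi (d x : R) := \int[mu]_(y in `[- d, d]) P x y.
have dPhi (d x : R) : 0 < d -> x \in `]u, v[ ->
    is_derive x 1 (Phi d) (Q x d - Q x (- d)).
  move=> d0 xuv.
  have dd : - d < d by rewrite gtrN.
  exact: (is_derive_segment_integral dd xuv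
    (fun z y zuv _ => dP z y zuv) (fun z y zuv _ => dQ z y zuv)
    (fun z zuv => continuous_subspaceT (cP z zuv))
    (fun z zuv => continuous_subspaceT (cA z zuv))
    (fun z y zuv _ => AM z y zuv)).
have bnd (d : R) : 0 < d -> `|Phi d b - Phi d a| <= (g d + g (- d)) * (b - a).
  move=> d0.
  have [x xab ->] := @MVT_segment _ (Phi d) (fun x => Q x d - Q x (- d)) a b ab
      (fun x xab => dPhi d x d0 (sub x (subset_itv_oo_cc xab)))
      (derivable_within_continuous (fun x xab => @ex_derive _ _ _ _ _ _ _ (dPhi d x d0 (sub x xab)))).
  rewrite normrM [X in _ * X]ger0_norm ?subr_ge0// ler_wpM2r ?subr_ge0//.
  by rewrite (le_trans (ler_normB _ _))// lerD// Qg// sub.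
have L : (Phi n.+1%:R b - Phi n.+1%:R a) @[n --> \oo] --> \int[mu]_y P b y - \int[mu]_y P a y.
  by apply: cvgB; apply: cvg_integral_line; exact: Pi_.
have L0 : (Phi n.+1%:R b - Phi n.+1%:R a) @[n --> \oo] --> (0 : R).
  have G : ((g n.+1%:R + g (- n.+1%:R)) * (b - a)) @[n --> \oo] --> (0 : R).
    rewrite -[X in _ --> X](mul0r (b - a)); apply: cvgM; last exact: cvg_cst.
    by rewrite -[X in _ --> X](addr0 0); exact: cvgD.
  apply/cvgr0Pnorm_le => e e0; move/cvgr0Pnorm_le : G => /(_ e e0).
  apply: filterS => n; apply: le_trans; apply: le_trans (bnd _ _) _ => //; exact: ler_norm.
have E : \int[mu]_y P b y - \int[mu]_y P a y = 0.
  by apply: (cvg_unique _ L L0).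
by symmetry; apply/eqP; rewrite -subr_eq0; apply/eqP.
Qed.

(** Cauchy's theorem for a strip: the real and the imaginary part of H each
    satisfy the Cauchy-Riemann equations with the other one as conjugate
    function, so the real statement applies to both. *)
Lemma cint_line_shift (H H' : R[i] -> R[i]) (u v M a b : R) (g : R -> R) :
  a <= b -> a \in `]u, v[ -> b \in `]u, v[ ->
  (forall x y : R, x \in `]u, v[ -> cderiv (fun x => H (x +i* y)) x (H' (x +i* y))) ->
  (forall x y : R, x \in `]u, v[ -> cderiv (fun y => H (x +i* y)) y ('i * H' (x +i* y))) ->
  (forall x : R, x \in `]u, v[ -> ccontinuous (fun y => H' (x +i* y))) ->
  (forall x y : R, x \in `]u, v[ -> cmod (H' (x +i* y)) <= M) ->
  (forall x y : R, x \in `]u, v[ -> cmod (H (x +i* y)) <= g y) ->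
  mu.-integrable setT (EFin \o g) ->
  (g n.+1%:R) @[n --> \oo] --> (0 : R) -> (g (- n.+1%:R)) @[n --> \oo] --> (0 : R) ->
  cint mu setT (fun y => H (a +i* y)) = cint mu setT (fun y => H (b +i* y)).
Proof.
move=> ab auv buv dx dy cH' H'M Hg gi g0 g0'.
have cH x : x \in `]u, v[ -> ccontinuous (fun y => H (x +i* y)).
  by move=> xuv; exact: cderiv_ccontinuous (fun y => dy x y xuv).
apply: complex_ext => /=.
  apply: (@real_line_shift (fun x y => complex.Re (H (x +i* y)))
    (fun x y => complex.Im (H (x +i* y))) (fun x y => complex.Re (H' (x +i* y))) u v M a b g) => //.
  - by move=> x y xuv; have [] := dx x y xuv.
  - move=> x y xuv; have [_] := dy x y xuv; rewrite ImM/= mul0r add0r mul1r; exact.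
  - by move=> x xuv; have [] := cH x xuv.
  - by move=> x xuv; have [] := cH' x xuv.
  - by move=> x y xuv; exact: le_trans (absRe_le _) (H'M x y xuv).
  - by move=> x y xuv; exact: le_trans (absRe_le _) (Hg x y xuv).
  - by move=> x y xuv; exact: le_trans (absIm_le _) (Hg x y xuv).
apply: (@real_line_shift (fun x y => complex.Im (H (x +i* y)))
  (fun x y => - complex.Re (H (x +i* y))) (fun x y => complex.Im (H' (x +i* y))) u v M a b g) => //.
- by move=> x y xuv; have [] := dx x y xuv.
- move=> x y xuv; have [/rderivN + _] := dy x y xuv.
  by rewrite ReM/= mul0r mul1r sub0r opprK.
- by move=> x xuv; have [] := cH x xuv.
- by move=> x xuv; have [] := cH' x xuv.
- by move=> x y xuv; exact: le_trans (absIm_le _) (H'M x y xuv).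
- by move=> x y xuv; exact: le_trans (absIm_le _) (Hg x y xuv).
- by move=> x y xuv; rewrite normrN; exact: le_trans (absRe_le _) (Hg x y xuv).
Qed.

End LineShift.

(** * Complex derivatives and Laplace transforms *)

Section ComplexDifferentiability.
Context {R : realType}.
Implicit Types (u : R -> R) (f : R -> R[i]) (F : R[i] -> R[i]).

Lemma rderivP u (x a : R) : is_derive x 1 u a <->
  forall e : R, 0 < e -> exists2 d : R, 0 < d &
    forall h : R, `|h| <= d -> `|u (x + h) - u x - h * a| <= e * `|h|.
Proof.
have cP : (is_derive x 1 u a) <->
    (h^-1 *: (u (h *: 1 + x) - u x) @[h --> (0 : R)^'] --> a).
  split.
    move=> [du <-]; exact: du.
  move=> cu; have du : derivable u x 1 by apply/cvg_ex; exists a.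
  by apply: DeriveDef => //; exact: (cvg_lim (@Rhausdorff R) cu).
rewrite cP; split.
  move=> /cvgrPdist_le H e e0; have := H e e0.
  rewrite near_withinE => /nbhs_ballP[d /= d0 Hd]; exists (d / 2); first by rewrite divr_gt0.
  move=> h hd; have [->|h0] := eqVneq h 0.
    by rewrite addr0 subrr mul0r subr0 normr0 mulr0.
  have := Hd h; rewrite /ball/= sub0r normrN => /(_ _ h0).
  rewrite (le_lt_trans hd) ?ltr_pdivrMr ?ltr_pMr ?ltr1n// => /(_ isT).
  rewrite /GRing.scale/= mulr1 addrC [h + x]addrC => H1.
  have -> : u (x + h) - u x - h * a = - h * (- (h^-1 * (u (x + h) - u x)) + a).
    by field.
  by rewrite normrM normrN mulrC ler_wpM2r.
move=> H; apply/cvgrPdist_le => e e0; have [d d0 Hd] := H e e0.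
rewrite near_withinE; apply/nbhs_ballP; exists d => //= h.
rewrite /ball/= sub0r normrN => hd h0.
rewrite /GRing.scale/= mulr1 [h + x]addrC.
have -> : a - h^-1 * (u (x + h) - u x) = - (h^-1 * (u (x + h) - u x - h * a)).
  by field.
rewrite normrN normrM normfV mulrC ler_pdivrMr ?normr_gt0//.
by apply: Hd; exact: ltW.
Qed.

Lemma cderivP f x l : cderiv f x l <->
  forall e : R, 0 < e -> exists2 d : R, 0 < d &
    forall h : R, `|h| <= d -> cmod (f (x + h) - f x - h%:C * l) <= e * `|h|.
Proof.
rewrite /cderiv !rderivP; split.
  move=> [H1 H2] e e0; have e2 : 0 < e / 2 by rewrite divr_gt0.
  have [d1 d10 Hd1] := H1 _ e2; have [d2 d20 Hd2] := H2 _ e2.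
  exists (Num.min d1 d2); first by rewrite lt_min d10.
  move=> h; rewrite le_min => /andP[h1 h2].
  apply: le_trans (cmod_le _) _.
  rewrite !ReImE/= !mul0r subr0 addr0.
  by rewrite [e]splitr mulrDl lerD// ?Hd1 ?Hd2.
move=> H; split=> e /H[d d0 Hd]; exists d => // h /Hd; apply: le_trans.
  by apply: le_trans (absRe_le _); rewrite !ReImE/= mul0r subr0.
by apply: le_trans (absIm_le _); rewrite !ReImE/= mul0r addr0.
Qed.

Definition cdiff F z l := forall e : R, 0 < e -> exists2 d : R, 0 < d &
  forall w, cmod w <= d -> cmod (F (z + w) - F z - l * w) <= e * cmod w.

Lemma cderiv_cdiff F (c : R -> R[i]) x l k : cdiff F (c x) l -> cderiv c x k ->
  cderiv (fun t => F (c t)) x (l * k).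
Proof.
move=> dF /cderivP dc; apply/cderivP => e e0.
pose e1 := Num.min 1 (e / (2 * (cmod l + 1))).
have l0 : 0 < 2 * (cmod l + 1) by rewrite mulr_gt0// ltr_wpDl// cmod_ge0.
have k0 : 0 < 2 * (cmod k + 1) by rewrite mulr_gt0// ltr_wpDl// cmod_ge0.
have e10 : 0 < e1 by rewrite lt_min ltr01 divr_gt0.
have [d1 d10 H1] := dc _ e10.
have [d2 d20 H2] := dF _ (divr_gt0 e0 k0).
exists (Num.min d1 (d2 / (cmod k + 1))).
  by rewrite lt_min d10 divr_gt0// ltr_wpDl// cmod_ge0.
move=> h; rewrite le_min => /andP[hd1 hd2].
pose w := c (x + h) - c x.
have Hw : cmod (w - h%:C * k) <= e1 * `|h| by exact: H1.
have wle : cmod w <= (cmod k + 1) * `|h|.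
  have E : w = (w - h%:C * k) + h%:C * k by rewrite subrK.
  have : cmod w <= cmod (w - h%:C * k) + cmod (h%:C * k).
    by rewrite {1}E; exact: cmodD.
  have -> : cmod (h%:C * k) = cmod k * `|h| by rewrite cmodM cmodR mulrC.
  have e1h : e1 * `|h| <= `|h| by rewrite ler_piMl// /e1 ge_min lexx.
  by move: e1h Hw; move: (cmod _) (cmod _) (cmod _) `|h| => ? ? ? ?; lra.
have := H2 w; have -> : c x + w = c (x + h) by rewrite addrC subrK.
rewrite (le_trans wle)=> [/(_ isT) H3|]; last first.
  by move: hd2; rewrite ler_pdivlMr ?ltr_wpDl ?cmod_ge0// mulrC.
have -> : F (c (x + h)) - F (c x) - h%:C * (l * k) =
  (F (c (x + h)) - F (c x) - l * w) + l * (w - h%:C * k) by ring.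
rewrite (le_trans (cmodD _ _))// [e]splitr mulrDl lerD//.
  have k1 : cmod k + 1 != 0 by rewrite gt_eqF// ltr_wpDl// cmod_ge0.
  apply: le_trans (le_trans (ler_wpM2l _ wle) _).
  + exact: H3.
  + by rewrite divr_ge0// ltW.
  + by rewrite le_eqVlt; apply/orP; left; apply/eqP; field.
have l1 : cmod l + 1 != 0 by rewrite gt_eqF// ltr_wpDl// cmod_ge0.
rewrite cmodM; apply: (@le_trans _ _ ((cmod l + 1) * (e / (2 * (cmod l + 1)) * `|h|))).
  apply: ler_pM; rewrite ?cmod_ge0// ?lerDl// (le_trans Hw)// ler_wpM2r//.
  by rewrite /e1 ge_min lexx orbT.
by rewrite le_eqVlt; apply/orP; left; apply/eqP; field.
Qed.

(** A unimodular rotation makes the increment real, which reduces the complex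
    mean value inequality to the real one. *)
Lemma cmod_mean_value f f' (a b M : R) : a <= b ->
  (forall x : R, x \in `[a, b] -> cderiv f x (f' x)) ->
  (forall x : R, x \in `[a, b] -> cmod (f' x) <= M) ->
  cmod (f b - f a) <= M * (b - a).
Proof.
move=> ab df fM; set D := f b - f a.
have [D0|D0] := eqVneq D 0.
  rewrite D0 cmod0 mulr_ge0 ?subr_ge0//.
  by apply: le_trans (cmod_ge0 _) (fM a _); rewrite in_itv/= lexx.
have cD : 0 < cmod D by rewrite cmod_gt0.
pose c := (cmod D)%:C / D.
have cc : cmod c = 1.
  by rewrite cmodM cmodV cmod_real ?cmod_ge0// divff// gt_eqF.
have dcf x : x \in `[a, b] -> is_derive x 1 (fun t => complex.Re (c * f t)) (complex.Re (c * f' x)).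
  by move=> /df /(cderivZ c)[].
have [x xab E] := @MVT_segment _ _ _ a b ab
      (fun x xab => dcf x (subset_itv_oo_cc xab))
      (derivable_within_continuous (fun x xab => @ex_derive _ _ _ _ _ _ _ (dcf x xab))).
have <- : complex.Re (c * f b) - complex.Re (c * f a) = cmod D.
  by rewrite -ReN -ReD -mulrN -mulrDr -/D /c divfK//.
rewrite E ler_wpM2r ?subr_ge0// (le_trans (ler_norm _))//.
by rewrite (le_trans (absRe_le _))// cmodM cc mul1r fM.
Qed.

Lemma cmod_cexp_le (w : R[i]) : cmod (cexp w) <= expR (cmod w).
Proof. by rewrite cmod_cexp ler_expR Re_le_cmod. Qed.

Lemma cexp_taylor1 (w : R[i]) : cmod (cexp w - 1) <= cmod w * expR (cmod w).
Proof.
have d (r : R) : r \in `[0, 1] -> cderiv (fun r => cexp (r%:C * w)) r (w * cexp (r%:C * w)).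
  move=> _; apply: cderiv_cexp; apply: cderiv_eq (cderivM (cderiv_id r) (cderiv_cst r w)).
  by rewrite mulr0 add0r mul1r.
have := @cmod_mean_value _ _ 0 1 (cmod w * expR (cmod w)) ler01 d.
rewrite mul1r mul0r cexp0 subr0 mulr1; apply => r.
rewrite in_itv/= => /andP[r0 r1].
rewrite cmodM ler_wpM2l ?cmod_ge0// (le_trans (cmod_cexp_le _))// ler_expR.
by rewrite cmodM cmod_real// ler_piMl// cmod_ge0.
Qed.

Lemma cexp_taylor2 (w : R[i]) : cmod (cexp w - 1 - w) <= cmod w ^+ 2 * expR (cmod w).
Proof.
have d (r : R) : r \in `[0, 1] ->
    cderiv (fun r => cexp (r%:C * w) - 1 - r%:C * w) r (w * (cexp (r%:C * w) - 1)).
  move=> _; have dw := cderivM (cderiv_id r) (cderiv_cst r w).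
  apply: cderiv_eq (cderivD (cderivD (cderiv_cexp dw) (cderivN (cderiv_cst r 1))) (cderivN dw)).
  by ring.
have := @cmod_mean_value _ _ 0 1 (cmod w ^+ 2 * expR (cmod w)) ler01 d.
rewrite mul1r mul0r cexp0 !subr0 mulr1 subrr subr0; apply => r.
rewrite in_itv/= => /andP[r0 r1].
rewrite cmodM expr2 -mulrA ler_wpM2l ?cmod_ge0// (le_trans (cexp_taylor1 _))//.
rewrite cmodM cmod_real//.
by rewrite ler_pM ?mulr_ge0 ?cmod_ge0 ?expR_ge0 ?ler_expR// ler_piMl// cmod_ge0.
Qed.

End ComplexDifferentiability.

Section LaplaceDerivative.
Context {R : realType}.
Notation mu := (@lebesgue_measure R).
Implicit Types (b : R -> R[i]) (z w : R[i]).

Definition subexp b : Prop := cmeas (`[0, +oo[ : set R) b /\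
  forall eps : R, 0 < eps ->
    mu.-integrable `[0, +oo[ (fun t => (expR (- (eps * t)) * cmod (b t))%:E).

(** The factor t costs an arbitrarily small exponential, so every derivative of
    a Laplace transform is again the Laplace transform of such a function. *)
Lemma subexpX b : subexp b -> subexp (fun t => t%:C * b t).
Proof.
move=> [mb ib]; have mt : cmeas (`[0, +oo[ : set R) (fun t : R => t%:C * b t).
  by apply: cmeasM mb; apply: cmeas_real; exact: measurable_id.
split => // eps eps0; have e20 : 0 < eps / 2 by rewrite divr_gt0.
apply: (le_integrable _ _ _ (integrable_realZ _ (2 / eps) (ib _ e20))) => //.
  apply/measurable_EFinP/measurable_funM; last exact: cmeas_cmod.
  by apply: measurable_funTS; apply: continuous_measurable_fun; exact: continuous_expM.
move=> t /=; rewrite in_itv/= andbT => t0.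
have e0 : 0 <= 2 / eps by rewrite divr_ge0// ltW.
rewrite lee_fin !ger0_norm ?mulr_ge0 ?expR_ge0 ?cmod_ge0//.
rewrite cmodM cmod_real// !mulrA [_ * t]mulrC ler_wpM2r ?cmod_ge0//.
  exact: xexp_le.
by rewrite invr_ge0 ltW.
Qed.

Lemma laplace_cintble b z : subexp b -> 0 < complex.Re z ->
  cintble mu `[0, +oo[ (fun t => cexp (- (z * t%:C)) * b t).
Proof.
move=> [mb ib] z0; apply: (cintble_le _ _ (ib _ z0)) => //.
  by apply: cmeasM mb; exact: ccontinuous_cmeas (ccontinuous_expc z).
by move=> t _; rewrite cmodM cmod_expc.
Qed.

(** Taylor's formula for exp(-wt) leaves t^2 |w|^2 exp(|w|t). Of the four
    quarters of the decay of exp(-zt), two absorb t^2, one absorbs exp(|w|t)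
    and one keeps the integral finite. *)
Lemma laplace_taylor b z : subexp b -> 0 < complex.Re z ->
  exists2 K, 0 < K & forall w, cmod w <= complex.Re z / 4 ->
   cmod (laplace b (z + w) - laplace b z + w * laplace (fun t => t%:C * b t) z)
     <= K * cmod w ^+ 2.
Proof.
move=> sb z0; have x40 : 0 < complex.Re z / 4 by rewrite divr_gt0.
pose K := (8 / complex.Re z) ^+ 2 *
  \int[mu]_(t in `[0%R, +oo[) (expR (- (complex.Re z / 4 * t)) * cmod (b t)).
have K0 : 0 <= K.
  by rewrite mulr_ge0 ?sqr_ge0// Rintegral_ge0// => t _; rewrite mulr_ge0 ?expR_ge0 ?cmod_ge0.
exists (K + 1); first by rewrite ltr_wpDl.
move=> w wz; have zw0 : 0 < complex.Re (z + w).
  have := le_trans (absRe_le w) wz; rewrite ReD ler_norml => /andP[+ _].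
  by move: (complex.Re z) (complex.Re w) z0 => p q ? ?; lra.
have i1 := laplace_cintble sb zw0; have i2 := laplace_cintble sb z0.
have i3 := laplace_cintble (subexpX sb) z0.
rewrite /laplace -!/(cint mu _ _) -cintZ// -cintB// -cintD//; last 2 first.
- exact: cintbleB.
- exact: cintbleZ.
apply: le_trans (cmod_cint_le _ _) _ => //.
  by apply: cintbleD => //; [exact: cintbleB|exact: cintbleZ].
apply: (@le_trans _ _ (K * cmod w ^+ 2)); last first.
  by rewrite ler_wpM2r ?sqr_ge0// lerDl.
rewrite /K mulrAC -RintegralZl//; last exact: sb.2.
apply: le_Rintegral => //.
- apply: cintble_cmod => //.
  by apply: cintbleD => //; [exact: cintbleB|exact: cintbleZ].
- by apply: integrable_realZ => //; exact: sb.2.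
move=> t /=; rewrite in_itv/= andbT => t0.
have -> : cexp (- ((z + w) * t%:C)) * b t - cexp (- (z * t%:C)) * b t +
    w * (cexp (- (z * t%:C)) * (t%:C * b t)) =
    cexp (- (z * t%:C)) * (cexp (- (w * t%:C)) - 1 - (- (w * t%:C))) * b t.
  by rewrite mulrDl opprD cexpD; ring.
rewrite !cmodM cmod_expc mulrA ler_wpM2r ?cmod_ge0//.
apply: (le_trans (ler_wpM2l (expR_ge0 _) (cexp_taylor2 _))).
rewrite cmodN cmodM cmod_real//.
have E1 : expR (cmod w * t) <= expR (complex.Re z / 4 * t).
  by rewrite ler_expR ler_wpM2r.
have E2 : (t * expR (- (complex.Re z / 4 * t))) ^+ 2 <= (8 / complex.Re z) ^+ 2.
  have k0 : 0 <= 8 / complex.Re z by apply: divr_ge0 => //; exact: ltW.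
  rewrite lerXn2r ?nnegrE//; first by rewrite mulr_ge0// expR_ge0.
  apply: le_trans (xexp_le x40 t0) _.
  have -> : 8 / complex.Re z = 2 / (complex.Re z / 4) by field; rewrite gt_eqF.
  rewrite ler_piMr//; first by rewrite divr_ge0// ltW.
  by rewrite -expR0 ler_expR oppr_le0 !mulr_ge0// ltW.
have E3 : expR (- (complex.Re z * t)) = expR (- (complex.Re z / 4 * t)) ^+ 2 *
    expR (- (complex.Re z / 4 * t)) * expR (- (complex.Re z / 4 * t)).
  by rewrite expr2 -!expRD; congr expR; field.
have E4 : expR (- (complex.Re z / 4 * t)) * expR (complex.Re z / 4 * t) = 1.
  by rewrite -expRD addNr expR0.
rewrite E3; move: E1 E2 E4.
move: (expR (- (complex.Re z / 4 * t))) (expR_gt0 (- (complex.Re z / 4 * t))) => p p0.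
move: (expR (complex.Re z / 4 * t)) (8 / complex.Re z) => q k.
move: (expR (cmod w * t)) (expR_ge0 (cmod w * t)) => e e0.
move: (cmod w) (cmod_ge0 w) => m m0 E1 E2 E4.
have -> : p ^+ 2 * p * p * ((m * t) ^+ 2 * e) = m ^+ 2 * (t * p) ^+ 2 * p * (p * e) by ring.
rewrite [k ^+ 2 * _]mulrC -[leRHS]mulr1; apply: ler_pM.
- by apply: mulr_ge0 (ltW p0); apply: mulr_ge0; exact: sqr_ge0.
- by rewrite mulr_ge0// ltW.
- by apply: ler_wpM2r (ltW p0) _ _ _; apply: ler_wpM2l (sqr_ge0 _) _ _ _.
by rewrite -E4; apply: ler_wpM2l (ltW p0) _ _ _.
Qed.

Lemma laplace_cdiff b z : subexp b -> 0 < complex.Re z ->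
  cdiff (laplace b) z (- laplace (fun t => t%:C * b t) z).
Proof.
move=> sb z0 e e0; have [K K0 HK] := laplace_taylor sb z0.
exists (Num.min (complex.Re z / 4) (e / K)); first by rewrite lt_min !divr_gt0.
move=> w; rewrite le_min => /andP[wz wK].
rewrite mulNr opprK [_ * w]mulrC (le_trans (HK w wz))// expr2 mulrA ler_wpM2r ?cmod_ge0//.
by rewrite mulrC -ler_pdivlMr.
Qed.

(** The topology of the complex field and the real modulus give the same
    derivative; regularity is stated with the former and used with the latter.
    *)
Lemma cdiff_derive1n (F : R[i] -> R[i]) z l : cdiff F z l ->
  derive1n 1 (F : R[i] -> (R[i])^o) z = l.
Proof.
move=> dF; rewrite /derive1n/= /derive1; apply: cvg_lim; first exact: norm_hausdorff.
apply/cvgrPdist_le => e e0.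
have [r r0 er] : exists2 r : R, 0 < r & e = r%:C.
  by move: e0; rewrite ltcE/= => /andP[/eqP E p0]; exists (complex.Re e); last exact: complex_ext.
have [d d0 Hd] := dF r r0.
rewrite near_withinE; apply/nbhs_ballP; exists d%:C; first by rewrite /= ltcR.
move=> w; rewrite /ball/= sub0r normrN => hd w0.
have {}hd : cmod w <= d by move: hd; rewrite -cmodC ltcR => /ltW.
have cw : 0 < cmod w by rewrite cmod_gt0.
rewrite er -cmodC lecR /GRing.scale/= [w + z]addrC.
have -> : l - w^-1 * (F (z + w) - F z) = - (w^-1 * (F (z + w) - F z - l * w)).
  by field.
by rewrite cmodN cmodM cmodV mulrC ler_pdivrMr//; exact: Hd.
Qed.

End LaplaceDerivative.

(** * Growth of sectorial regular functions *)

Section SectorGrowth.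
Context {R : realType}.
Notation mu := (@lebesgue_measure R).
Implicit Types (z w : R[i]) (f : R -> R[i]).

(** The principal argument, but only where Re z > 0. *)
Definition rarg z : R := atan (complex.Im z / complex.Re z).
(** The logarithm of the modulus, in a form whose differentiation involves no
    square root. *)
Definition logmod z : R :=
  2^-1 * ln (complex.Re z * complex.Re z + complex.Im z * complex.Im z).

Lemma logmodE z : z != 0 -> logmod z = ln (cmod z).
Proof.
move=> z0; rewrite /logmod -!expr2 -sqr_cmod lnXn ?cmod_gt0//.
by rewrite mulr2n; field.
Qed.

Lemma rderiv_logmod f (x : R) k : f x != 0 -> cderiv f x k ->
  is_derive x 1 (fun t => logmod (f t)) (complex.Re (k / f x)).
Proof.
move=> fx0 [dR dI].
have s0 : 0 < complex.Re (f x) * complex.Re (f x) + complex.Im (f x) * complex.Im (f x).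
  by rewrite -!expr2 -sqr_cmod exprn_gt0// cmod_gt0.
have d1 := rderivD (rderivM dR dR) (rderivM dI dI).
have d2 := @rderiv_comp _ (@ln R) (fun t => complex.Re (f t) * complex.Re (f t) +
  complex.Im (f t) * complex.Im (f t)) x _ _ (is_derive1_ln s0) d1.
apply: (is_derive_eq (rderivZ 2^-1 d2)); rewrite ReM ReV ImV !expr2.
by field; rewrite gt_eqF.
Qed.

Lemma rderiv_rarg f (x : R) k : 0 < complex.Re (f x) -> cderiv f x k ->
  is_derive x 1 (fun t => rarg (f t)) (complex.Im (k / f x)).
Proof.
move=> fx0 [dR dI]; have n0 : complex.Re (f x) != 0 by rewrite gt_eqF.
have s0 : complex.Re (f x) ^+ 2 + complex.Im (f x) ^+ 2 != 0.
  by rewrite gt_eqF// ltr_wpDr ?sqr_ge0// exprn_gt0.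
have d1 := rderivM dI (rderivV n0 dR).
have d2 := @rderiv_comp _ (@atan R) (fun t => complex.Im (f t) / complex.Re (f t)) x _ _
  (is_derive1_atan _) d1.
apply: (is_derive_eq d2); rewrite ImM ReV ImV !expr2.
rewrite !expr2 in s0.
have s1 : 1 + complex.Im (f x) / complex.Re (f x) * (complex.Im (f x) / complex.Re (f x)) =
   (complex.Re (f x) * complex.Re (f x) + complex.Im (f x) * complex.Im (f x)) / complex.Re (f x) ^+ 2.
  by field.
rewrite s1; field.
by rewrite s0 n0.
Qed.

(** An angle below pi/2 forces the right half-plane, where acos of the
    normalized real part and atan of the slope measure the same angle. *)
Lemma sectorP (theta : R) z : theta < pi / 2 -> sector theta z ->
  [/\ 0 < complex.Re z, cos theta * cmod z <= complex.Re z & `|rarg z| <= theta].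
Proof.
move=> tpi [z0]; rewrite /carg.
have c0 : 0 < cmod z by rewrite cmod_gt0.
set q := complex.Re z / cmod z.
have qB : -1 <= q <= 1.
  by rewrite -ler_norml normrM normfV [X in _ / X]ger0_norm ?cmod_ge0// ler_pdivrMr// mul1r absRe_le.
have a0 : 0 <= acos q by exact: acos_ge0.
have -> : `|if 0 <= complex.Im z then acos q else - acos q| = acos q.
  by case: ifP => _; rewrite ?normrN ger0_norm.
move=> qt; have t0 : 0 < theta by exact: le_lt_trans qt.
have pi2 : pi / 2 <= pi :> R by rewrite ler_pdivrMr// ler_pMr ?pi_gt0// ler1n.
have cq : cos theta < q.
  have E : cos (acos q) = q by apply: acosK; rewrite in_itv.
  have tp : theta <= pi by exact: ltW (lt_le_trans tpi pi2).
  by rewrite -[ltRHS]E ltr_cos// in_itv/= ?a0 ?acos_lepi// (ltW t0) tp.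
have ct : 0 < cos theta.
  by apply: cos_gt0_pihalf; rewrite tpi andbT (lt_trans _ t0)// oppr_lt0 divr_gt0// pi_gt0.
have R0 : 0 < complex.Re z.
  by have := lt_trans ct cq; rewrite /q pmulr_lgt0// invr_gt0.
have cR : cos theta * cmod z <= complex.Re z.
  by move/ltW : cq; rewrite /q ler_pdivlMr.
have tI : theta \in `](- (pi / 2)), (pi / 2)[.
  by rewrite in_itv/= tpi andbT (lt_trans _ t0)// oppr_lt0 divr_gt0// pi_gt0.
have ty : 0 <= tan theta.
  rewrite /tan divr_ge0//; last exact: ltW.
  by rewrite sin_ge0_pi// (ltW t0)/= ltW// (lt_le_trans tpi).
have key : `|complex.Im z / complex.Re z| <= tan theta.
  rewrite -(ler_pXn2r (ltn0Sn 1)) ?nnegrE// real_normK ?num_real//.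
  have := cos2_tan2 (lt0r_neq0 ct) => E.
  rewrite -(lerD2l 1) -E expr_div_n.
  have -> : 1 + complex.Im z ^+ 2 / complex.Re z ^+ 2 = cmod z ^+ 2 / complex.Re z ^+ 2.
    by rewrite sqr_cmod mulrDl divff// expf_neq0// gt_eqF.
  rewrite ler_pdivrMr ?exprn_gt0// ler_pdivlMl ?exprn_gt0// -exprMn.
  by rewrite lerXn2r ?nnegrE ?mulr_ge0 ?cmod_ge0 ?(ltW ct) ?(ltW R0).
split => //; move: key; rewrite /rarg !ler_norml => /andP[k1 k2].
rewrite -[theta](tanK tI) -atanN; apply/andP; split; exact: le_atan.
Qed.

Lemma cexp_polar z : 0 < complex.Re z -> cexp (ln (cmod z) +i* rarg z) = z.
Proof.
move=> z0; have zn0 : z != 0 by apply: contraTneq z0 => ->; rewrite ltxx.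
have c0 : 0 < cmod z by rewrite cmod_gt0.
have n0 : complex.Re z != 0 by rewrite gt_eqF.
have sq : cmod z ^+ 2 = complex.Re z ^+ 2 + complex.Im z ^+ 2 := sqr_cmod z.
have Ec : cos (rarg z) = complex.Re z / cmod z.
  rewrite /rarg cos_atan.
  have -> : 1 + (complex.Im z / complex.Re z) ^+ 2 = (cmod z / complex.Re z) ^+ 2.
    by rewrite !expr_div_n sq mulrDl divff// expf_neq0.
  by rewrite sqrtr_sqr ger0_norm ?invf_div// divr_ge0 ?cmod_ge0// ltW.
have cn0 : cos (rarg z) != 0 by rewrite Ec mulf_neq0// invr_neq0// gt_eqF.
have Es : sin (rarg z) = complex.Im z / cmod z.
  have := atanK (complex.Im z / complex.Re z); rewrite -/(rarg z) /tan => /(congr1 ( *%R ^~ (cos (rarg z)))).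
  by rewrite divfK// Ec => ->; field; rewrite n0 gt_eqF.
by rewrite /cexp/= lnK ?posrE// Ec Es; apply: complex_ext => /=; field; rewrite gt_eqF.
Qed.

Lemma cderiv_polar_radius (p phi : R) :
  cderiv (fun p => cexp (p +i* phi)) p (cexp (p +i* phi)).
Proof.
rewrite -[X in cderiv _ _ X]mul1r; apply: cderiv_cexp; split => /=.
  exact: is_derive_id.
exact: is_derive_cst.
Qed.

Lemma cderiv_polar_angle (p phi : R) :
  cderiv (fun phi => cexp (p +i* phi)) phi ('i * cexp (p +i* phi)).
Proof.
apply: cderiv_cexp; split => /=.
  exact: is_derive_cst.
exact: is_derive_id.
Qed.

(** The mean of the logarithm of the modulus of F over an arc of angle 2b has,
    by the Cauchy-Riemann equations, the variation of the argument of F over the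
    arc as its logarithmic derivative in the radius; this variation is at most
    2 theta. Regularity makes the logarithm of the modulus vary by at most a
    constant on each arc, so that 1/F grows at most like a power with exponent
    theta/b. *)
Lemma sector_growth (F F' F'' : R[i] -> R[i]) (theta K : R) :
  0 < theta -> theta < pi / 2 ->
  (forall z, 0 < complex.Re z -> cdiff F z (F' z)) ->
  (forall z, 0 < complex.Re z -> cdiff F' z (F'' z)) ->
  (forall z, 0 < complex.Re z -> 0 < complex.Re (F z)) ->
  (forall z, 0 < complex.Re z -> `|rarg (F z)| <= theta) ->
  (forall z, 0 < complex.Re z -> cmod (z * F' z) <= K * cmod (F z)) ->
  exists rho B : R, [/\ 0 < rho, rho < 1, 0 < B &
    forall z, 0 < complex.Re z -> 1 <= cmod z -> (cmod (F z))^-1 <= B * cmod z `^ rho].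
Proof.
move=> t0 tpi dF dF' F0 Ft FK.
have pi0 : 0 < pi :> R := pi_gt0 R.
(* any half-angle b strictly between theta and pi/2 gives the order theta/b < 1 *)
have b0 : 0 < (theta + pi / 2) / 2 by lra.
have tb : theta < (theta + pi / 2) / 2 by lra.
have bpi : (theta + pi / 2) / 2 < pi / 2 by lra.
move: b0 tb bpi; set b : R := (theta + pi / 2) / 2 => b0 tb bpi.
pose c (p phi : R) : R[i] := cexp (p +i* phi).
have cR (p phi : R) : - (pi / 2) < phi < pi / 2 -> 0 < complex.Re (c p phi).
  by move=> h; rewrite /c/= mulr_gt0 ?expR_gt0// cos_gt0_pihalf.
have sub (phi : R) : phi \in `[- b, b] -> - (pi / 2) < phi < pi / 2.
  rewrite in_itv/= => /andP[h1 h2]; rewrite (le_lt_trans h2 bpi) andbT.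
  by apply: lt_le_trans h1; rewrite ltrN2.
have Fn0 z : 0 < complex.Re z -> F z != 0.
  by move=> /F0 h; apply: contraTneq h => ->; rewrite ltxx.
pose P p phi := logmod (F (c p phi)).
pose Q p phi := rarg (F (c p phi)).
pose A p phi := complex.Re (F' (c p phi) * c p phi / F (c p phi)).
have dPr (p phi : R) : - (pi / 2) < phi < pi / 2 -> is_derive p 1 (P ^~ phi) (A p phi).
  move=> /(cR p) h; apply: rderiv_logmod; first exact: Fn0.
  exact: (@cderiv_cdiff _ F (c ^~ phi) p _ _ (dF _ h) (cderiv_polar_radius p phi)).
have dPa (p phi : R) : - (pi / 2) < phi < pi / 2 ->
    is_derive phi 1 (P p) (complex.Re (F' (c p phi) * ('i * c p phi) / F (c p phi))).
  move=> /(cR p) h; apply: rderiv_logmod; first exact: Fn0.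
  exact: (@cderiv_cdiff _ F (c p) phi _ _ (dF _ h) (cderiv_polar_angle p phi)).
have dQ (p phi : R) : - (pi / 2) < phi < pi / 2 -> is_derive phi 1 (Q p) (A p phi).
  move=> /(cR p) h; have -> : A p phi = complex.Im (F' (c p phi) * ('i * c p phi) / F (c p phi)).
    by rewrite mulrCA -[_ * _ / _]mulrA /A ImM/= mul0r add0r mul1r.
  apply: rderiv_rarg; first exact: F0.
  exact: (@cderiv_cdiff _ F (c p) phi _ _ (dF _ h) (cderiv_polar_angle p phi)).
have AK (p phi : R) (k : R[i]) : - (pi / 2) < phi < pi / 2 -> cmod k = cmod (c p phi) ->
    cmod (F' (c p phi) * k / F (c p phi)) <= K.
  move=> /(cR p) h kc; rewrite cmodM cmodV ler_pdivrMr ?cmod_gt0 ?Fn0//.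
  by rewrite cmodM kc mulrC -cmodM; exact: FK.
have cP (p : R) : {within `[- b, b], continuous (P p)}.
  by apply: derivable_within_continuous => phi /sub h; have [] := dPa p phi h.
have cA (p : R) : {within `[- b, b], continuous (A p)}.
  apply: derivable_within_continuous => phi /sub h; have h' := cR p phi h.
  have dc := cderiv_polar_angle p phi.
  have := cderivM (cderivM (@cderiv_cdiff _ F' (c p) phi _ _ (dF' _ h') dc) dc)
    (cderivV (Fn0 _ h') (@cderiv_cdiff _ F (c p) phi _ _ (dF _ h') dc)).
  by move=> [[]].
pose Phi (p : R) := \int[mu]_(phi in `[- b, b]) P p phi.
pose q (p : R) := Q p b - Q p (- b).
have bb : - b < b by rewrite gtrN.
have bI : - (pi / 2) < b < pi / 2 by apply: sub; rewrite in_itv/= lexx ltW.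
have NbI : - (pi / 2) < - b < pi / 2 by apply: sub; rewrite in_itv/= lexx ltW.
have dPhi (p : R) : is_derive p 1 Phi (q p).
  have pI : p \in `](p - 1), (p + 1)[ by rewrite in_itv/= ltrDl ltrBlDr ltrDl ltr01.
  exact: (@is_derive_segment_integral _ P Q A (p - 1) (p + 1) (- b) b K p bb pI
    (fun r y _ yb => dPr r y (sub y yb)) (fun r y _ yb => dQ r y (sub y yb))
    (fun r _ => cP r) (fun r _ => cA r)
    (fun r y _ yb => le_trans (absRe_le _) (AK r y _ (sub y yb) erefl))).
have q_le (p : R) : `|q p| <= 2 * theta.
  rewrite /q (le_trans (ler_normB _ _))// mulr_natl mulr2n lerD//; apply: Ft; exact: cR.
have Phi_ge (p : R) : 0 <= p -> Phi 0 - 2 * theta * p <= Phi p.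
  move=> p0.
  have [x _ E] := @MVT_segment _ Phi q 0 p p0 (fun x _ => dPhi x)
    (derivable_within_continuous (fun x _ => @ex_derive _ _ _ _ _ _ _ (dPhi x))).
  rewrite lerBlDr -lerBlDl -opprB E subr0 -mulNr ler_wpM2r//.
  by apply: le_trans (q_le x); rewrite lerNl; move: (ler_norm (- q x)); rewrite normrN lerNl.
have Posc (p phi psi : R) : - (pi / 2) < phi < pi / 2 -> - (pi / 2) < psi < pi / 2 ->
    phi <= psi -> `|P p psi - P p phi| <= K * pi.
  move=> h1 h2 le12.
  have I x : x \in `[phi, psi] -> - (pi / 2) < x < pi / 2.
    rewrite in_itv/= => /andP[x1 x2]; move: h1 h2 => /andP[h1 _] /andP[_ h2].
    by rewrite (lt_le_trans h1 x1) (le_lt_trans x2 h2).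
  have [x xI ->] := @MVT_segment _ (P p) _ phi psi le12
    (fun x xI => dPa p x (I x (subset_itv_oo_cc xI)))
    (derivable_within_continuous (fun x xI => @ex_derive _ _ _ _ _ _ _ (dPa p x (I x xI)))).
  rewrite normrM ler_pM//.
    by apply: le_trans (absRe_le _) (AK p x _ (I x xI) _); rewrite cmodM cmodE/= expr0n expr1n add0r sqrtr1 mul1r.
  rewrite ger0_norm ?subr_ge0//; move: h1 h2 => /andP[h1 _] /andP[_ h2].
  by move: h1 h2; move: (pi : R) => ? ? ?; lra.
have P_ge (p psi : R) : 0 <= p -> - (pi / 2) < psi < pi / 2 ->
    (Phi 0 - 2 * theta * p) / (2 * b) - K * pi <= P p psi.
  move=> p0 hpsi.
  have b20 : 0 < 2 * b by rewrite mulr_gt0.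
  rewrite lerBlDr ler_pdivrMr//; apply: (le_trans (Phi_ge p p0)).
  have -> : (P p psi + K * pi) * (2 * b) = \int[mu]_(phi in `[- b, b]) (P p psi + K * pi).
    rewrite Rintegral_cst//= lebesgue_measure_itv/= lte_fin bb/=.
    by congr (_ * _); ring.
  apply: le_Rintegral => //.
  - by apply: continuous_compact_integrable; [exact: segment_compact|exact: cP].
  - apply: continuous_compact_integrable; first exact: segment_compact.
    by apply: continuous_subspaceT; exact: cst_continuous.
  - move=> phi /= /sub hphi; rewrite -lerBlDl.
    have [le1|/ltW le1] := leP phi psi.
      by apply: le_trans (Posc p phi psi hphi hpsi le1); rewrite distrC ler_norm.
    by apply: le_trans (Posc p psi phi hpsi hphi le1); rewrite ler_norm.
exists (theta / b), (expR (K * pi - Phi 0 / (2 * b))); split.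
- by rewrite divr_gt0.
- by rewrite ltr_pdivrMr// mul1r.
- exact: expR_gt0.
move=> z z0 z1; have := P_ge (ln (cmod z)) (rarg z) (ln_ge0 z1).
rewrite /P /c cexp_polar// atan_gtNpi2 atan_ltpi2 => /(_ isT).
have cF : 0 < cmod (F z) by rewrite cmod_gt0 Fn0.
have cz : 0 < cmod z by exact: lt_le_trans z1.
rewrite logmodE ?Fn0// => H.
rewrite -[(cmod (F z))^-1]lnK ?posrE ?invr_gt0// lnV ?posrE// /powR gt_eqF// -expRD ler_expR.
rewrite lerNl; apply: le_trans H; rewrite le_eqVlt; apply/orP; left; apply/eqP.
by field; rewrite gt_eqF.
Qed.

End SectorGrowth.

(** * Power weights and holomorphic functions on vertical lines *)

Section PowerWeight.
Context {R : realType}.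
Notation mu := (@lebesgue_measure R).

Definition pweight (c y : R) : R := (1 + `|y|) `^ (- c).

Lemma pweight_ge0 c y : 0 <= pweight c y.
Proof. exact: powR_ge0. Qed.

Lemma pweightN c y : pweight c (- y) = pweight c y.
Proof. by rewrite /pweight normrN. Qed.

Lemma continuous_pweight c : continuous (pweight c).
Proof.
move=> y; have y0 : 0 < 1 + `|y| by rewrite ltr_pwDl.
have d := is_derive1_powR (- c) y0.
have H : {for y, continuous ((fun a => a `^ (- c)) \o (fun y => 1 + `|y|))}.
  apply: continuous_comp.
    by apply: continuousD; [exact: cst_continuous|exact: norm_continuous].
  exact: rderiv_continuous d.
exact: H.
Qed.

Lemma powRN_small (d e : R) : 0 < d -> 0 < e ->
  exists2 K : R, 0 < K & forall a, K <= a -> a `^ (- d) <= e.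
Proof.
move=> d0 e0; pose K : R := e `^ (- d^-1).
have K0 : 0 < K by exact: powR_gt0.
exists K => // a Ka; rewrite powRN.
have E : e = (K `^ d)^-1.
  by rewrite -powRrM mulNr mulVf ?gt_eqF// powRN powRr1 ?invrK//; exact: ltW.
have a0 : 0 < a by exact: lt_le_trans Ka.
rewrite [leRHS]E lef_pV2 ?posrE ?powR_gt0//.
by apply: ge0_ler_powR => //; rewrite ?nnegrE; exact: ltW.
Qed.

Lemma cvg_pweight c : 0 < c -> (pweight c n.+1%:R) @[n --> \oo] --> (0 : R).
Proof.
move=> c0; apply/cvgr0Pnorm_le => e e0.
have [K K0 HK] := powRN_small c0 e0.
apply: filterS (nbhs_infty_ger K) => n Kn.
rewrite ger0_norm ?pweight_ge0//; apply: HK.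
by rewrite ger0_norm// (le_trans Kn)// -[leLHS]add0r lerD// ler_nat.
Qed.

Lemma ge0_integral_pweight c : 1 < c ->
  (\int[mu]_(y in `[0%R, +oo[) (pweight c y)%:E = ((c - 1)^-1)%:E)%E.
Proof.
move=> c1; have c10 : 0 < c - 1 by rewrite subr_gt0.
have dF (y : R) : 0 <= y -> is_derive y 1 (fun t => - ((c - 1)^-1 * (1 + t) `^ (- (c - 1)))) (pweight c y).
  move=> y0; have y10 : 0 < 1 + y by rewrite ltr_pwDl.
  have dl : is_derive y 1 (fun t : R => 1 + t) (0 + 1).
    exact: rderivD (is_derive_cst (1 : R) y 1) (is_derive_id y 1).
  have dp := @rderiv_comp _ (fun a => a `^ (- (c - 1))) _ y _ _ (is_derive1_powR (- (c - 1)) y10) dl.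
  apply: (is_derive_eq (rderivN (rderivZ _ dp))).
  rewrite /pweight ger0_norm// add0r mulr1 mulNr mulrN opprK mulrA mulVf ?gt_eqF// mul1r.
  by congr (_ `^ _); ring.
rewrite (@ge0_continuous_FTC2y _ _ (fun t => - ((c - 1)^-1 * (1 + t) `^ (- (c - 1)))) _ 0).
- by rewrite addr0 powR1 mulr1 EFinN sub0e oppeK.
- by move=> x _; exact: pweight_ge0.
- by apply: continuous_subspaceT; exact: continuous_pweight.
- rewrite -oppr0; apply: cvgN; rewrite -[X in _ --> X](mulr0 (c - 1)^-1).
  apply: cvgM; first exact: cvg_cst.
  apply/cvgr0Pnorm_le => e e0; have [K K0 HK] := powRN_small c10 e0.
  near=> x; rewrite ger0_norm ?powR_ge0//; apply: HK.
  apply: (@le_trans _ _ x); last by rewrite lerDr.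
  by near: x; apply: nbhs_pinfty_ge; rewrite num_real.
- by move=> x x0; have [] := dF x (ltW x0).
- by apply: cvg_at_right_filter; exact: rderiv_continuous (dF 0 (lexx 0)).
- move=> x; rewrite in_itv/= andbT => x0.
  by rewrite derive1E; have [] := dF x (ltW x0).
Unshelve. all: end_near. Qed.

Lemma integrable_pweight c : 1 < c -> mu.-integrable setT (EFin \o pweight c).
Proof.
move=> c1; apply/integrableP; split.
  apply/measurable_EFinP; apply: continuous_measurable_fun.
  exact: continuous_pweight.
under eq_integral do rewrite /= ger0_norm ?pweight_ge0//.
rewrite ge0_symfun_integralT//; last 3 first.
- by move=> y; exact: pweight_ge0.
- exact: continuous_pweight.
- by move=> y /=; rewrite pweightN.
have -> : [set x : R | 0 <= x] = `[0, +oo[%classic.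
  by apply/seteqP; split => x/=; rewrite in_itv/= andbT.
by rewrite ge0_integral_pweight// -EFinM ltry.
Qed.

(** For x >= 1 the modulus of x + iy is at least (1 + |y|)/2. *)
Lemma powR_cmod_le c (x y : R) : 0 < c -> 1 <= x ->
  cmod (x +i* y) `^ (- c) <= 2 `^ c * pweight c y.
Proof.
move=> c0 x1; have z1 : (1 + `|y|) / 2 <= cmod (x +i* y).
  have := Re_le_cmod (x +i* y); have := absIm_le (x +i* y) => /= h1 h2.
  by lra.
have y0 : 0 < 1 + `|y| by rewrite ltr_pwDl.
have c20 : 0 < (1 + `|y|) / 2 by rewrite divr_gt0.
rewrite !/pweight !powRN.
have -> : 2 `^ c / (1 + `|y|) `^ c = (((1 + `|y|) / 2) `^ c)^-1.
  have E : (2^-1 : R) `^ c = (2 `^ c)^-1.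
    by rewrite -powRN -(@powR_inv1 _ 2)// -powRrM mulN1r.
  by rewrite powRM ?ltW// E invfM invrK mulrC.
rewrite lef_pV2 ?posrE ?powR_gt0//; last exact: lt_le_trans z1.
apply: ge0_ler_powR => //; rewrite ?nnegrE; [exact: ltW|exact: ltW|].
exact: cmod_ge0.
Qed.
End PowerWeight.

Section VerticalHolomorphy.
Context {R : realType}.
Notation mu := (@lebesgue_measure R).
Implicit Types (f g : R[i] -> R[i]) (x y : R).

Lemma ccontinuousD (f g : R -> R[i]) : ccontinuous f -> ccontinuous g ->
  ccontinuous (fun y => f y + g y).
Proof.
move=> [fR fI] [gR gI]; split=> y.
  by under eq_fun do rewrite ReD; apply: continuousD; [exact: fR|exact: gR].
by under eq_fun do rewrite ImD; apply: continuousD; [exact: fI|exact: gI].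
Qed.

Lemma ccontinuousM (f g : R -> R[i]) : ccontinuous f -> ccontinuous g ->
  ccontinuous (fun y => f y * g y).
Proof.
move=> [fR fI] [gR gI]; split=> y.
  have -> : (fun y => complex.Re (f y * g y)) =
     (fun y => complex.Re (f y) * complex.Re (g y) - complex.Im (f y) * complex.Im (g y)).
    by apply/funext => s; rewrite ReM.
  by apply: cvgB; apply: cvgM; [exact: fR|exact: gR|exact: fI|exact: gI].
have -> : (fun y => complex.Im (f y * g y)) =
   (fun y => complex.Re (f y) * complex.Im (g y) + complex.Im (f y) * complex.Re (g y)).
  by apply/funext => s; rewrite ImM.
by apply: cvgD; apply: cvgM; [exact: fR|exact: gI|exact: fI|exact: gR].
Qed.

Lemma ccontinuous_cst (k : R[i]) : ccontinuous (fun _ : R => k).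
Proof. by split => y; exact: cst_continuous. Qed.

(** Holomorphy on Re z > 1 with continuous derivative f', recorded by the two
    partial derivatives: this is the form in which lines of integration are
    shifted. *)
Definition lhol f f' : Prop := forall x y, 1 < x ->
  [/\ cderiv (fun x => f (x +i* y)) x (f' (x +i* y)),
      cderiv (fun y => f (x +i* y)) y ('i * f' (x +i* y))
    & ccontinuous (fun y => f' (x +i* y))].

Lemma lhol_continuous f f' x : lhol f f' -> 1 < x -> ccontinuous (fun y => f (x +i* y)).
Proof. move=> hf x1; apply: (@cderiv_ccontinuous _ _ (fun y => 'i * f' (x +i* y))) => y.
by have [] := hf x y x1. Qed.

Lemma eq_lhol f f' g' : (forall z, 1 < complex.Re z -> f' z = g' z) ->
  lhol f f' -> lhol f g'.
Proof.
move=> E hf x y x1; have [dx dy c] := hf x y x1; rewrite -E//; split => //.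
by rewrite (_ : (fun y => g' (x +i* y)) = (fun y => f' (x +i* y)))//; apply/funext => ?; rewrite E.
Qed.

Lemma lhol_cst k : lhol (fun _ => k) (fun _ => 0).
Proof.
move=> x y _; split; first exact: cderiv_cst.
  by rewrite mulr0; exact: cderiv_cst.
exact: ccontinuous_cst.
Qed.

Lemma lhol_id : lhol id (fun _ => 1).
Proof.
move=> x y _; split.
- by split; [exact: is_derive_id|exact: is_derive_cst].
- by rewrite mulr1; split; [exact: is_derive_cst|exact: is_derive_id].
- exact: ccontinuous_cst.
Qed.

Lemma lholD f f' g g' : lhol f f' -> lhol g g' ->
  lhol (fun z => f z + g z) (fun z => f' z + g' z).
Proof.
move=> hf hg x y x1; have [fx fy fc] := hf x y x1; have [gx gy gc] := hg x y x1.
split; [exact: cderivD| |exact: ccontinuousD].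
by rewrite mulrDr; exact: cderivD.
Qed.

Lemma lholM f f' g g' : lhol f f' -> lhol g g' ->
  lhol (fun z => f z * g z) (fun z => f z * g' z + f' z * g z).
Proof.
move=> hf hg x y x1; have [fx fy fc] := hf x y x1; have [gx gy gc] := hg x y x1.
split; first exact: (cderivM fx gx).
  apply: cderiv_eq (cderivM fy gy); ring.
by apply: ccontinuousD; apply: ccontinuousM => //;
  [apply: lhol_continuous hf _|apply: lhol_continuous hg _].
Qed.

Lemma lhol_exp f f' : lhol f f' -> lhol (fun z => cexp (f z)) (fun z => f' z * cexp (f z)).
Proof.
move=> hf x y x1; have [fx fy fc] := hf x y x1; split; first exact: cderiv_cexp.
  by rewrite mulrA; apply: (cderiv_cexp (f := fun y => f (x +i* y))).
apply: ccontinuousM => //; apply: (@cderiv_ccontinuous _ _ (fun s => 'i * f' (x +i* s) * cexp (f (x +i* s)))) => s.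
by have [_ sy _] := hf x s x1; exact: (cderiv_cexp (f := fun y => f (x +i* y))).
Qed.

Lemma lholV f f' : (forall z, 1 < complex.Re z -> f z != 0) -> lhol f f' ->
  lhol (fun z => (f z)^-1) (fun z => - f' z * (f z)^-1 * (f z)^-1).
Proof.
move=> n0 hf.
have E z : 1 < complex.Re z -> - f' z * (f z)^-1 * (f z)^-1 = - f' z / f z ^+ 2.
  by move=> /n0 z0; field.
have dy x y : 1 < x -> cderiv (fun y => (f (x +i* y))^-1) y (- ('i * f' (x +i* y)) / f (x +i* y) ^+ 2).
  by move=> x1; have [_ fy _] := hf x y x1; apply: (cderivV (f := fun y => f (x +i* y))) => //; exact: n0.
move=> x y x1; have [fx fy fc] := hf x y x1; split.
- by rewrite E//; apply: (cderivV (f := fun x => f (x +i* y))) => //; exact: n0.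
- by rewrite E// mulrA mulrN; exact: dy.
- have cV : ccontinuous (fun y => (f (x +i* y))^-1).
    exact: (@cderiv_ccontinuous _ _ (fun y => - ('i * f' (x +i* y)) / f (x +i* y) ^+ 2) (fun s => dy x s x1)).
  apply: (ccontinuousM _ cV); apply: (ccontinuousM _ cV).
  rewrite (_ : (fun y => - f' (x +i* y)) = (fun y => (- 1) * f' (x +i* y))).
    by apply: ccontinuousM fc; exact: ccontinuous_cst.
  by apply/funext => s; rewrite mulN1r.
Qed.

Lemma lhol_cdiff f f' f'' :
  (forall z, 0 < complex.Re z -> cdiff f z (f' z)) ->
  (forall z, 0 < complex.Re z -> cdiff f' z (f'' z)) -> lhol f f'.
Proof.
move=> df df' x y x1; have x0 : 0 < x by exact: lt_trans x1.
have [hx hy _] := lhol_id y x1.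
split.
- by rewrite -[X in cderiv _ _ X]mulr1; apply: (cderiv_cdiff (c := fun x => x +i* y)) => //; exact: df.
- apply: (cderiv_eq _ (cderiv_cdiff (c := fun y => x +i* y) (df (x +i* y) x0) hy)).
  by rewrite mulr1 mulrC.
- apply: (@cderiv_ccontinuous _ _ (fun s => f'' (x +i* s) * ('i * 1))) => s; have [_ hs _] := lhol_id s x1.
  by apply: (cderiv_cdiff (c := fun y => x +i* y) (df' (x +i* s) x0)); exact: hs.
Qed.

End VerticalHolomorphy.

(** * The kernel that carries the semigroup to the solution family *)

Section Symbol.
Context {R : realType}.
Notation mu := (@lebesgue_measure R).

(** The symbol 1/a^ is sectorial, regular, and of order rho < 1 on a right
    half-plane; the kernel estimates depend on nothing else about a. *)
Record sublinear_symbol (m m' : R[i] -> R[i]) (kappa K B rho : R) : Prop := {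
  symbol_hol : lhol m m' ;
  symbol_kappa : 0 < kappa ;
  symbol_K : 0 < K ;
  symbol_B : 0 < B ;
  symbol_rho : 0 < rho < 1 ;
  symbol_re : forall z, 1 < complex.Re z -> 0 < complex.Re (m z) ;
  symbol_sector : forall z, 1 < complex.Re z -> kappa * cmod (m z) <= complex.Re (m z) ;
  symbol_regular : forall z, 1 < complex.Re z -> cmod (z * m' z) <= K * cmod (m z) ;
  symbol_growth : forall z, 1 < complex.Re z -> cmod (m z) <= B * cmod z `^ rho }.

(** Two factors of this multiplier make the inversion integrals absolutely
    convergent; their modulus is at most 1, so they cost nothing in the energy.
    *)
Definition damp (N : R) (z : R[i]) : R[i] := N%:C / (z + N%:C).

Lemma cmod_sub_le (z w : R[i]) : cmod (z - w) <= cmod z + cmod w.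
Proof. by rewrite -(cmodN w) cmodD. Qed.

Lemma lt_cmod (c : R) (z : R[i]) : c < complex.Re z -> c < cmod z.
Proof. by move=> h; apply: lt_le_trans h (Re_le_cmod z). Qed.

Lemma damp_den (N : R) (z : R[i]) : 0 < N -> 0 < complex.Re z ->
  cmod z <= cmod (z + N%:C) /\ N <= cmod (z + N%:C).
Proof.
move=> N0 z0.
have E : cmod (z + N%:C) ^+ 2 = cmod z ^+ 2 + 2 * N * complex.Re z + N ^+ 2.
  by rewrite !sqr_cmod !ReImE/=; ring.
have Nz : 0 <= 2 * N * complex.Re z by rewrite !mulr_ge0// ltW.
split; rewrite -ler_sqr ?nnegrE ?cmod_ge0 ?(ltW N0)// E.
  by rewrite -addrA lerDl addr_ge0// sqr_ge0.
by rewrite lerDr addr_ge0// sqr_ge0.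
Qed.

Lemma damp_le1 (N : R) (z : R[i]) : 0 < N -> 0 < complex.Re z -> cmod (damp N z) <= 1.
Proof.
move=> N0 z0; have [_ h] := damp_den N0 z0.
rewrite /damp cmodM cmodV cmod_real ?(ltW N0)// ler_pdivrMr ?mul1r//.
exact: lt_le_trans h.
Qed.

Lemma damp_le (N : R) (z : R[i]) : 0 < N -> 0 < complex.Re z ->
  cmod (damp N z) <= N / cmod z.
Proof.
move=> N0 z0; have [h _] := damp_den N0 z0.
have cz : 0 < cmod z by exact: lt_cmod.
rewrite /damp cmodM cmodV cmod_real ?(ltW N0)//.
rewrite ler_wpM2l ?(ltW N0)// lef_pV2 ?posrE//.
exact: lt_le_trans h.
Qed.

Context (m m' : R[i] -> R[i]) (kappa K B rho : R).
Context (hm : sublinear_symbol m m' kappa K B rho).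

Lemma symbol_neq0 z : 1 < complex.Re z -> m z != 0.
Proof. by move=> /(symbol_re hm); apply: contraTneq => ->; rewrite ltxx. Qed.

Lemma symbol_growth_le (x y : R) : 1 < x ->
  cmod (m (x +i* y)) / cmod (x +i* y) ^+ 2 <= B * 2 `^ (2 - rho) * pweight (2 - rho) y.
Proof.
move=> x1; have [r0 r1] := andP (symbol_rho hm).
have c0 : 0 < 2 - rho by lra.
have z1 : 1 < cmod (x +i* y) by exact: lt_cmod.
have cz : 0 < cmod (x +i* y) by exact: lt_trans z1.
apply: (@le_trans _ _ (B * cmod (x +i* y) `^ (- (2 - rho)))); last first.
  by rewrite -mulrA ler_wpM2l ?(ltW (symbol_B hm))// powR_cmod_le// ltW.
have -> : cmod (x +i* y) `^ (- (2 - rho)) = cmod (x +i* y) `^ rho / cmod (x +i* y) ^+ 2.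
  rewrite opprB -(@powR_mulrn _ _ 2) ?cmod_ge0// powRB//.
  by apply/implyP => _; rewrite gt_eqF.
rewrite mulrA ler_wpM2r ?invr_ge0 ?exprn_ge0 ?cmod_ge0//.
exact: (symbol_growth hm).
Qed.

Definition amplitude (N : R) (z : R[i]) : R[i] := damp N z * damp N z * m z / z.

Lemma amplitude_le_symbol (N : R) z : 0 < N -> 1 < complex.Re z ->
  cmod (amplitude N z) <= cmod (m z) / cmod z.
Proof.
move=> N0 z1; have z0 : 0 < complex.Re z by exact: lt_trans z1.
rewrite /amplitude cmodM cmodV ler_wpM2r ?invr_ge0 ?cmod_ge0//.
rewrite cmodM -[leRHS]mul1r ler_wpM2r ?cmod_ge0// cmodM -[leRHS]mulr1.
by rewrite ler_pM ?cmod_ge0 ?damp_le1.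
Qed.

(** One damping factor gains N/|z|, the division by z gains 1/|z|, and the
    symbol costs at most |z|^rho: the total order rho - 2 is below -1, so this
    majorant is integrable. *)
Definition amplitude_bound (N y : R) : R :=
  N * (B * 2 `^ (2 - rho) * pweight (2 - rho) y).

Lemma amplitude_le (N x y : R) : 0 < N -> 1 < x ->
  cmod (amplitude N (x +i* y)) <= amplitude_bound N y.
Proof.
move=> N0 x1; have x0 : 0 < x by exact: lt_trans x1.
have z1 : 1 < cmod (x +i* y) by exact: lt_cmod.
have cz : 0 < cmod (x +i* y) by exact: lt_trans z1.
have := ler_wpM2l (ltW N0) (symbol_growth_le y x1); apply: le_trans.
rewrite /amplitude cmodM cmodV 2!cmodM.
apply: (@le_trans _ _ (1 * (N / cmod (x +i* y)) * cmod (m (x +i* y)) / cmod (x +i* y))).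
  rewrite ler_wpM2r ?invr_ge0 ?cmod_ge0// ler_wpM2r ?cmod_ge0//.
  by rewrite ler_pM ?cmod_ge0 ?damp_le1 ?damp_le.
rewrite mul1r expr2 invfM le_eqVlt; apply/orP; left; apply/eqP.
by field; rewrite gt_eqF.
Qed.

Lemma integrable_amplitude_bound (N : R) :
  mu.-integrable setT (EFin \o amplitude_bound N).
Proof.
have [r0 r1] := andP (symbol_rho hm).
have c1 : 1 < 2 - rho by lra.
by do 2! apply: integrable_realZ => //; exact: integrable_pweight.
Qed.

Lemma amplitude_bound_ge0 (N y : R) : 0 < N -> 0 <= amplitude_bound N y.
Proof.
move=> N0; rewrite /amplitude_bound mulr_ge0 ?(ltW N0)// mulr_ge0 ?pweight_ge0//.
by rewrite mulr_ge0 ?powR_ge0// ltW// (symbol_B hm).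
Qed.

(** The Laplace transform in t of the kernel that turns an orbit of the
    semigroup into a damped orbit of the solution family. The resolvent of the
    generator at m(z) is the superposition of the T(s), s >= 0, with weights
    exp(-m(z)s); hence the value 0 for s < 0. *)
Definition lsymbol (N s : R) (z : R[i]) : R[i] :=
  if 0 <= s then amplitude N z * cexp (- (m z * s%:C)) else 0.

Lemma cmod_lsymbol_le (N s : R) z : 1 < complex.Re z ->
  cmod (lsymbol N s z) <= cmod (amplitude N z) *
     (if 0 <= s then expR (- (complex.Re (m z) * s)) else 0).
Proof.
by move=> z1; rewrite /lsymbol; case: ifP => s0; rewrite ?mulr0 ?cmod0// cmodM cmod_expc.
Qed.

Lemma lsymbol_le (N s x y : R) : 0 < N -> 1 < x ->
  cmod (lsymbol N s (x +i* y)) <= amplitude_bound N y.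
Proof.
move=> N0 x1; apply: le_trans (amplitude_le y N0 x1).
apply: le_trans (cmod_lsymbol_le _ _ _) _ => //.
rewrite ler_piMr ?cmod_ge0//; case: ifP => // s0.
by rewrite -expR0 ler_expR oppr_le0 mulr_ge0// ltW// (symbol_re hm).
Qed.

Lemma lhol_damp (N : R) : 0 < N -> lhol (damp N) (fun z => - damp N z / (z + N%:C)).
Proof.
move=> N0; have n0 (z : R[i]) : 1 < complex.Re z -> z + N%:C != 0.
  move=> z1; rewrite -cmod_gt0; have [+ _] := damp_den N0 (lt_trans ltr01 z1).
  by apply: lt_le_trans; apply: lt_cmod; exact: lt_trans z1.
have := lholM (lhol_cst N%:C) (lholV n0 (lholD lhol_id (lhol_cst N%:C))).
apply: eq_lhol => z /n0 z0; rewrite /damp; field.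
by [].
Qed.

Lemma lhol_amplitude (N : R) : 0 < N ->
  lhol (amplitude N) (fun z => amplitude N z * (m' z / m z - 2 / (z + N%:C) - z^-1)).
Proof.
move=> N0; have n1 (z : R[i]) : 1 < complex.Re z -> z != 0.
  by move=> z1; apply: contraTneq z1 => ->; rewrite /= ltNge ler01.
have n0 (z : R[i]) : 1 < complex.Re z -> z + N%:C != 0.
  move=> z1; rewrite -cmod_gt0; have [+ _] := damp_den N0 (lt_trans ltr01 z1).
  by apply: lt_le_trans; apply: lt_cmod; exact: lt_trans z1.
have := lholM (lholM (lholM (lhol_damp N0) (lhol_damp N0)) (symbol_hol hm)) (lholV n1 lhol_id).
apply: eq_lhol => z z1; rewrite /amplitude; move: (damp N z) => d; field.
by rewrite n0// n1// symbol_neq0.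
Qed.

(** Up to the factor 2 pi, the inverse Laplace transform of the symbol along
    the line Re z = x; it does not depend on x. *)
Definition line_kernel (N x t s : R) : R[i] :=
  cint mu setT (fun y => cexp ((x +i* y) * t%:C) * lsymbol N s (x +i* y)).

(** The integrand is holomorphic and the amplitude bound is uniform in the
    abscissa; regularity bounds its derivative. *)
Lemma line_kernel_shift (N a b t s : R) : 0 < N -> 1 < a -> a <= b ->
  line_kernel N a t s = line_kernel N b t s.
Proof.
move=> N0 a1 ab; rewrite /line_kernel; case: (boolP (0 <= s)) => s0; last first.
  by apply: eq_cint => y _; rewrite /lsymbol (negbTE s0) !mulr0.
rewrite /lsymbol s0.
pose b1 := b + 1.
pose H (z : R[i]) := cexp (z * t%:C + - s%:C * m z) * amplitude N z.
have HE x : (fun y : R => cexp ((x +i* y) * t%:C) * (amplitude N (x +i* y) * cexp (- (m (x +i* y) * s%:C)))) =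
   (fun y => H (x +i* y)).
  by apply/funext => y; rewrite /H cexpD mulrCA mulrC -!mulrA [m _ * _]mulrC mulNr.
apply: (etrans (congr1 (cint mu setT) (HE a))).
apply: (etrans _ (esym (congr1 (cint mu setT) (HE b)))).
pose H' (z : R[i]) := H z * (t%:C - s%:C * m' z + m' z / m z - 2 / (z + N%:C) - z^-1).
have hH : lhol H H'.
  have := lholM (lhol_exp (lholD (lholM lhol_id (lhol_cst t%:C))
     (lholM (lhol_cst (- s%:C)) (symbol_hol hm)))) (lhol_amplitude N0).
  by apply: eq_lhol => z z1; rewrite /H' /H; ring.
have HM (x y : R) : x \in `]1, b1[ -> cmod (H (x +i* y)) <= expR (b1 * `|t|) * amplitude_bound N y.
  rewrite in_itv/= => /andP[x1 xb].
  have -> : H (x +i* y) = cexp ((x +i* y) * t%:C) * lsymbol N s (x +i* y).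
    by rewrite -(congr1 (@^~ y) (HE x))/= /lsymbol s0.
  rewrite cmodM ler_pM ?cmod_ge0 ?lsymbol_le//.
  rewrite cmod_cexp ler_expR Re_mulC/= (le_trans (ler_norm _))// normrM ler_wpM2r//.
  by rewrite ger0_norm ltW// (lt_trans ltr01).
apply: (@cint_line_shift _ H H' 1 b1 (expR (b1 * `|t|) * (N * (B * 2 `^ (2 - rho))) *
   (`|t| + s * (K * B) + K + 2 + 1)) a b (fun y => expR (b1 * `|t|) * amplitude_bound N y)) => //.
- by rewrite in_itv/= a1/= /b1 (le_lt_trans ab)// ltrDl.
- by rewrite in_itv/= (lt_le_trans a1)//= /b1 ltrDl.
- by move=> x y; rewrite in_itv/= => /andP[x1 _]; have [] := hH x y x1.
- by move=> x y; rewrite in_itv/= => /andP[x1 _]; have [] := hH x y x1.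
- by move=> x; rewrite in_itv/= => /andP[x1 _]; have [] := hH x 0 x1.
- move=> x y xI; have x1 : 1 < x by move: xI; rewrite in_itv/= => /andP[].
  have x0 : 0 < x by exact: lt_trans x1.
  set z := x +i* y; have z1 : 1 < complex.Re z by [].
  have cz1 : 1 < cmod z by exact: lt_cmod.
  have cz : 0 < cmod z by exact: lt_trans cz1.
  have iz : (cmod z)^-1 <= 1 by rewrite invf_le1 ?ltW.
  have [h1 _] := damp_den N0 (lt_trans ltr01 z1).
  have izN : (cmod (z + N%:C))^-1 <= 1.
    by rewrite invf_le1 ?(le_trans (ltW cz1))// (lt_le_trans cz).
  have m0 : 0 < cmod (m z) by rewrite cmod_gt0 symbol_neq0.
  have hK : cmod (m' z) <= K * cmod (m z) / cmod z.
    by rewrite ler_pdivlMr// mulrC -cmodM; exact: (symbol_regular hm).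
  have hq : cmod (m' z / m z) <= K.
    rewrite cmodM cmodV ler_pdivrMr// (le_trans hK)// ler_piMr//.
    by rewrite mulr_ge0 ?cmod_ge0// ltW// (symbol_K hm).
  have hmB : cmod (m z) / cmod z <= B.
    rewrite ler_pdivrMr// (le_trans (symbol_growth hm z1))// ler_wpM2l ?(ltW (symbol_B hm))//.
    by apply: ler1_powR; rewrite ltW//; have /andP[] := symbol_rho hm.
  have hm' : cmod (m' z) <= K * B.
    by rewrite (le_trans hK)// -mulrA ler_wpM2l// ltW// (symbol_K hm).
  rewrite /H' cmodM; apply: ler_pM; rewrite ?cmod_ge0//.
    apply: le_trans (HM x y xI) _; rewrite ler_wpM2l ?expR_ge0// ler_wpM2l ?(ltW N0)//.
    rewrite ler_piMr//; first by rewrite mulr_ge0 ?powR_ge0// ltW// (symbol_B hm).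
    have /andP[r0 r1] := symbol_rho hm.
    rewrite /pweight -[leRHS](@powRr0 _ (1 + `|y|)) ler_powR ?lerDl//; lra.
  rewrite (le_trans (cmod_sub_le _ _))// cmodV lerD//.
  rewrite (le_trans (cmod_sub_le _ _))// lerD//.
    rewrite (le_trans (cmodD _ _))// lerD//.
    rewrite (le_trans (cmod_sub_le _ _))// cmodR lerD// cmodM cmod_real//.
    by rewrite ler_wpM2l.
  rewrite cmodM cmodV (_ : cmod 2 = 2); last first.
    by rewrite (_ : 2 = (2 : R)%:C) ?cmod_real// rmorphD.
  by rewrite ler_piMr.
- by apply: integrable_realZ => //; exact: integrable_amplitude_bound.
- have c0 : 0 < 2 - rho by have /andP[r0 r1] := symbol_rho hm; lra.
  rewrite -[X in _ --> X](mulr0 (expR (b1 * `|t|))).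
  apply: cvgM; first exact: cvg_cst.
  rewrite -[X in _ --> X](mulr0 N); apply: cvgM; first exact: cvg_cst.
  rewrite -[X in _ --> X](mulr0 (B * 2 `^ (2 - rho))); apply: cvgM; first exact: cvg_cst.
  exact: cvg_pweight.
- have c0 : 0 < 2 - rho by have /andP[r0 r1] := symbol_rho hm; lra.
  rewrite -[X in _ --> X](mulr0 (expR (b1 * `|t|))).
  apply: cvgM; first exact: cvg_cst.
  rewrite -[X in _ --> X](mulr0 N); apply: cvgM; first exact: cvg_cst.
  rewrite -[X in _ --> X](mulr0 (B * 2 `^ (2 - rho))); apply: cvgM; first exact: cvg_cst.
  apply: cvg_trans (cvg_pweight c0); apply: near_eq_cvg; apply: nearW => n.
  by rewrite pweightN.
Qed.

End Symbol.

Section PlaneIntegral.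
Context {R : realType}.

Lemma measurable_integral_plane (f : R -> R -> \bar R) :
  measurable_fun setT (fun z : R * R => f z.1 z.2) ->
  (forall x y, (0 <= f x y)%E) ->
  measurable_fun setT (fun x => (\int[@lebesgue_measure R]_y f x y)%E).
Proof.
move=> mf f0.
by apply: (@measurable_fun_fubini_tonelli_F _ _ (measurableTypeR R) (measurableTypeR R)
  R (@lebesgue_measure R) (fun z => f z.1 z.2)).
Qed.

End PlaneIntegral.

Section KernelEnergy.
Context {R : realType}.
Notation mu := (@lebesgue_measure R).
Context (m m' : R[i] -> R[i]) (kappa K B rho : R).
Context (hm : sublinear_symbol m m' kappa K B rho).

Lemma pweight_le1 (c y : R) : 0 <= c -> pweight c y <= 1.
Proof.
by move=> c0; rewrite /pweight -[leRHS](@powRr0 _ (1 + `|y|)) ler_powR ?lerDl// oppr_le0.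
Qed.

Lemma cmeas_symbol_line (x : R) : 1 < x -> cmeas setT (fun y : R => m (x +i* y)).
Proof.
by move=> x1; apply: ccontinuous_cmeas => //; apply: lhol_continuous (symbol_hol hm) x1.
Qed.

Lemma cmeas_amplitude (N x : R) : 0 < N -> 1 < x ->
  cmeas setT (fun y : R => amplitude m N (x +i* y)).
Proof.
by move=> N0 x1; apply: ccontinuous_cmeas => //; apply: lhol_continuous (lhol_amplitude hm N0) x1.
Qed.

Lemma lsymbolE (N s : R) z : lsymbol m N s z =
  (\1_(`[0, +oo[%classic) s)%:C * (amplitude m N z * cexp (- (m z * s%:C))).
Proof.
rewrite /lsymbol indicE.
have -> : (s \in `[0%R, +oo[%classic) = (0 <= s).
  by apply/idP/idP; rewrite inE/= in_itv/= andbT.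
by case: (0 <= s); rewrite ?mul1r ?mul0r.
Qed.

Lemma cmeas_lsymbol_plane (N x : R) : 0 < N -> 1 < x ->
  cmeas setT (fun p : R * R => lsymbol m N p.2 (x +i* p.1)).
Proof.
move=> N0 x1; rewrite (_ : (fun p : R * R => _) = (fun p : R * R =>
  (\1_(`[0, +oo[%classic) p.2)%:C * (amplitude m N (x +i* p.1) * cexp (- (m (x +i* p.1) * p.2%:C))))).
  apply: cmeasM.
    apply: (cmeas_on_snd (f := fun s => (\1_(`[0, +oo[%classic) s)%:C)).
    by apply: cmeas_real; exact: measurable_indic.
  apply: cmeasM; first exact: (cmeas_on_fst (cmeas_amplitude N0 x1)).
  apply: cmeas_cexp; apply: cmeasN; apply: cmeasM.
    exact: (cmeas_on_fst (cmeas_symbol_line x1)).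
  by apply: (cmeas_on_snd (f := fun s => s%:C)); apply: cmeas_real; exact: measurable_id.
by apply/funext => p; rewrite lsymbolE.
Qed.

Lemma cmeas_comp d d' (T1 : measurableType d) (T2 : measurableType d') (f : T2 -> R[i]) (g : T1 -> T2) :
  cmeas setT f -> measurable_fun setT g -> cmeas setT (fun x => f (g x)).
Proof. by move=> [fR fI] mg; split; [exact: measurableT_comp fR mg|exact: measurableT_comp fI mg]. Qed.

Lemma cintble_line_kernel (N x t s : R) : 0 < N -> 1 < x ->
  cintble mu setT (fun y => cexp ((x +i* y) * t%:C) * lsymbol m N s (x +i* y)).
Proof.
move=> N0 x1; apply: (cintble_le _ _ (integrable_realZ _ (expR (x * t)) (integrable_amplitude_bound hm N))) => //.
  apply: cmeasM.
    apply: cmeas_cexp; apply: cmeasM; last exact: cmeas_cst.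
    by split => /=; [exact: measurable_cst|exact: measurable_id].
  apply: (cmeas_comp (f := fun p : R * R => lsymbol m N p.2 (x +i* p.1)) (g := fun y => (y, s))).
    exact: cmeas_lsymbol_plane.
  exact: measurable_fun_pair.
move=> y _; rewrite cmodM cmod_cexp Re_mulC/= ler_wpM2l ?expR_ge0//.
exact: (lsymbol_le hm).
Qed.

Lemma cmeas_line_kernel (N x : R) : 0 < N -> 1 < x ->
  cmeas setT (fun p : R * R => line_kernel m N x p.1 p.2).
Proof.
move=> N0 x1.
apply: (@cmeas_cint_param _ _ (measurableTypeR R * measurableTypeR R)%type (measurableTypeR R) R mu
  (fun q => cexp ((x +i* q.2) * q.1.1%:C) * lsymbol m N q.1.2 (x +i* q.2))); last first.
  by move=> p; exact: cintble_line_kernel.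
apply: cmeasM.
  apply: cmeas_cexp; apply: cmeasM.
    by split => /=; [exact: measurable_cst|exact: measurable_snd].
  apply: cmeas_real; exact: (measurableT_comp measurable_fst measurable_fst).
apply: (cmeas_comp (f := fun p : R * R => lsymbol m N p.2 (x +i* p.1)) (g := fun q => (q.2, q.1.2))).
  exact: cmeas_lsymbol_plane.
apply: measurable_fun_pair; first exact: measurable_snd.
exact: (measurableT_comp measurable_snd measurable_fst).
Qed.

(** The s-integral is |amplitude|^2 / (2 Re m). Sectoriality replaces Re m by
    kappa |m|, which cancels one of the two factors |m| and leaves |m|/|z|^2,
    of integrable order rho - 2 on the line. *)
Lemma integral_sqr_lsymbol (N x y : R) : 0 < N -> 1 < x ->
  (\int[mu]_s (cmod (lsymbol m N s (x +i* y)) ^+ 2)%:E <=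
    (B * 2 `^ (2 - rho) / (2 * kappa) * pweight (2 - rho) y)%:E)%E.
Proof.
move=> N0 x1; set z := x +i* y; have z1 : 1 < complex.Re z by [].
have m0 : 0 < complex.Re (m z) := symbol_re hm z1.
have cm0 : 0 < cmod (m z) by rewrite cmod_gt0 (symbol_neq0 hm).
have k0 := symbol_kappa hm.
have E : (\int[mu]_s (cmod (lsymbol m N s z) ^+ 2)%:E =
    (cmod (amplitude m N z) ^+ 2)%:E * \int[mu]_(s in `[0%R, +oo[) (expR (- (2 * complex.Re (m z) * s)))%:E)%E.
  rewrite -ge0_integralZl//; last 2 first.
  - apply/measurable_EFinP; apply: measurable_funTS; apply: continuous_measurable_fun.
    exact: continuous_expM.
  - by rewrite lee_fin sqr_ge0.
  rewrite [RHS]integral_mkcond; apply: eq_integral => s _.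
  rewrite patchE /lsymbol.
  have -> : (s \in `[0%R, +oo[%classic) = (0 <= s).
    by apply/idP/idP; rewrite inE/= in_itv/= andbT.
  case: ifP => _; last by rewrite cmod0 expr0n.
  rewrite -EFinM cmodM cmod_expc exprMn expr2 -[X in _ * X]expRD.
  by congr ((_ * expR _)%:E); ring.
rewrite E ge0_integral_expM ?mulr_gt0// -EFinM lee_fin.
have h1 := amplitude_le_symbol m N0 z1.
apply: (@le_trans _ _ ((cmod (m z) / cmod z) ^+ 2 / (2 * (kappa * cmod (m z))))).
  apply: ler_pM; rewrite ?sqr_ge0 ?invr_ge0 ?mulr_ge0 ?(ltW m0)//.
    by rewrite ler_sqr ?nnegrE ?cmod_ge0 ?divr_ge0 ?cmod_ge0.
  rewrite lef_pV2 ?posrE ?mulr_gt0// ler_wpM2l//.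
  exact: (symbol_sector hm).
have h2 := symbol_growth_le hm y x1.
have -> : (cmod (m z) / cmod z) ^+ 2 / (2 * (kappa * cmod (m z))) =
   cmod (m z) / cmod z ^+ 2 / (2 * kappa).
  have cz : cmod z != 0 by rewrite gt_eqF// lt_cmod//= (lt_trans _ x1).
  by field; rewrite cz !gt_eqF.
have -> : B * 2 `^ (2 - rho) / (2 * kappa) * pweight (2 - rho) y =
  B * 2 `^ (2 - rho) * pweight (2 - rho) y / (2 * kappa).
  by field; rewrite gt_eqF.
by rewrite ler_wpM2r// invr_ge0 mulr_ge0// ltW.
Qed.

(** The majorant of the squared symbol, integrated over s, is integrated over
    the line; 2 pi is the constant of Plancherel's theorem. *)
Definition kernel_energy : R :=
  2 * pi * \int[mu]_y (B * 2 `^ (2 - rho) / (2 * kappa) * pweight (2 - rho) y).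

(** Plancherel in t, at fixed s, bounds the weighted energy of the kernel by
    that of its symbol on the line Re z = 2; the weight exp(-4t) is the square
    of exp(-2t). The bound is uniform in N as the damping multiplier has
    modulus at most one, although the kernel converges absolutely for finite N
    only. *)
Lemma line_kernel_energy (N : R) : 0 < N ->
  (\int[mu]_t \int[mu]_s (expR (- (4 * t)) * cmod (line_kernel m N 2 t s) ^+ 2)%:E <=
    kernel_energy%:E)%E.
Proof.
move=> N0; have x1 : 1 < 2 :> R by rewrite ltr1n.
have mV : measurable_fun setT (fun p : R * R => cmod (line_kernel m N 2 p.1 p.2) ^+ 2).
  exact: cmeas_sqr_cmod (cmeas_line_kernel N0 x1).
have mVe : measurable_fun setT (fun p : R * R => (expR (- (4 * p.1)) * cmod (line_kernel m N 2 p.1 p.2) ^+ 2)%:E).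
  apply/measurable_EFinP; apply: measurable_funM mV.
  apply: (measurable_on_fst (f := fun t => expR (- (4 * t)))).
  by apply: continuous_measurable_fun; exact: continuous_expM.
rewrite (tonelli_plane (f := fun t s => (expR (- (4 * t)) * cmod (line_kernel m N 2 t s) ^+ 2)%:E))//; last first.
  by move=> t s; rewrite lee_fin mulr_ge0 ?expR_ge0 ?sqr_ge0.
pose F s y := lsymbol m N s (2 +i* y).
have iF s : cintble mu setT (F s).
  have := cintble_line_kernel 0 s N0 x1.
  by under [X in cintble _ _ X]eq_fun => y do rewrite mulr0 cexp0 mul1r.
have iF2 s : mu.-integrable setT (fun y => (cmod (F s y) ^+ 2)%:E).
  pose k := N * (B * 2 `^ (2 - rho)).
  apply: (le_integrable _ _ _ (integrable_realZ _ k (integrable_amplitude_bound hm N))) => //.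
    by apply/measurable_EFinP; apply: cmeas_sqr_cmod; exact: cintble_meas (iF s).
  move=> y _ /=; rewrite lee_fin !ger0_norm ?sqr_ge0//; last first.
    apply: mulr_ge0; last exact: (amplitude_bound_ge0 hm).
    by rewrite mulr_ge0 ?(ltW N0)// mulr_ge0 ?powR_ge0// ltW// (symbol_B hm).
  have h := lsymbol_le hm s y N0 x1.
  rewrite expr2; apply: ler_pM => //; rewrite ?cmod_ge0//.
  apply: le_trans h _; rewrite /amplitude_bound /k ler_wpM2l ?(ltW N0)//.
  rewrite ler_piMr//; first by rewrite mulr_ge0 ?powR_ge0// ltW// (symbol_B hm).
  by apply: pweight_le1; have /andP[r0 r1] := symbol_rho hm; lra.
have E1 t s : expR (- (4 * t)) * cmod (line_kernel m N 2 t s) ^+ 2 =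
    cmod (cint mu setT (fun y => F s y * osc (y * t))) ^+ 2.
  rewrite /line_kernel.
  have -> : (fun y => cexp ((2 +i* y) * t%:C) * lsymbol m N s (2 +i* y)) =
     (fun y => (expR (2 * t))%:C * (F s y * osc (y * t))).
    apply/funext => y.
    have -> : cexp ((2 +i* y) * t%:C) = (expR (2 * t))%:C * osc (y * t).
      by rewrite /osc -cexpR -cexpD; congr cexp; apply: complex_ext; rewrite !ReImE/=; ring.
    by rewrite -mulrA [osc _ * _]mulrC.
  rewrite cintZ//; last by apply: cintbleM_osc; [exact: iF|exact: measurable_funM].
  rewrite cmodM cmod_real ?expR_ge0// exprMn mulrA expr2 -!expRD.
  rewrite (_ : - (4 * t) + (2 * t + 2 * t) = 0) ?expR0 ?mul1r//; ring.
have E2 s : (\int[mu]_t (expR (- (4 * t)) * cmod (line_kernel m N 2 t s) ^+ 2)%:E <=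
    (2 * pi)%:E * \int[mu]_y (cmod (F s y) ^+ 2)%:E)%E.
  under eq_integral => t _ do rewrite E1.
  rewrite -(EFin_Rintegral measurableT (iF2 s)) -EFinM; exact: plancherel_le (iF s) (iF2 s).
have mF : measurable_fun setT (fun p : R * R => (cmod (F p.2 p.1) ^+ 2)%:E).
  apply/measurable_EFinP; exact: cmeas_sqr_cmod (cmeas_lsymbol_plane N0 x1).
have mF' : measurable_fun setT (fun p : R * R => (cmod (F p.1 p.2) ^+ 2)%:E).
  exact: (measurableT_comp mF (measurable_fun_pair measurable_snd measurable_fst)).
have pi2 : 0 <= 2 * pi :> R by rewrite mulr_ge0// pi_ge0.
have F0 s y : (0%R <= (cmod (F s y) ^+ 2)%:E)%E by rewrite lee_fin sqr_ge0.
have mG : measurable_fun setT (fun s => (\int[mu]_y (cmod (F s y) ^+ 2)%:E)%E).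
  exact: (measurable_integral_plane (f := fun s y => (cmod (F s y) ^+ 2)%:E)).
have mV' : measurable_fun setT (fun p : R * R => (expR (- (4 * p.2)) * cmod (line_kernel m N 2 p.2 p.1) ^+ 2)%:E).
  exact: (measurableT_comp mVe (measurable_fun_pair measurable_snd measurable_fst)).
have V0 t s : (0%R <= (expR (- (4 * t)) * cmod (line_kernel m N 2 t s) ^+ 2)%:E)%E.
  by rewrite lee_fin mulr_ge0 ?expR_ge0 ?sqr_ge0.
have mE := @measurable_integral_plane _ (fun s t => (expR (- (4 * t)) * cmod (line_kernel m N 2 t s) ^+ 2)%:E) mV' (fun s t => V0 t s).
apply: (@le_trans _ _ (\int[mu]_s ((2 * pi)%:E * \int[mu]_y (cmod (F s y) ^+ 2)%:E))%E).
  apply: ge0_le_integral => //.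
  - by move=> s _; apply: integral_ge0 => t _; exact: V0.
  - exact: measurable_funeM.
rewrite ge0_integralZl//; last by move=> s _; apply: integral_ge0 => t _; exact: F0.
rewrite (tonelli_plane (f := fun s y => (cmod (F s y) ^+ 2)%:E))//.
rewrite /kernel_energy [leRHS]EFinM; apply: lee_wpmul2l; first by rewrite lee_fin.
have iw : mu.-integrable setT (fun y => (B * 2 `^ (2 - rho) / (2 * kappa) * pweight (2 - rho) y)%:E).
  apply: integrable_realZ => //; apply: integrable_pweight.
  by have /andP[r0 r1] := symbol_rho hm; lra.
rewrite EFin_Rintegral//; apply: ge0_le_integral => //.
- by move=> y _; apply: integral_ge0 => s _; exact: F0.
- exact: (measurable_integral_plane (f := fun y s => (cmod (F s y) ^+ 2)%:E)).
- exact: measurable_int iw.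
- by move=> y _; exact: integral_sqr_lsymbol.
Qed.
End KernelEnergy.

(** * Damped inversion of Laplace transforms *)

Section DampingKernel.
Context {R : realType}.
Notation mu := (@lebesgue_measure R).

(** The density whose convolution operator has the multiplier 1/(z + c)^2. *)
Definition ramp (c t : R) : R := Num.max t 0 * expR (- (c * t)).

Lemma ramp_ge0 c t : 0 <= ramp c t.
Proof. by rewrite mulr_ge0 ?expR_ge0// le_max lexx orbT. Qed.

Lemma continuous_ramp c : continuous (ramp c).
Proof.
have H : continuous (fun t : R => Num.max t 0).
  have -> : (fun t : R => Num.max t 0) = (fun t => (t + `|t|) / 2).
    apply/funext => s; have [s0|s0] := leP 0 s.
      by rewrite ger0_norm//; field.
    by rewrite ltr0_norm// subrr mul0r.
  move=> t; apply: cvgM; last exact: cvg_cst.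
  by apply: cvgD; [exact: cvg_id|exact: norm_continuous].
by move=> t; apply: cvgM; [exact: H|exact: continuous_expM].
Qed.

Lemma ramp_mkcond c t : (ramp c t)%:C =
  if t \in (`[0, +oo[%classic : set R) then t%:C * cexp (- (c%:C * t%:C)) else 0.
Proof.
have -> : (t \in (`[0%R, +oo[%classic : set R)) = (0 <= t).
  by apply/idP/idP; rewrite inE/= in_itv/= andbT.
rewrite /ramp; have [t0|t0] := leP 0 t; last by rewrite mul0r.
by rewrite rmorphM/= -cexpR; congr (_ * cexp _); apply: complex_ext; rewrite !ReImE/=; ring.
Qed.

Lemma cintble_ramp c : 0 < c -> cintble mu setT (fun t => (ramp c t)%:C).
Proof.
move=> c0; under eq_fun do rewrite ramp_mkcond.
by apply: (cintble_mkcond mu (D := `[0, +oo[%classic) _ _).1 (@cintble_xexpc _ c%:C c0).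
Qed.

Lemma integrable_ramp c : 0 < c -> mu.-integrable setT (EFin \o ramp c).
Proof. by move=> /cintble_ramp[]. Qed.

Lemma cint_osc_ramp c y : 0 < c ->
  cint mu setT (fun t => osc (- (y * t)) * (ramp c t)%:C) = (c +i* y) ^- 2.
Proof.
move=> c0; rewrite -cint_xexpc// [RHS]cint_mkcond; apply: eq_cint => t _.
rewrite ramp_mkcond; case: ifP => _; last by rewrite mulr0.
rewrite mulrCA -cexpD; congr (_ * cexp _).
by apply: complex_ext; rewrite !ReImE/=; ring.
Qed.

Lemma Rintegral_ramp c : 0 < c -> \int[mu]_t ramp c t = c ^- 2.
Proof.
move=> c0; have := cint_osc_ramp 0 c0.
have -> : (fun t => osc (- (0 * t)) * (ramp c t)%:C) = (fun t => (ramp c t)%:C).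
  by apply/funext => t; rewrite mul0r oppr0 osc0 mul1r.
rewrite cint_real => /(congr1 (@complex.Re R))/= ->.
by rewrite !(mul0r, mulr0, subr0, addr0) expr0n addr0; field; rewrite gt_eqF.
Qed.

Lemma ramp_le c t : 0 < c -> ramp c t <= 2 / c.
Proof.
move=> c0; rewrite /ramp; have [t0|t0] := leP 0 t; last by rewrite mul0r divr_ge0// ltW.
apply: le_trans (xexp_le c0 t0) _; rewrite ler_piMr//; first by rewrite divr_ge0// ltW.
by rewrite -expR0 ler_expR oppr_le0 mulr_ge0// divr_ge0// ltW.
Qed.

Lemma cintble_inv_sqr c : 0 < c -> cintble mu setT (fun y : R => (c +i* y) ^- 2).
Proof.
move=> c0.
apply: (cintble_le _ _ (integrable_realZ _ (2 * c)^-1 (integrable_pois c0))) => //.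
  apply: ccontinuous_cmeas => //.
  have n0 (y : R) : (c +i* y) ^+ 2 != 0.
    by rewrite expf_neq0// -cmod_gt0; apply: lt_cmod.
  have dl (y : R) : cderiv (fun y => c +i* y) y 'i.
    by split; [exact: is_derive_cst|exact: is_derive_id].
  exact: (cderiv_ccontinuous (fun y => cderivV (n0 y) (cderivM (dl y) (dl y)))).
move=> y _; rewrite cmodV cmodX sqr_cmod /pois/=.
by rewrite le_eqVlt; apply/orP; left; apply/eqP; field; rewrite gt_eqF ?pois_den_gt0// gt_eqF.
Qed.

(** The ramp is continuous with integrable transform, so Fourier inversion
    applies to it pointwise. *)
Lemma ramp_inversion c u : 0 < c ->
  cint mu setT (fun y => osc (y * u) * (c +i* y) ^- 2) = (2 * pi * ramp c u)%:C.
Proof.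
move=> c0; have E y := cint_osc_ramp y c0.
have -> : (fun y => osc (y * u) * (c +i* y) ^- 2) =
   (fun y => osc (y * u) * cint mu setT (fun t => osc (- (y * t)) * (ramp c t)%:C)).
  by apply/funext => y; rewrite E.
rewrite (@fourier_inversion _ (fun t => (ramp c t)%:C) (2 / c) u).
- by rewrite [RHS]rmorphM.
- exact: cintble_ramp.
- by move=> t; rewrite cmod_real ?ramp_ge0// ramp_le.
- move=> e e0; have := @continuous_ramp c u.
  move=> /cvgrPdist_lt /(_ e e0) /nbhs_ballP[d /= d0 Hd]; exists d => // x xd.
  rewrite -rmorphB/= cmodR distrC ltW//; apply: Hd.
  by rewrite /ball/= distrC.
- under eq_fun do rewrite E.
  exact: cintble_inv_sqr.
Qed.

(** The density whose convolution operator has the multiplier (N/(z + N))^2; it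
    has mass 1 and concentrates at 0 as N grows. *)
Definition damping (N u : R) : R := N ^+ 2 * ramp N u.

Lemma damping_ge0 N u : 0 <= damping N u.
Proof. by rewrite mulr_ge0 ?sqr_ge0 ?ramp_ge0. Qed.

Lemma integrable_damping N : 0 < N -> mu.-integrable setT (EFin \o damping N).
Proof. by move=> N0; apply: integrable_realZ => //; exact: integrable_ramp. Qed.

Lemma Rintegral_damping N : 0 < N -> \int[mu]_u damping N u = 1.
Proof.
move=> N0; rewrite RintegralZl//; last exact: integrable_ramp.
by rewrite Rintegral_ramp// divff// expf_neq0// gt_eqF.
Qed.

(** On y >= d half of the exponential yields the factor exp(-nd/2), with N = n
    + 1; the other half leaves a density of mass 4. *)
Lemma damping_tail (d : R) : 0 < d ->
  exists2 tau : nat -> R, (tau n) @[n --> \oo] --> (0 : R) &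
    forall n, \int[mu]_y (if d <= `|y| then damping n.+1%:R y else 0) <= tau n.
Proof.
move=> d0; exists (fun n => 4 * expR (- (d / 2 * n%:R))).
  rewrite -[X in _ --> X](mulr0 4); apply: cvgM; first exact: cvg_cst.
  by apply: cvg_expRM; rewrite divr_gt0.
move=> n; set N : R := n.+1%:R; have N0 : 0 < N by [].
have N20 : 0 < N / 2 by rewrite divr_gt0.
have i2 := integrable_ramp N20.
have mk : measurable_fun setT (fun y : R => if d <= `|y| then damping N y else 0).
  apply: measurable_fun_ifT.
  - by apply: measurable_fun_ler; [exact: measurable_cst|apply: continuous_measurable_fun; exact: norm_continuous].
  - apply/measurable_EFinP; exact: measurable_int (integrable_damping N0).
  - exact: measurable_cst.
have bd y : 0 <= (if d <= `|y| then damping N y else 0) <= N ^+ 2 * expR (- (d / 2 * n%:R)) * ramp (N / 2) y.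
  case: ifP => dy; last by rewrite lexx/= mulr_ge0 ?ramp_ge0// mulr_ge0 ?sqr_ge0 ?expR_ge0.
  rewrite damping_ge0/= /damping -mulrA ler_wpM2l ?sqr_ge0// /ramp mulrCA.
  move: dy; have [y0|y0] := leP 0 y => dy; last by rewrite !mul0r.
  rewrite ler_wpM2l// -expRD ler_expR.
  have E : N = n%:R + 1 by rewrite /N -natr1.
  have n0 : 0 <= n%:R :> R by [].
  rewrite ger0_norm// in dy; rewrite E.
  have : (n%:R + 1) * d <= (n%:R + 1) * y by rewrite ler_wpM2l// addr_ge0.
  have -> : (n%:R + 1) / 2 * y = ((n%:R + 1) * y) / 2 by field.
  have -> : d / 2 * n%:R = ((n%:R + 1) * d - d) / 2 by field.
  by move: ((n%:R + 1) * d) ((n%:R + 1) * y) => p q; lra.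
have [_] := Rintegral_le_of_le mk (integrable_realZ measurableT _ i2) bd.
move=> /le_trans; apply; rewrite RintegralZl// Rintegral_ramp//.
rewrite le_eqVlt; apply/orP; left; apply/eqP; field.
by rewrite gt_eqF.
Qed.

End DampingKernel.

Section Representation.
Context {R : realType}.
Notation mu := (@lebesgue_measure R).
Context (m m' : R[i] -> R[i]) (kappa K B rho : R).
Context (hm : sublinear_symbol m m' kappa K B rho).
Context (w sigma : R -> R[i]) (E : R[i] -> R[i]) (tau M : R).
Context (iw : cintble mu setT w) (w0 : forall s, s < 0 -> w s = 0).
Context (isigma : cintble mu setT sigma) (sigma0 : forall r, r < 0 -> sigma r = 0).
Context (sigmaE : forall z, 1 < complex.Re z ->
  cint mu setT (fun r => cexp (- (z * r%:C)) * sigma r) =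
    m z / z * cint mu setT (fun s => cexp (- (m z * s%:C)) * w s) + m z * E z).
Context (E_le : forall z, 1 < complex.Re z -> cmod (E z) <= M * expR (- (tau * complex.Re z))).

Lemma damping_lineE (N x u y : R) : 0 < N -> 0 < x ->
  cexp ((x +i* y) * u%:C) * (damp N (x +i* y) * damp N (x +i* y)) =
  (N ^+ 2 * expR (x * u))%:C * (osc (y * u) * ((x + N) +i* y) ^- 2).
Proof.
move=> N0 x0; have xN : 0 < x + N by rewrite addr_gt0.
have n0 : (x + N) +i* y != 0 by rewrite -cmod_gt0; apply: lt_cmod.
rewrite /damp.
have -> : (x +i* y) + N%:C = (x + N) +i* y by apply: complex_ext; rewrite !ReImE/= ?addr0.
have -> : cexp ((x +i* y) * u%:C) = (expR (x * u))%:C * osc (y * u).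
  by rewrite /osc -cexpR -cexpD; congr cexp; apply: complex_ext; rewrite !ReImE/=; ring.
by rewrite !rmorphM/=; field; exact: n0.
Qed.

Lemma cintble_osc_inv_sqr (c u : R) : 0 < c ->
  cintble mu setT (fun y : R => osc (y * u) * (c +i* y) ^- 2).
Proof.
move=> c0; under eq_fun do rewrite mulrC.
by apply: cintbleM_osc; [exact: cintble_inv_sqr|exact: measurable_funM].
Qed.

Lemma cintble_damping_line (N x u : R) : 0 < N -> 0 < x ->
  cintble mu setT (fun y => cexp ((x +i* y) * u%:C) * (damp N (x +i* y) * damp N (x +i* y))).
Proof.
move=> N0 x0; under eq_fun do rewrite damping_lineE//.
by apply: cintbleZ => //; apply: cintble_osc_inv_sqr; rewrite addr_gt0.
Qed.

Lemma damping_inversion (N x u : R) : 0 < N -> 0 < x ->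
  cint mu setT (fun y => cexp ((x +i* y) * u%:C) * (damp N (x +i* y) * damp N (x +i* y))) =
  (2 * pi * damping N u)%:C.
Proof.
move=> N0 x0; have xN : 0 < x + N by rewrite addr_gt0.
under eq_fun do rewrite damping_lineE//.
rewrite cintZ//; last exact: cintble_osc_inv_sqr.
rewrite ramp_inversion// -rmorphM/=; congr (_%:C).
rewrite /damping /ramp [(x + N) * u]mulrDl opprD expRD.
have -> : expR (x * u) = (expR (- (x * u)))^-1 by rewrite expRN invrK.
by field; rewrite gt_eqF// expR_gt0.
Qed.

(** Invert the Laplace transform of the damped sigma along Re z = x. The main
    term is the line kernel integrated against w, by Fubini's theorem, and is
    independent of x; the term with E is at most a constant times exp(-(tau -
    t)x), so it vanishes when x tends to infinity. This is causality: the
    values of sigma after tau do not matter before tau. *)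
Lemma representation (N t : R) : 0 < N -> t < tau ->
  cintble mu setT (fun s => line_kernel m N 2 t s * w s) /\
  (2 * pi)%:C * cint mu setT (fun r => (damping N (t - r))%:C * sigma r) =
  cint mu setT (fun s => line_kernel m N 2 t s * w s).
Proof.
move=> N0 ttau.
have [r0 r1] := andP (symbol_rho hm); have c1 : 1 < 2 - rho by lra.
have iamp x : 1 < x -> cintble (mu \x mu)%E setT (fun p : R * R =>
    (cexp ((x +i* p.1) * t%:C) * lsymbol m N p.2 (x +i* p.1)) * w p.2).
  move=> x1; apply: (cintble_plane_prod (f := fun y s => (cexp ((x +i* y) * t%:C) * lsymbol m N s (x +i* y)) * w s)
     (U := fun y => expR (x * t) * amplitude_bound B rho N y) (V := fun s => cmod (w s))) => //.
  - apply: cmeasM; last exact: (cmeas_on_snd (cintble_meas iw)).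
    apply: cmeasM; last exact: (cmeas_lsymbol_plane hm).
    apply: (cmeas_on_fst (f := fun y => cexp ((x +i* y) * t%:C))).
    apply: cmeas_cexp; apply: cmeasM; last exact: cmeas_cst.
    by split => /=; [exact: measurable_cst|exact: measurable_id].
  - move=> y s; rewrite cmodM ler_wpM2r ?cmod_ge0// cmodM cmod_cexp Re_mulC/=.
    by rewrite ler_wpM2l ?expR_ge0// (lsymbol_le hm).
  - by move=> y; rewrite mulr_ge0 ?expR_ge0// (amplitude_bound_ge0 hm).
  - by move=> s; exact: cmod_ge0.
  - by apply: integrable_realZ => //; exact: (integrable_amplitude_bound hm).
  - exact: cintble_cmod.
have iexpw (z : R[i]) : 1 < complex.Re z ->
    cintble mu setT (fun s => cexp (- (m z * s%:C)) * w s).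
  move=> z1; apply: (cintble_le _ _ (cintble_cmod measurableT iw)) => //.
    by apply: cmeasM (cintble_meas iw); exact: ccontinuous_cmeas (ccontinuous_expc _).
  move=> s _; have [s0|s0] := leP 0 s; last by rewrite w0// mulr0.
  rewrite cmodM cmod_expc ler_piMl ?cmod_ge0// -expR0 ler_expR oppr_le0 mulr_ge0//.
  by rewrite ltW// (symbol_re hm).
have H2 x y : 1 < x -> cint mu setT (fun s => cexp ((x +i* y) * t%:C) * lsymbol m N s (x +i* y) * w s) =
   cexp ((x +i* y) * t%:C) * (amplitude m N (x +i* y) * cint mu setT (fun s => cexp (- (m (x +i* y) * s%:C)) * w s)).
  move=> x1; rewrite -cintZ//; last exact: iexpw.
  rewrite -cintZ//; last by apply: cintbleZ => //; exact: iexpw.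
  apply: eq_cint => s _; rewrite /lsymbol; have [s0|s0] := leP 0 s; last by rewrite w0// !mulr0.
  by rewrite !mulrA.
have swap x : 1 < x ->
  cint mu setT (fun s => line_kernel m N x t s * w s) =
  cint mu setT (fun y => cexp ((x +i* y) * t%:C) *
    (amplitude m N (x +i* y) * cint mu setT (fun s => cexp (- (m (x +i* y) * s%:C)) * w s))).
  move=> x1; have := cint_plane (f := fun y s => (cexp ((x +i* y) * t%:C) * lsymbol m N s (x +i* y)) * w s) (iamp x x1).
  have H1 s : cint mu setT (fun y => cexp ((x +i* y) * t%:C) * lsymbol m N s (x +i* y) * w s) =
      line_kernel m N x t s * w s.
    by rewrite /line_kernel -cintZr//; exact: (cintble_line_kernel hm).
  move=> H; transitivity (cint mu setT (fun s => cint mu setT (fun y => cexp ((x +i* y) * t%:C) * lsymbol m N s (x +i* y) * w s))).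
    by apply: eq_cint => s _; rewrite H1.
  by rewrite -H; apply: eq_cint => y _; rewrite H2.
(* the error on the line Re z = x is at most exp(-(tau - t)x) cE, as one factor
   N/|z| of each damping makes m(z) (N/|z|)^2 integrable *)
pose cE := M * (N ^+ 2 * \int[mu]_y (B * 2 `^ (2 - rho) * pweight (2 - rho) y)).
pose lhs := (2 * pi)%:C * cint mu setT (fun r => (damping N (t - r))%:C * sigma r).
pose rhs := cint mu setT (fun s => line_kernel m N 2 t s * w s).
have key x : 2 <= x -> cmod (lhs - rhs) <= expR (- ((tau - t) * x)) * cE.
  move=> x2; have x1 : 1 < x by rewrite (lt_le_trans _ x2)// ltr1n.
  have x0 : 0 < x by exact: lt_trans x1.
  have xN : 0 < x + N by rewrite addr_gt0.
  pose h y r := cexp ((x +i* y) * (t - r)%:C) * (damp N (x +i* y) * damp N (x +i* y)) * sigma r.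
  have ih : cintble (mu \x mu)%E setT (fun p : R * R => h p.1 p.2).
    apply: (cintble_plane_prod (f := h) (U := fun y => N ^+ 2 * cmod (((x + N) +i* y) ^- 2))
       (V := fun r => expR (x * t) * cmod (sigma r))).
    - apply: cmeasM; last exact: (cmeas_on_snd (cintble_meas isigma)).
      apply: cmeasM.
        apply: cmeas_cexp; apply: cmeasM.
          by split => /=; [exact: measurable_cst|exact: measurable_fst].
        apply: (cmeas_on_snd (f := fun r => (t - r)%:C)); apply: cmeas_real.
        by apply: measurable_funB; [exact: measurable_cst|exact: measurable_id].
      have md : cmeas setT (fun y : R => damp N (x +i* y)).
        by apply: ccontinuous_cmeas => //; apply: lhol_continuous (lhol_damp N0) x1.
      by apply: (cmeas_on_fst (f := fun y => damp N (x +i* y) * damp N (x +i* y))); exact: cmeasM.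
    - move=> y r; rewrite /h cmodM [leRHS]mulrA; have [r00|r00] := leP 0 r; last by rewrite sigma0// cmod0 !mulr0.
      apply: ler_wpM2r (cmod_ge0 _) _ _ _; rewrite damping_lineE// cmodM.
      rewrite cmod_real; last by rewrite mulr_ge0 ?sqr_ge0// expR_ge0.
      rewrite cmodM cmod_osc mul1r mulrAC; apply: ler_wpM2l.
        by rewrite mulr_ge0 ?sqr_ge0// cmod_ge0.
      by rewrite ler_expR; apply: ler_wpM2l (ltW x0) _ _ _; rewrite lerBlDr lerDl.
    - by move=> y; rewrite mulr_ge0 ?sqr_ge0 ?cmod_ge0.
    - by move=> r; rewrite mulr_ge0 ?expR_ge0 ?cmod_ge0.
    - by apply: integrable_realZ => //; apply: cintble_cmod => //; exact: cintble_inv_sqr.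
    - by apply: integrable_realZ => //; exact: cintble_cmod.
  have Hr r : cint mu setT (h ^~ r) = (2 * pi)%:C * ((damping N (t - r))%:C * sigma r).
    rewrite /h cintZr//; last exact: cintble_damping_line.
    by rewrite damping_inversion// rmorphM mulrA.
  have Hy y : cint mu setT (h y) = cexp ((x +i* y) * t%:C) *
      (amplitude m N (x +i* y) * cint mu setT (fun s => cexp (- (m (x +i* y) * s%:C)) * w s)) +
      cexp ((x +i* y) * t%:C) * (damp N (x +i* y) * damp N (x +i* y) * m (x +i* y)) * E (x +i* y).
    have z1 : 1 < complex.Re (x +i* y) by [].
    have ie : cintble mu setT (fun r => cexp (- ((x +i* y) * r%:C)) * sigma r).
      apply: (cintble_le _ _ (cintble_cmod measurableT isigma)) => //.
        by apply: cmeasM (cintble_meas isigma); exact: ccontinuous_cmeas (ccontinuous_expc _).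
      move=> r _; have [r00|r00] := leP 0 r; last by rewrite sigma0// mulr0.
      rewrite cmodM cmod_expc ler_piMl ?cmod_ge0// -expR0 ler_expR oppr_le0 mulr_ge0//.
      exact: ltW.
    transitivity (cexp ((x +i* y) * t%:C) * (damp N (x +i* y) * damp N (x +i* y)) *
        cint mu setT (fun r => cexp (- ((x +i* y) * r%:C)) * sigma r)).
      rewrite -cintZ//; apply: eq_cint => r _; rewrite /h.
      have -> : cexp ((x +i* y) * (t - r)%:C) = cexp ((x +i* y) * t%:C) * cexp (- ((x +i* y) * r%:C)).
        by rewrite -cexpD rmorphB/= mulrBr.
      move: (cexp ((x +i* y) * t%:C)) (cexp _) (damp _ _) (sigma r) => a b c d.
      by ring.
    rewrite sigmaE// /amplitude.
    move: (cexp _) (damp _ _) (m _) (cint _ _ _) (E _) (x +i* y)^-1 => e d mz W Ez iz.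
    by ring.
  have iA : cintble mu setT (fun y => cexp ((x +i* y) * t%:C) *
      (amplitude m N (x +i* y) * cint mu setT (fun s => cexp (- (m (x +i* y) * s%:C)) * w s))).
    have := cintble_plane1 (f := fun y s => (cexp ((x +i* y) * t%:C) * lsymbol m N s (x +i* y)) * w s) (iamp x x1).
    by under [X in cintble _ _ X]eq_fun => y do rewrite H2//.
  have iT := cintble_plane1 ih.
  have iB : cintble mu setT (fun y => cexp ((x +i* y) * t%:C) *
      (damp N (x +i* y) * damp N (x +i* y) * m (x +i* y)) * E (x +i* y)).
    have := cintbleB measurableT iT iA.
    by under [X in cintble _ _ X]eq_fun => y do rewrite Hy addrC addKr.
  have E1 : lhs = rhs + cint mu setT (fun y => cexp ((x +i* y) * t%:C) *
      (damp N (x +i* y) * damp N (x +i* y) * m (x +i* y)) * E (x +i* y)).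
    rewrite /lhs /rhs -cintZ//; last first.
      apply: (cintbleM_bounded (M := N ^+ 2 * (2 / N))) => //.
        apply: cmeas_real; apply: measurable_funM; first exact: measurable_cst.
        apply: (measurableT_comp (continuous_measurable_fun (@continuous_ramp R N))).
        by apply: measurable_funB; [exact: measurable_cst|exact: measurable_id].
      by move=> r _; rewrite cmod_real ?damping_ge0// ler_wpM2l ?sqr_ge0// ramp_le.
    transitivity (cint mu setT (fun r => cint mu setT (h ^~ r))).
      by apply: eq_cint => r _; rewrite Hr.
    rewrite -(cint_plane ih).
    transitivity (cint mu setT (fun y => cexp ((x +i* y) * t%:C) *
      (amplitude m N (x +i* y) * cint mu setT (fun s => cexp (- (m (x +i* y) * s%:C)) * w s)) +
      cexp ((x +i* y) * t%:C) * (damp N (x +i* y) * damp N (x +i* y) * m (x +i* y)) * E (x +i* y))).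
      by apply: eq_cint => y _; rewrite Hy.
    rewrite cintD//; apply: (congr1 (+%R ^~ _)); apply: (etrans (esym (swap x x1))).
    apply: eq_cint => s _; congr (_ * _); symmetry.
    by apply: (line_kernel_shift hm) => //; rewrite ltr1n.
  rewrite E1 addrAC subrr add0r; apply: le_trans (cmod_cint_le measurableT iB) _.
  have iw' : mu.-integrable setT (fun y => (B * 2 `^ (2 - rho) * pweight (2 - rho) y)%:E).
    by apply: integrable_realZ => //; exact: integrable_pweight.
  have -> : expR (- ((tau - t) * x)) * cE = \int[mu]_y
     (expR (x * t) * (M * expR (- (tau * x))) * N ^+ 2 * (B * 2 `^ (2 - rho) * pweight (2 - rho) y)).
    rewrite RintegralZl// /cE; have -> : expR (- ((tau - t) * x)) = expR (x * t) * expR (- (tau * x)).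
      by rewrite -expRD; congr expR; ring.
    by ring.
  apply: le_Rintegral => //.
  - exact: cintble_cmod.
  - by apply: integrable_realZ.
  move=> y _; set z := x +i* y; have z1 : 1 < complex.Re z by [].
  have h1 := damp_le N0 (lt_trans ltr01 z1).
  have h2 := symbol_growth_le hm y x1.
  have h3 : cmod (damp N z * damp N z * m z) <= N ^+ 2 * (B * 2 `^ (2 - rho) * pweight (2 - rho) y).
    apply: le_trans (ler_wpM2l (sqr_ge0 N) h2); rewrite 2!cmodM.
    have -> : N ^+ 2 * (cmod (m (x +i* y)) / cmod (x +i* y) ^+ 2) = (N / cmod z) * (N / cmod z) * cmod (m z).
      have cz : cmod z != 0 by rewrite gt_eqF// lt_cmod.
      by rewrite -/z; field.
    by rewrite ler_wpM2r ?cmod_ge0// ler_pM ?cmod_ge0.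
  rewrite 2!cmodM cmod_cexp Re_mulC.
  have -> : forall a b c d : R, a * b * c * d = a * (c * d) * b by move=> *; ring.
  rewrite -[leLHS]mulrA -[leRHS]mulrA ler_wpM2l ?expR_ge0//.
  apply: ler_pM; rewrite ?cmod_ge0//; exact: E_le.
split.
  have := cintble_plane1 (f := fun s y => (cexp ((2 +i* y) * t%:C) * lsymbol m N s (2 +i* y)) * w s)
    (cintble_swap (iamp 2 _)).
  rewrite ltr1n => /(_ isT); apply: eq_cintble => // s _ /=.
  by rewrite cintZr//; apply: (cintble_line_kernel hm); rewrite ?ltr1n.
have : cmod (lhs - rhs) = 0.
  apply/eqP; rewrite eq_le cmod_ge0 andbT leNgt; apply/negP => pos.
  have d0 : 0 < tau - t by rewrite subr_gt0.
  have L : (expR (- ((tau - t) * n%:R)) * cE) @[n --> \oo] --> (0 : R).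
    rewrite -[X in _ --> X](mul0r cE); apply: cvgM; last exact: cvg_cst.
    exact: cvg_expRM.
  move/cvgr0Pnorm_lt : L => /(_ _ pos) L.
  have [n [/= Hn n2]] := @filter_ex _ _ _ _ (filterI L (nbhs_infty_ge 2)).
  have n2' : 2 <= n%:R :> R by rewrite ler_nat.
  have := le_lt_trans (le_trans (key _ n2') (ler_norm _)) Hn.
  by rewrite ltxx.
move=> /eqP; rewrite cmod_eq0 subr_eq0 => /eqP; exact.
Qed.
End Representation.

(** * Energy estimates *)

Section PointwiseEnergy.
Context {R : realType}.
Notation mu := (@lebesgue_measure R).

Lemma limn_einf_mono (u v : nat -> \bar R) : (forall n, (u n <= v n)%E) ->
  (limn_einf u <= limn_einf v)%E.
Proof.
move=> uv; rewrite !limn_einf_lim; apply: lee_lim; [exact: is_cvg_einfs|exact: is_cvg_einfs|].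
apply: nearW => n; apply: le_ereal_inf_tmp => _ [k nk <-].
by apply: le_trans (uv k); apply: ereal_inf_lbound; exists k.
Qed.

Lemma cmod_dist (z w : R[i]) : `|cmod z - cmod w| <= cmod (z - w).
Proof.
have h (a b : R[i]) : cmod a - cmod b <= cmod (a - b).
  by rewrite lerBlDr -{1}[a](subrK b) cmodD.
by rewrite ler_norml h andbT lerNl opprB cmodB h.
Qed.

(** The optimal weight in 2 a b <= c a^2 + b^2/c turns the integrated
    arithmetic-geometric inequality into the Cauchy-Schwarz inequality. *)
Lemma cauchy_schwarz_cint (V w : R -> R[i]) (q : R) : 0 < q ->
  cmeas setT V -> cintble mu setT (fun s => V s * w s) ->
  mu.-integrable setT (fun s => (cmod (w s) ^+ 2)%:E) ->
  \int[mu]_s cmod (w s) ^+ 2 <= q ->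
  ((cmod (cint mu setT (fun s => V s * w s)) ^+ 2)%:E <=
    q%:E * \int[mu]_s (cmod (V s) ^+ 2)%:E)%E.
Proof.
move=> q0 mV iVw iw wq.
have mV2 : measurable_fun setT (fun s => (cmod (V s) ^+ 2)%:E).
  by apply/measurable_EFinP; exact: cmeas_sqr_cmod.
have V0 : (0 <= \int[mu]_s (cmod (V s) ^+ 2)%:E)%E.
  by apply: integral_ge0 => s _; rewrite lee_fin sqr_ge0.
have [Voo|Vfin] := eqVneq (\int[mu]_s (cmod (V s) ^+ 2)%:E)%E +oo%E.
  by rewrite Voo gt0_muley ?leey// lte_fin.
have iV : mu.-integrable setT (fun s => (cmod (V s) ^+ 2)%:E).
  apply/integrableP; split => //; under eq_integral do rewrite /= ger0_norm ?sqr_ge0//.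
  by rewrite lt_neqAle Vfin leey.
rewrite -(EFin_Rintegral measurableT iV) -EFinM lee_fin.
set a := \int[mu]_s _; set J := cmod _.
have J0 : 0 <= J by exact: cmod_ge0.
have [->|Jn0] := eqVneq J 0.
  by rewrite expr0n mulr_ge0 ?(ltW q0)// Rintegral_ge0// => s _; rewrite sqr_ge0.
have Jp : 0 < J by rewrite lt_neqAle eq_sym Jn0.
have h1 : J <= \int[mu]_s (q / J / 2 * cmod (V s) ^+ 2 + J / q / 2 * cmod (w s) ^+ 2).
  apply: le_trans (cmod_cint_le measurableT iVw) _; apply: le_Rintegral => //.
  - exact: cintble_cmod.
  - by apply: integrable_realD => //; exact: integrable_realZ.
  move=> s _; rewrite cmodM.
  have -> : q / J / 2 * cmod (V s) ^+ 2 + J / q / 2 * cmod (w s) ^+ 2 =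
     cmod (V s) * cmod (w s) + (q / J * cmod (V s) - cmod (w s)) ^+ 2 * (J / q / 2).
    by field; rewrite Jn0 gt_eqF.
  by rewrite lerDl mulr_ge0 ?sqr_ge0// !divr_ge0// ltW.
rewrite RintegralD// in h1; try exact: integrable_realZ.
rewrite !RintegralZl// -/a in h1.
have h2 : J / q / 2 * (\int[mu]_s cmod (w s) ^+ 2) <= J / 2.
  have -> : J / 2 = J / q / 2 * q by field; rewrite gt_eqF.
  by rewrite ler_wpM2l// !divr_ge0// ltW.
have h3 : J / 2 <= q / J / 2 * a.
  by move: h1 h2; move: (q / J / 2 * a) (J / q / 2 * _) => X Y; lra.
have h4 : J * (J / 2) <= J * (q / J / 2 * a) by rewrite ler_wpM2l.
have E : J * (q / J / 2 * a) = q * a / 2 by field.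
rewrite E in h4; rewrite expr2; move: h4; move: (q * a) => X.
by rewrite mulrA ler_pdivrMr// divfK.
Qed.

Context (m m' : R[i] -> R[i]) (kappa K B rho : R).
Context (hm : sublinear_symbol m m' kappa K B rho).

(** A lower limit over n of these densities is what survives without
    convergence of the kernels themselves. *)
Definition kernel_density (n : nat) (t : R) : \bar R :=
  (\int[mu]_s (expR (- (4 * t)) * cmod (line_kernel m n.+1%:R 2 t s) ^+ 2)%:E)%E.

Lemma kernel_density_ge0 n t : (0 <= kernel_density n t)%E.
Proof. by apply: integral_ge0 => s _; rewrite lee_fin mulr_ge0 ?expR_ge0 ?sqr_ge0. Qed.

Lemma measurable_kernel_density n : measurable_fun setT (kernel_density n).
Proof.
apply: (measurable_integral_plane (f := fun t s => (expR (- (4 * t)) * cmod (line_kernel m n.+1%:R 2 t s) ^+ 2)%:E)).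
  have x1 : 1 < 2 :> R by rewrite ltr1n.
  have N0 : 0 < n.+1%:R :> R by [].
  apply/measurable_EFinP; apply: measurable_funM; last exact: cmeas_sqr_cmod (cmeas_line_kernel hm N0 x1).
  apply: (measurable_on_fst (f := fun t => expR (- (4 * t)))).
  by apply: continuous_measurable_fun; exact: continuous_expM.
by move=> t s; rewrite lee_fin mulr_ge0 ?expR_ge0 ?sqr_ge0.
Qed.

(** Cauchy-Schwarz in s bounds the damped sigma at t by the kernel energy
    density at t times the energy of w; the damping tends to the identity at
    points of continuity. *)
Lemma pointwise_energy (w sigma : R -> R[i]) (E : R[i] -> R[i]) (tau M Ms q t : R) :
  cintble mu setT w -> (forall s, s < 0 -> w s = 0) ->
  cintble mu setT sigma -> (forall r, r < 0 -> sigma r = 0) ->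
  (forall z, 1 < complex.Re z ->
    cint mu setT (fun r => cexp (- (z * r%:C)) * sigma r) =
    m z / z * cint mu setT (fun s => cexp (- (m z * s%:C)) * w s) + m z * E z) ->
  (forall z, 1 < complex.Re z -> cmod (E z) <= M * expR (- (tau * complex.Re z))) ->
  t < tau -> (forall r, cmod (sigma r) <= Ms) ->
  (forall e : R, 0 < e -> exists2 d : R, 0 < d & forall r : R, `|r - t| < d -> cmod (sigma r - sigma t) <= e) ->
  mu.-integrable setT (fun s => (cmod (w s) ^+ 2)%:E) ->
  0 < q -> \int[mu]_s cmod (w s) ^+ 2 <= q ->
  ((expR (- (4 * t)) * (2 * pi * cmod (sigma t)) ^+ 2 / q)%:E <= limn_einf (kernel_density ^~ t))%E.
Proof.
move=> iw w0 isig s0 sE E_le ttau sM sc iw2 q0 wq.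
pose D n := cint mu setT (fun r => (damping n.+1%:R (t - r))%:C * sigma r).
pose c n := expR (- (4 * t)) * (2 * pi * cmod (D n)) ^+ 2 / q.
have c_le n : ((c n)%:E <= kernel_density n t)%E.
  have N0 : 0 < n.+1%:R :> R by [].
  have [iV VE] := representation hm iw w0 isig s0 sE E_le N0 ttau.
  have mV : cmeas setT (fun s : R => line_kernel m n.+1%:R 2 t s).
    have x1 : 1 < 2 :> R by rewrite ltr1n.
    apply: (cmeas_comp (f := fun p : R * R => line_kernel m n.+1%:R 2 p.1 p.2) (g := fun s => (t, s))).
      exact: (cmeas_line_kernel hm).
    exact: measurable_fun_pair.
  have := cauchy_schwarz_cint q0 mV iV iw2 wq.
  rewrite -VE cmodM cmod_real ?mulr_ge0 ?pi_ge0// -/(D n) => h.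
  rewrite /kernel_density; under eq_integral do rewrite EFinM.
  rewrite ge0_integralZl//; last 2 first.
  - by apply/measurable_EFinP; exact: cmeas_sqr_cmod.
  - by move=> s _; rewrite lee_fin sqr_ge0.
  have -> : c n = expR (- (4 * t)) * (q^-1 * (2 * pi * cmod (D n)) ^+ 2) by rewrite /c mulrAC -mulrA.
  rewrite EFinM lee_wpmul2l ?lee_fin ?expR_ge0// EFinM.
  rewrite lee_pdivrMl//.
have cL : (c n) @[n --> \oo] --> expR (- (4 * t)) * (2 * pi * cmod (sigma t)) ^+ 2 / q.
  have DL : (cmod (D n)) @[n --> \oo] --> cmod (sigma t).
    have N0 n : 0 < n.+1%:R :> R by [].
    have := @approx_identity _ (fun n => damping n.+1%:R) sigma 1 Ms t
      (fun n y => damping_ge0 n.+1%:R y) (fun n => integrable_damping (N0 n))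
      (fun n => Rintegral_damping (N0 n)) (@damping_tail R) (cintble_meas isig) sM sc.
    rewrite mul1r => /ccvgP DL; apply/cvgrPdist_le => e e0.
    apply: filterS (DL e e0) => n; apply: le_trans.
    by rewrite distrC cmod_dist.
  apply: cvgM; last exact: cvg_cst.
  apply: cvgM; first exact: cvg_cst.
  by apply: cvgM; apply: cvgM => //; exact: cvg_cst.
have cL' : (c n)%:E @[n --> \oo] --> (expR (- (4 * t)) * (2 * pi * cmod (sigma t)) ^+ 2 / q)%:E.
  by apply: cvg_EFin => //; exact: nearW.
rewrite -(cvg_limn_einf_sup cL').1; exact: limn_einf_mono.
Qed.
(** Fatou's lemma moves the lower limit out of the t-integral, where the
    uniform bound on the kernel energy applies. *)
Lemma integral_le_kernel_energy (f : R -> R) (q T : R) : 0 < q ->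
  measurable_fun `[0, T] f -> (forall t, `[0, T]%classic t -> 0 <= f t) ->
  (forall t, 0 < t -> t <= T ->
    ((expR (- (4 * t)) * (2 * pi) ^+ 2 * f t / q)%:E <= limn_einf (kernel_density ^~ t))%E) ->
  (\int[mu]_(t in `[0%R, T]) (f t)%:E <=
    (q / (2 * pi) ^+ 2 * expR (4 * T) * kernel_energy kappa B rho)%:E)%E.
Proof.
move=> q0 mf f0 fL.
have sub : `]0, T]%classic `<=` (`[0, T]%classic : set R).
  by move=> t /=; rewrite !in_itv/= => /andP[/ltW-> ->].
have mf' : measurable_fun `]0, T] (EFin \o f).
  by apply/measurable_EFinP; apply: measurable_funS mf.
rewrite -(integral_itv_obnd_cbnd mf').
have p0 : 0 < (2 * pi) ^+ 2 :> R by rewrite exprn_gt0// mulr_gt0// pi_gt0.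
pose k := q / (2 * pi) ^+ 2 * expR (4 * T).
have k0 : 0 < k by rewrite mulr_gt0 ?expR_gt0// divr_gt0.
pose L t := limn_einf (kernel_density ^~ t).
have mL : measurable_fun setT L.
  have -> : L = (fun t => - limn_esup (fun n => - kernel_density n t))%E.
    apply/funext => t; rewrite -limn_einfN; congr limn_einf.
    by apply/funext => n /=; rewrite oppeK.
  apply: (measurableT_comp (@oppe_measurable R setT)); apply: measurable_fun_limn_esup => n.
  by apply: (measurableT_comp (@oppe_measurable R setT)); exact: measurable_kernel_density.
have L0 t : (0 <= L t)%E.
  have <- : limn_einf (fun _ : nat => 0%E : \bar R) = 0%E.
    exact: (cvg_limn_einf_sup (cvg_cst _)).1.
  by apply: limn_einf_mono => n; exact: kernel_density_ge0.
apply: (@le_trans _ _ (\int[mu]_(t in `]0%R, T]) (k%:E * L t))%E).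
  apply: ge0_le_integral => //.
  - by move=> t /sub /f0; rewrite lee_fin.
  - by apply: measurable_funeM; apply: measurable_funTS.
  move=> t; rewrite /= in_itv/= => /andP[t0 tT].
  have ft0 : 0 <= f t by apply: f0; rewrite /= in_itv/= (ltW t0).
  apply: le_trans (lee_wpmul2l _ (fL t t0 tT)); last by rewrite lee_fin ltW.
  rewrite -EFinM lee_fin.
  have -> : k * (expR (- (4 * t)) * (2 * pi) ^+ 2 * f t / q) = expR (4 * T) * expR (- (4 * t)) * f t.
    have qn : q != 0 by rewrite gt_eqF.
    have pn := lt0r_neq0 p0.
    by rewrite /k; move: ((2 * pi) ^+ 2) pn => P Pn; field; rewrite ?Pn ?qn.
  by rewrite ler_peMl// -expRD -expR0 ler_expR subr_ge0 ler_wpM2l.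
apply: (@le_trans _ _ (\int[mu]_t (k%:E * L t))%E).
  apply: ge0_subset_integral => //; first exact: measurable_funeM.
  by move=> t _; rewrite mule_ge0// lee_fin ltW.
rewrite ge0_integralZl//; last by rewrite lee_fin ltW.
rewrite [leRHS]EFinM -/k; apply: lee_wpmul2l; first by rewrite lee_fin ltW.
apply: le_trans (fatou _ _ _ _) _ => //.
- by move=> n; exact: measurable_kernel_density.
- by move=> n t _; exact: kernel_density_ge0.
by apply: limn_einf_le => n; apply: (line_kernel_energy hm).
Qed.

End PointwiseEnergy.

(** * The symbol of a sectorial regular kernel *)

Section KernelSymbol.
Context {R : realType}.
Notation mu := (@lebesgue_measure R).

Lemma L1loc_cmeas (a : R -> R[i]) : L1loc a -> cmeas (`[0, +oo[ : set R) a.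
Proof.
move=> ha; have E : (`[0, +oo[%classic : set R) = \bigcup_n `[0%R, n%:R]%classic.
  apply/seteqP; split => [x /=|x [n _] /=]; last by rewrite !in_itv/= => /andP[->].
  rewrite in_itv/= andbT => x0; exists (Num.truncn x).+1 => //=; rewrite in_itv/= x0/= ltW//.
  exact: truncnS_gt.
have m n : cmeas (`[0, n%:R] : set R) a by apply: (cintble_meas (mu := mu)); exact: ha.
by rewrite E; split; apply/measurable_fun_bigcup => // n; have [] := m n.
Qed.

Lemma subexp_kernel (a : R -> R[i]) : L1loc a -> subexponential_growth a -> subexp a.
Proof.
move=> /L1loc_cmeas ma ga; split => // eps eps0; apply/integrableP; split.
  apply/measurable_EFinP; apply: measurable_funM; last exact: cmeas_cmod.
  by apply: measurable_funTS; apply: continuous_measurable_fun; exact: continuous_expM.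
under eq_integral do rewrite /= ger0_norm ?mulr_ge0 ?expR_ge0 ?cmod_ge0//.
exact: ga.
Qed.

Lemma cdiffN (F : R[i] -> R[i]) z l : cdiff F z l -> cdiff (fun z => - F z) z (- l).
Proof.
move=> dF e /dF[d d0 H]; exists d => // w /H; apply: le_trans.
by rewrite (_ : - _ - _ - _ = - (F (z + w) - F z - l * w)) ?cmodN//; ring.
Qed.

(** Sectoriality below pi/2 puts 1/a^ in the sector of the same angle;
    regularity of a^ is regularity of 1/a^; and the growth of order rho < 1 is
    the sector growth estimate for F = a^. *)
Lemma kernel_symbol (a : R -> R[i]) (theta : R) :
  L1loc a -> subexponential_growth a -> regular_kernel 1 a ->
  sectorial_kernel a theta -> theta < pi / 2 ->
  exists m' kappa K B rho, sublinear_symbol (fun z => (laplace a z)^-1) m' kappa K B rho.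
Proof.
move=> ha ga [K [K0 hK]] [t0 tpi hs] t2.
have sa := subexp_kernel ha ga; have sta := subexpX sa; have stta := subexpX sta.
pose F := laplace a; pose F' (z : R[i]) := - laplace (fun t => t%:C * a t) z.
pose F'' (z : R[i]) := - - laplace (fun t => t%:C * (t%:C * a t)) z.
have dF z : 0 < complex.Re z -> cdiff F z (F' z) by exact: laplace_cdiff.
have dF' z : 0 < complex.Re z -> cdiff F' z (F'' z).
  by move=> z0; apply: cdiffN; exact: laplace_cdiff.
have hS z : 0 < complex.Re z ->
  [/\ 0 < complex.Re (F z), cos theta * cmod (F z) <= complex.Re (F z) & `|rarg (F z)| <= theta].
  by move=> z0; apply: sectorP t2 _; exact: hs.
have FK z : 0 < complex.Re z -> cmod (z * F' z) <= K * cmod (F z).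
  move=> z0; have := hK 1%N z (leqnn _) z0.
  by rewrite (cdiff_derive1n (dF z z0)) expr1.
have [rho [B [r0 r1 B0 HB]]] := sector_growth t0 t2 dF dF'
  (fun z z0 => let: And3 h _ _ := hS z z0 in h)
  (fun z z0 => let: And3 _ _ h := hS z z0 in h) FK.
have Fn0 z : 0 < complex.Re z -> F z != 0.
  by move=> /hS[h _ _]; apply: contraTneq h => ->; rewrite ltxx.
have ct : 0 < cos theta.
  by apply: cos_gt0_pihalf; rewrite t2 andbT (lt_trans _ t0)// oppr_lt0 divr_gt0// pi_gt0.
have lt0 (z : R[i]) : 1 < complex.Re z -> 0 < complex.Re z by exact: lt_trans.
exists (fun z => - F' z * (F z)^-1 * (F z)^-1), (cos theta), K, B, rho; split => //.
- apply: lholV; first by move=> z /lt0; exact: Fn0.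
  exact: lhol_cdiff dF dF'.
- by rewrite r0.
- move=> z /lt0 z0; have [h _ _] := hS z z0.
  by rewrite ReV divr_gt0// -sqr_cmod exprn_gt0// cmod_gt0 Fn0.
- move=> z /lt0 z0; have [_ h _] := hS z z0; have c0 : 0 < cmod (F z) by rewrite cmod_gt0 Fn0.
  rewrite ReV cmodV -sqr_cmod ler_pdivlMr ?exprn_gt0// expr2.
  by rewrite -mulrA mulKf// gt_eqF.
- move=> z /lt0 z0; have c0 : 0 < cmod (F z) by rewrite cmod_gt0 Fn0.
  rewrite !mulrA mulrN !mulNr cmodN cmodM cmodV ler_wpM2r ?invr_ge0 ?cmod_ge0//.
  by rewrite cmodM cmodV ler_pdivrMr// FK.
- move=> z z1; rewrite cmodV; apply: HB; first exact: lt0.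
  by rewrite ltW// lt_cmod.
Qed.

End KernelSymbol.

(** * Norms and the Hahn-Banach theorem *)

Section RealNorm.
Context {R : realType} {V : normedModType R[i]}.
Implicit Types (x y : V) (k : R[i]).

Lemma rnormC x : (rnorm x)%:C = `|x|.
Proof. by rewrite /rnorm; apply: complex_ext => //=; move: (normr_ge0 x); rewrite lecE/= => /andP[/eqP ->]. Qed.

Lemma rnorm_ge0 x : 0 <= rnorm x.
Proof. by rewrite -lecR rnormC normr_ge0. Qed.

Lemma rnormZ k x : rnorm (k *: x) = cmod k * rnorm x.
Proof. by apply: complexI; rewrite rmorphM/= !rnormC cmodC normrZ. Qed.

Lemma rnormD x y : rnorm (x + y) <= rnorm x + rnorm y.
Proof. by rewrite -lecR rmorphD/= !rnormC ler_normD. Qed.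

Lemma rnormN x : rnorm (- x) = rnorm x.
Proof. by rewrite /rnorm normrN. Qed.

Lemma rnorm0 : rnorm (0 : V) = 0.
Proof. by rewrite /rnorm normr0. Qed.

Lemma rnorm_eq0 x : (rnorm x == 0) = (x == 0).
Proof. by rewrite -(inj_eq (@complexI R)) rnormC normr_eq0. Qed.

Lemma rnorm_dist x y : `|rnorm x - rnorm y| <= rnorm (x - y).
Proof.
have h (a b : V) : rnorm a - rnorm b <= rnorm (a - b).
  by rewrite lerBlDr -{1}[a](subrK b) rnormD.
by rewrite ler_norml h andbT lerNl opprB -[leRHS]rnormN opprB h.
Qed.

End RealNorm.

Section HahnBanach.
Context {R : realType} {V : normedModType R[i]}.
Implicit Types (G : set (V * R)) (M : R).

(** Real-linear functionals on real subspaces, dominated by M times the norm,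
    are handled through their graphs, which Zorn's lemma orders by inclusion. *)
Definition dominated_graph M G : Prop :=
  [/\ G (0, 0),
      forall (r : R) p q, G p -> G q -> G (r%:C *: p.1 + q.1, r * p.2 + q.2)
    & forall p, G p -> p.2 <= M * rnorm p.1].

Lemma dominated_graph_fun M G v a b : dominated_graph M G ->
  G (v, a) -> G (v, b) -> a = b.
Proof.
move=> [_ lin dom]; have h c d : G (v, c) -> G (v, d) -> d <= c.
  move=> Gc Gd; have := dom _ (lin (-1) _ _ Gc Gd) => /=.
  by rewrite rmorphN1 scaleN1r addNr rnorm0 mulr0 mulN1r addrC subr_le0.
by move=> Ga Gb; apply/eqP; rewrite eq_le (h b a)// (h a b).
Qed.

(** The value at v may be any number between the two families of bounds that
    domination imposes; the supremum of the lower family is one. *)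
Lemma dominated_graph_extend M G (v : V) : 0 <= M -> dominated_graph M G ->
  exists G', [/\ dominated_graph M G', G `<=` G' & exists a, G' (v, a)].
Proof.
move=> M0 [G0 lin dom].
have homog (s : R) (x : V) : 0 <= s -> s * rnorm x = rnorm (s%:C *: x).
  by move=> s0; rewrite rnormZ cmod_real.
pose S := [set p.2 - M * rnorm (p.1 - v) | p in G].
have key p q : G p -> G q -> p.2 - M * rnorm (p.1 - v) <= M * rnorm (q.1 + v) - q.2.
  move=> Gp Gq; rewrite lerBlDr addrAC lerBrDr.
  have := dom _ (lin 1 _ _ Gp Gq) => /=; rewrite scale1r mul1r => /le_trans; apply.
  rewrite -mulrDr ler_wpM2l//.
  rewrite (_ : p.1 + q.1 = (q.1 + v) + (p.1 - v)) ?rnormD//.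
  by rewrite addrACA subrr addr0 addrC.
have S0 : S !=set0 by exists (0 - M * rnorm (0 - v)); exists (0, 0).
have Sub q : G q -> ubound S (M * rnorm (q.1 + v) - q.2).
  by move=> Gq _ [p Gp <-]; exact: key.
have SS : has_sup S by split => //; exists (M * rnorm ((0 : V) + v) - 0); exact: (Sub (0, 0)).
pose al := sup S.
have al_le q : G q -> al <= M * rnorm (q.1 + v) - q.2.
  by move=> Gq; apply: ge_sup => //; exact: Sub.
have al_ge p : G p -> p.2 - M * rnorm (p.1 - v) <= al.
  by move=> Gp; apply: ub_le_sup; [case: SS|exists p].
exists [set p | exists (r : R) q, G q /\ p = (r%:C *: v + q.1, r * al + q.2)]; split.
- split.
  + by exists 0, (0, 0); split => //=; rewrite scale0r mul0r !addr0.
  + move=> r _ _ [s [p [Gp ->]]] [t [q [Gq ->]]] /=.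
    exists (r * s + t), (r%:C *: p.1 + q.1, r * p.2 + q.2); split; first exact: lin.
    congr (_, _) => /=; last by ring.
    by rewrite rmorphD rmorphM/= scalerDl !scalerDr scalerA !addrA; congr (_ + _); rewrite -!addrA; congr (_ + _); rewrite addrC.
  + move=> _ [r [q [Gq ->]]] /=.
    have [r0|r0|->] := ltgtP r 0; last by rewrite mul0r scale0r !add0r; exact: dom.
    * have s0 : 0 < - r by rewrite oppr_gt0.
      have rn : r != 0 by rewrite lt_eqF.
      have := al_ge _ (lin (- r)^-1 _ _ Gq G0) => /=; rewrite !addr0.
      rewrite -(ler_pM2l s0) mulrBr mulrA mulfV ?gt_eqF// mul1r lerBlDr.
      rewrite mulNr addrC -lerBlDr opprK addrC mulrCA => /le_trans; apply.
      rewrite (homog (- r)) ?(ltW s0)//.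
      rewrite scalerBr scalerA -rmorphM/= mulfV ?gt_eqF// scale1r.
      by rewrite rmorphN scaleNr opprK addrC.
    * have rn : r != 0 by rewrite gt_eqF.
      have := al_le _ (lin r^-1 _ _ Gq G0) => /=; rewrite !addr0.
      rewrite -(ler_pM2l r0) mulrBr [r * (r^-1 * _)]mulrA mulfV// mul1r lerBrDr mulrCA => /le_trans; apply.
      rewrite (homog r) ?(ltW r0)//.
      by rewrite scalerDr scalerA -rmorphM/= mulfV// scale1r addrC.
- by move=> [w b] Gw; exists 0, (w, b); split => //=; rewrite scale0r mul0r !add0r.
- by exists al, 1, (0, 0); split => //=; rewrite scale1r mul1r !addr0.
Qed.

Lemma hahn_banach_real (M : R) G0 : 0 <= M -> dominated_graph M G0 ->
  exists f : V -> R,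
    [/\ forall (r : R) x y, f (r%:C *: x + y) = r * f x + f y,
        forall x, f x <= M * rnorm x & forall x a, G0 (x, a) -> f x = a].
Proof.
move=> M0 dG0.
(* the empty chain has the empty union, which is not a dominated graph; adding G0
   to every member repairs this *)
have [A [dA Amax]] : exists A, dominated_graph M (A `|` G0) /\
    forall B, A `<` B -> ~ dominated_graph M (B `|` G0).
  apply: (@Zorn_bigcup _ (fun A => dominated_graph M (A `|` G0))) => F FP Ftot.
  have [z0 lin0 dom0] := dG0; split.
  - by right.
  - move=> r p q Hp Hq.
    have {Hp} [X [FX Xp]] : exists X, (F X \/ X = G0) /\ (X `|` G0) p.
      by case: Hp => [[X FX Xp]|Gp]; [exists X; split; left|exists G0; split; right].
    have {Hq} [Y [FY Yq]] : exists X, (F X \/ X = G0) /\ (X `|` G0) q.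
      by case: Hq => [[X' FX' Xp']|Gp]; [exists X'; split; left|exists G0; split; right].
    have [Z [FZ Zp Zq]] : exists Z, [/\ F Z \/ Z = G0, (Z `|` G0) p & (Z `|` G0) q].
      case: FX => [FX|XE].
        case: FY => [FY|YE].
          have [XY|YX] := Ftot _ _ FX FY.
            by exists Y; split; [left| |]=> //; case: Xp; [left; exact: XY|right].
          by exists X; split; [left| |]=> //; case: Yq; [left; exact: YX|right].
        by exists X; split; [left| |]=> //; rewrite YE setUid in Yq; right.
      by exists Y; split => //; rewrite XE setUid in Xp; right.
    have [_ linZ _] : dominated_graph M (Z `|` G0).
      by case: FZ => [/FP//|->]; rewrite setUid.
    case: (linZ r p q Zp Zq) => [Zr|]; last by right.
    by case: FZ => [FZ|ZE]; [left; exists Z|right; rewrite -ZE].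
  - move=> p [[X /FP[_ _ domX] Xp]|]; last exact: dom0.
    by apply: domX; left.
have tot v : exists a, (A `|` G0) (v, a).
  have [B [dB sub [a Ba]]] := dominated_graph_extend v M0 dA.
  apply: contrapT => na; apply: (Amax B); last first.
    by rewrite (_ : B `|` G0 = B)//; apply/setUidPl => p Gp; apply: sub; right.
  split; first by move=> p Ap; apply: sub; left.
  by move=> BA; apply: na; exists a; left; exact: BA.
pose f v := sval (cid (tot v)); have fP v : (A `|` G0) (v, f v) := svalP (cid (tot v)).
have [_ lin dom] := dA; exists f; split.
- by move=> r x y; apply: (dominated_graph_fun dA (fP _)); exact: (lin r (x, f x) (y, f y)).
- by move=> x; exact: (dom _ (fP x)).
- by move=> x a Ga; apply: (dominated_graph_fun dA (fP x)); right.
Qed.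

Definition clinear (g : V -> R[i]) : Prop :=
  forall k x y, g (k *: x + y) = k * g x + g y.

(** The complex functional with real part f is x |-> f x - i f(ix). *)
Lemma hahn_banach (W : set V) (f0 : V -> R[i]) (M : R) : 0 <= M -> W 0 ->
  (forall k x y, W x -> W y -> W (k *: x + y)) ->
  (forall k x y, W x -> W y -> f0 (k *: x + y) = k * f0 x + f0 y) ->
  (forall x, W x -> cmod (f0 x) <= M * rnorm x) ->
  exists g : V -> R[i], [/\ clinear g, forall x, cmod (g x) <= M * rnorm x &
     forall x, W x -> g x = f0 x].
Proof.
move=> M0 W0 Wlin f0lin f0le.
have f00 : f0 0 = 0.
  by have := f0lin 1 0 0 W0 W0; rewrite scale1r addr0 mul1r => /eqP; rewrite -subr_eq subrr eq_sym => /eqP.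
have f0Z k x : W x -> f0 (k *: x) = k * f0 x.
  by move=> Wx; have := f0lin k x 0 Wx W0; rewrite !addr0 f00 addr0.
have WZ k x : W x -> W (k *: x) by move=> Wx; have := Wlin k x 0 Wx W0; rewrite addr0.
pose G0 : set (V * R) := [set p | W p.1 /\ p.2 = complex.Re (f0 p.1)].
have dG0 : dominated_graph M G0.
  split.
  - by split => //=; rewrite f00.
  - move=> r p q [Wp ->] [Wq ->]; split => /=; first exact: Wlin.
    by rewrite f0lin// ReD ReM/= mul0r subr0.
  - by move=> p [Wp ->]; exact: le_trans (Re_le_cmod _) (f0le _ Wp).
have [f [flin fM fG]] := hahn_banach_real M0 dG0.
have fZ (r : R) x : f (r%:C *: x) = r * f x.
  have f0' : f 0 = 0.
    by have := flin 1 0 0; rewrite scale1r addr0 mul1r => /eqP; rewrite -subr_eq subrr eq_sym => /eqP.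
  by have := flin r x 0; rewrite !addr0 f0' addr0.
have fD x y : f (x + y) = f x + f y by have := flin 1 x y; rewrite scale1r mul1r.
have fC k x : f (k *: x) = complex.Re k * f x + complex.Im k * f ('i%C *: x).
  by rewrite [in LHS](complexE k) scalerDl fD fZ ['i%C * _]mulrC -scalerA fZ.
pose g x := f x +i* (- f ('i%C *: x)).
have ii : ('i%C : R[i]) * 'i%C = -1.
  by apply: complex_ext; rewrite !ReImE/=; ring.
have glin : clinear g.
  move=> k x y; rewrite /g; apply: complex_ext; rewrite !ReImE/=.
    by rewrite fD fC; ring.
  rewrite scalerDr fD scalerA [_ * k]mulrC -scalerA fC scalerA ii scaleN1r.
  by have := fZ (-1) x; rewrite rmorphN1 scaleN1r mulN1r => ->; ring.
have gZ k x : g (k *: x) = k * g x.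
  have g0 : g 0 = 0.
    by have := glin 1 0 0; rewrite scale1r addr0 mul1r => /eqP; rewrite -subr_eq subrr eq_sym => /eqP.
  by have := glin k x 0; rewrite !addr0 g0 addr0.
exists g; split => //.
- move=> x; have [g0|g0] := eqVneq (g x) 0.
    by rewrite g0 cmod0 mulr_ge0 ?rnorm_ge0.
  have c0 : 0 < cmod (g x) by rewrite cmod_gt0.
  pose c := (cmod (g x))%:C / g x.
  have cc : cmod c = 1 by rewrite cmodM cmodV cmod_real ?cmod_ge0// divff// gt_eqF.
  have -> : cmod (g x) = f (c *: x).
    by rewrite -[RHS]/(complex.Re (g (c *: x))) gZ /c divfK.
  by apply: le_trans (fM _) _; rewrite rnormZ cc mul1r.
- move=> x Wx; apply: complex_ext => /=; first exact: fG.
  rewrite (fG _ (complex.Re (f0 ('i%C *: x)))); last by split => //=; exact: WZ.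
  by rewrite f0Z// ReM/= mul0r mul1r sub0r opprK.
Qed.

(** Extend k v |-> k |v| from the line spanned by v. *)
Lemma norming_functional (v : V) : exists g : V -> R[i],
  [/\ clinear g, forall x, cmod (g x) <= rnorm x & g v = (rnorm v)%:C].
Proof.
have [->|v0] := eqVneq v 0.
  exists (fun _ => 0); split; last by rewrite rnorm0.
    by move=> k x y; rewrite mulr0 addr0.
  by move=> x; rewrite cmod0 rnorm_ge0.
pose W : set V := [set x | exists k : R[i], x = k *: v].
have kE k k' : k *: v = k' *: v -> k = k'.
  move/eqP; rewrite -subr_eq0 -scalerBl scaler_eq0 (negbTE v0) orbF subr_eq0.
  by move/eqP.
pose f0 x := xget 0 [set k : R[i] | x = k *: v] * (rnorm v)%:C.
have f0E k : f0 (k *: v) = k * (rnorm v)%:C.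
  rewrite /f0; congr (_ * _); case: xgetP => [k' _ /= /kE //|/(_ k)/=].
  by move=> H; exfalso; exact: H.
have [|||||g [glin gM gE]] := @hahn_banach W f0 1 => //.
- by exists 0; rewrite scale0r.
- by move=> k x y [p ->] [q ->]; exists (k * p + q); rewrite scalerA scalerDl.
- move=> k x y [p ->] [q ->]; rewrite scalerA -scalerDl !f0E.
  by rewrite mulrDl mulrA.
- move=> x [p ->]; rewrite f0E cmodM cmod_real ?rnorm_ge0// rnormZ mul1r//.
exists g; split => //; first by move=> x; have := gM x; rewrite mul1r.
have := f0E 1; rewrite scale1r mul1r => <-; apply: gE; exists 1; by rewrite scale1r.
Qed.

End HahnBanach.

(** * Semigroups seen through bounded functionals *)

Section BoundedFunctional.
Context {R : realType}.
Notation mu := (@lebesgue_measure R).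

Lemma ccontinuous_epsdelta (f : R -> R[i]) :
  (forall t e : R, 0 < e -> exists2 d : R, 0 < d & forall s : R, `|s - t| < d -> cmod (f s - f t) <= e) ->
  ccontinuous f.
Proof.
move=> H; split => t; apply/cvgrPdist_le => e e0; have [d d0 Hd] := H t e e0;
  apply/nbhs_ballP; exists d => // s; rewrite /ball/= distrC => /Hd; apply: le_trans;
  rewrite distrC; [apply: le_trans (absRe_le _)|apply: le_trans (absIm_le _)];
  by rewrite !ReImE.
Qed.

Context {X : normedModType R[i]}.

Lemma within_epsdelta (v : R -> X) : {within `[0, +oo[, continuous v} ->
  forall t e : R, 0 <= t -> 0 < e -> exists2 d : R, 0 < d &
    forall s : R, 0 <= s -> `|s - t| < d -> rnorm (v s - v t) <= e.
Proof.
move=> /subspace_continuousP cv t e t0 e0.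
have tI : `[0, +oo[%classic t by rewrite /= in_itv/= t0.
have /cvgrPdist_le /(_ e%:C) := cv t tI; rewrite ltcR => /(_ e0).
rewrite near_withinE => /nbhs_ballP[d /= d0 Hd]; exists d => // s s0 sd.
have := Hd s; rewrite /ball/= distrC => /(_ sd); rewrite in_itv/= s0 => /(_ isT).
by rewrite -rnormC lecR -rnormN opprB.
Qed.

Lemma max0_dist (s t : R) : `|Num.max s 0 - Num.max t 0| <= `|s - t|.
Proof.
have [s0|/ltW s0] := leP 0 s; have [t0|/ltW t0] := leP 0 t.
- by [].
- by rewrite subr0 !ger0_norm ?subr_ge0 ?(le_trans t0)// lerDl oppr_ge0.
- by rewrite sub0r normrN ger0_norm// distrC ger0_norm ?subr_ge0 ?(le_trans s0)// lerDl oppr_ge0.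
- by rewrite subrr normr0.
Qed.

Definition bounded_functional (psi : X -> R[i]) (M : R) : Prop :=
  [/\ clinear psi, 0 <= M & forall x, cmod (psi x) <= M * rnorm x].

Section Functional.
Context (psi : X -> R[i]) (M : R) (hpsi : bounded_functional psi M).

Lemma functional_lin k x y : psi (k *: x + y) = k * psi x + psi y.
Proof. by have [h _ _] := hpsi. Qed.

Lemma functional_le x : cmod (psi x) <= M * rnorm x.
Proof. by have [_ _ h] := hpsi. Qed.

Lemma functional_ge0 : 0 <= M. Proof. by have [] := hpsi. Qed.

Lemma functional0 : psi 0 = 0.
Proof.
by have := functional_lin 1 0 0; rewrite scale1r addr0 mul1r => /eqP; rewrite -subr_eq subrr eq_sym => /eqP.
Qed.

Lemma functionalZ k x : psi (k *: x) = k * psi x.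
Proof. by have := functional_lin k x 0; rewrite !addr0 functional0 addr0. Qed.

Lemma functionalD x y : psi (x + y) = psi x + psi y.
Proof. by have := functional_lin 1 x y; rewrite scale1r mul1r. Qed.

Lemma functionalB x y : psi (x - y) = psi x - psi y.
Proof. by rewrite functionalD -scaleN1r functionalZ mulN1r. Qed.

Lemma functional_orbit (v : R -> X) : {within `[0, +oo[, continuous v} ->
  ccontinuous (fun s => psi (v (Num.max s 0))).
Proof.
move=> cv; apply: ccontinuous_epsdelta => t e e0.
have M1 : 0 < M + 1 by rewrite ltr_wpDl// functional_ge0.
have max0 (s : R) : 0 <= Num.max s 0 by rewrite le_max lexx orbT.
have [d d0 Hd] := within_epsdelta cv (max0 t) (divr_gt0 e0 M1).
exists d => // s sd; rewrite -functionalB (le_trans (functional_le _))//.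
apply: (@le_trans _ _ ((M + 1) * (e / (M + 1)))); last by rewrite mulrC divfK// gt_eqF.
apply: ler_pM; rewrite ?functional_ge0 ?rnorm_ge0// ?lerDl//.
by apply: Hd => //; exact: le_lt_trans (max0_dist _ _) sd.
Qed.

End Functional.
End BoundedFunctional.

Section Semigroup.
Context {R : realType} {X : normedModType R[i]}.
Notation mu := (@lebesgue_measure R).
Context (DA : set X) (A : X -> X) (T : R -> {linear X -> X}).
Context (hT : generates DA A T).

Lemma semigroupT0 x : T 0 x = x.
Proof. by have [[]] := hT. Qed.

Lemma semigroupD s t x : 0 <= s -> 0 <= t -> T (s + t) x = T s (T t x).
Proof. by have [[_ _ h _] _ _] := hT => s0 t0; exact: h. Qed.

Lemma semigroup_orbit x : {within `[0, +oo[, continuous (fun t => T t x)}.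
Proof. by have [[]] := hT. Qed.

Lemma generator_lin k x y : DA x -> DA y ->
  DA (k *: x + y) /\ A (k *: x + y) = k *: A x + A y.
Proof.
have [_ hD hA] := hT => Dx Dy.
have L : (h^-1)%:C *: (T h (k *: x + y) - (k *: x + y)) @[h --> (0 : R)^'+] --> k *: A x + A y.
  have L : (k *: ((h^-1)%:C *: (T h x - x)) + (h^-1)%:C *: (T h y - y)) @[h --> (0 : R)^'+] --> k *: A x + A y.
    by apply: cvgD; [apply: cvgZl_tmp; exact: hA|exact: hA].
  apply: cvg_trans L; apply: near_eq_cvg; apply: nearW => h.
  by rewrite scalerA [k * _]mulrC -scalerA -scalerDr scalerBr linearP/= opprD addrACA.
have D : DA (k *: x + y) by apply/hD/cvg_ex; exists (k *: A x + A y).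
by split => //; apply: (cvg_unique _ (hA _ D) L).
Qed.

(** T(s) is continuous and commutes with the difference quotients at 0. *)
Lemma generator_orbit s x : 0 <= s -> DA x -> DA (T s x) /\ A (T s x) = T s (A x).
Proof.
have [[cT _ _ _] hD hA] := hT => s0 Dx.
have L : (h^-1)%:C *: (T h (T s x) - T s x) @[h --> (0 : R)^'+] --> T s (A x).
  have : T s ((h^-1)%:C *: (T h x - x)) @[h --> (0 : R)^'+] --> T s (A x).
    by apply: (cvg_comp _ _ (hA _ Dx)); exact: cT.
  move=> H; apply: cvg_trans H; apply: near_eq_cvg; near=> h.
  have h0 : 0 <= h by [].
  by rewrite linearZ/= linearB/= -(semigroupD _ s0 h0) -(semigroupD _ h0 s0) [s + h]addrC.
have D : DA (T s x) by apply/hD/cvg_ex; exists (T s (A x)).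
by split => //; apply: (cvg_unique _ (hA _ D) L).
Unshelve. all: end_near. Qed.

Lemma generator_epsdelta x : DA x -> forall e : R, 0 < e -> exists2 d : R, 0 < d &
  forall h, 0 < h -> h < d -> rnorm (T h x - x - h%:C *: A x) <= e * h.
Proof.
have [_ _ hA] := hT => Dx e e0.
have /cvgrPdist_le /(_ e%:C) := hA _ Dx; rewrite ltcR => /(_ e0).
rewrite near_withinE => /nbhs_ballP[d /= d0 Hd]; exists d => // h h0 hd.
have := Hd h; rewrite /ball/= sub0r normrN ger0_norm ?(ltW h0)// => /(_ hd h0).
rewrite -rnormC lecR => H.
have -> : T h x - x - h%:C *: A x = - (h%:C *: (A x - (h^-1)%:C *: (T h x - x))).
  rewrite scalerBr scalerA -rmorphM/= divff ?gt_eqF// scale1r.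
  by rewrite opprB.
by rewrite rnormN rnormZ cmod_real ?(ltW h0)// mulrC ler_wpM2r// ltW.
Qed.

End Semigroup.

Section StableSemigroup.
Context {R : realType} {X : normedModType R[i]}.
Notation lmu := (@lebesgue_measure R).
Context (DA : set X) (A : X -> X) (T : R -> {linear X -> X}).
Context (hT : generates DA A T).
Context (M0 omega : R) (M0ge : 0 <= M0) (omega0 : 0 < omega).
Context (T_le : forall t x, 0 <= t -> rnorm (T t x) <= M0 * expR (- (omega * t)) * rnorm x).
Context (psi : X -> R[i]) (P : R) (hpsi : bounded_functional psi P).

Lemma semigroup_le t x : 0 <= t -> rnorm (T t x) <= M0 * rnorm x.
Proof.
move=> t0; apply: le_trans (T_le x t0) _; rewrite ler_wpM2r ?rnorm_ge0// ler_piMr//.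
by rewrite -expR0 ler_expR oppr_le0 mulr_ge0// ltW.
Qed.

(** The generator is a right derivative at 0; for the left derivative at t,
    write the increment as T(t - h) applied to an increment at 0 and use strong
    continuity. *)
Lemma cderiv_orbit x (t : R) : 0 < t -> DA x ->
  cderiv (fun s => psi (T (Num.max s 0) x)) t (psi (T t (A x))).
Proof.
move=> t0 Dx; apply/cderivP => e e0.
have P0 := functional_ge0 hpsi.
have P1 : 0 < P + 1 by rewrite ltr_wpDl.
have M1 : 0 < M0 + 1 by rewrite ltr_wpDl.
pose e1 := e / 2 / (P + 1); have e10 : 0 < e1 by rewrite !divr_gt0.
pose e2 := e1 / (M0 + 1); have e20 : 0 < e2 by rewrite divr_gt0.
have [d1 d10 H1] := generator_epsdelta hT Dx e20.
have [d2 d20 H2] := within_epsdelta (semigroup_orbit hT (x := A x)) (ltW t0) e10.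
exists (Num.min (d1 / 2) (Num.min (d2 / 2) t)); first by rewrite !lt_min !divr_gt0.
move=> h; rewrite !le_min => /and3P[hd1 hd2 ht].
have th0 : 0 <= t + h.
  by move: ht; rewrite ler_norml => /andP[+ _]; rewrite -subr_ge0 opprK addrC.
have [hd1' hd2'] : `|h| < d1 /\ `|h| < d2.
  by split; [apply: le_lt_trans hd1 _|apply: le_lt_trans hd2 _];
    rewrite ltr_pdivrMr// ltr_pMr// ltr1n.
rewrite !max_l ?(ltW t0)//.
have step r k : 0 <= r -> 0 < k -> k < d1 ->
   cmod (psi (T r (T k x - x - k%:C *: A x))) <= e / 2 * k.
  move=> r0 k0 kd; apply: le_trans (functional_le hpsi _) _.
  have H : rnorm (T r (T k x - x - k%:C *: A x)) <= (M0 + 1) * (e2 * k).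
    apply: le_trans (semigroup_le _ r0) _.
    by apply: ler_pM; rewrite ?rnorm_ge0// ?lerDl// H1.
  apply: (@le_trans _ _ ((P + 1) * ((M0 + 1) * (e2 * k)))).
    by apply: ler_pM; rewrite ?rnorm_ge0// lerDl.
  rewrite le_eqVlt; apply/orP; left; apply/eqP; rewrite /e2 /e1; field.
  by rewrite !gt_eqF.
have E r k : psi (T r (T k x - x - k%:C *: A x)) =
    psi (T r (T k x)) - psi (T r x) - k%:C * psi (T r (A x)).
  rewrite (linearB (T r)) (linearB (T r)) (linearZ_LR (T r)).
  by rewrite !(functionalB hpsi) (functionalZ hpsi).
have [h0|h0|->] := ltgtP h 0.
- have k0 : 0 < - h by rewrite oppr_gt0.
  have -> : psi (T (t + h) x) - psi (T t x) - h%:C * psi (T t (A x)) =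
    - psi (T (t + h) (T (- h) x - x - (- h)%:C *: A x)) +
     (- h)%:C * (psi (T t (A x)) - psi (T (t + h) (A x))).
    rewrite E -(semigroupD hT _ th0 (ltW k0)) addrK rmorphN/=.
    move: (psi (T t x)) (psi (T (t + h) x)) (psi (T t (A x))) (psi (T (t + h) (A x))) => p1 p2 p3 p4.
    by ring.
  rewrite (le_trans (cmodD _ _))// cmodN cmodM cmodR normrN.
  have -> : e * `|h| = e / 2 * `|h| + e / 2 * `|h| by field.
  have nh : `|h| = - h by rewrite ltr0_norm.
  have kd1 : - h < d1 by rewrite -nh.
  apply: lerD; first by rewrite nh; exact: step.
  rewrite mulrC ler_wpM2r// -(functionalB hpsi) (le_trans (functional_le hpsi _))//.
  apply: (@le_trans _ _ ((P + 1) * e1)); last by rewrite /e1 mulrC divfK// gt_eqF.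
  apply: ler_pM; rewrite ?rnorm_ge0// ?lerDl// -rnormN opprB.
  by apply: H2 => //; rewrite addrC addKr.
- have -> : psi (T (t + h) x) - psi (T t x) - h%:C * psi (T t (A x)) =
    psi (T t (T h x - x - h%:C *: A x)).
    by rewrite E -(semigroupD hT _ (ltW t0) (ltW h0)).
  rewrite gtr0_norm// in hd1' *; apply: le_trans (step _ _ (ltW t0) h0 hd1') _.
  by rewrite ler_wpM2r ?(ltW h0)// ler_pdivrMr// ler_pMr// ler1n.
- by rewrite addr0 subrr mul0r subr0 cmod0 normr0 mulr0.
Qed.

Lemma orbit_le z s : 0 <= s -> cmod (psi (T s z)) <= P * M0 * rnorm z * expR (- (omega * s)).
Proof.
move=> s0; apply: le_trans (functional_le hpsi _) _.
rewrite -mulrA -mulrA ler_wpM2l ?(functional_ge0 hpsi)//.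
by apply: le_trans (T_le z s0) _; rewrite -mulrA [_ * rnorm z]mulrC.
Qed.

Lemma ccontinuous_orbit z : ccontinuous (fun s => psi (T (Num.max s 0) z)).
Proof. exact: (functional_orbit hpsi (v := fun t => T t z) (semigroup_orbit hT (x := z))). Qed.

(** The functional psi o (mu - A)^-1, written as the Laplace transform of the
    scalar orbit: no vector-valued integral is needed. *)
Definition resolvent_functional (mu : R[i]) z : R[i] :=
  cint lmu `[0, +oo[ (fun s => cexp (- (mu * s%:C)) * psi (T (Num.max s 0) z)).

Lemma resolvent_integrand_le (mu : R[i]) z s : 0 <= complex.Re mu -> 0 <= s ->
  cmod (cexp (- (mu * s%:C)) * psi (T (Num.max s 0) z)) <=
  P * M0 * rnorm z * (expR (- (complex.Re mu * s)) * expR (- (omega * s))).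
Proof.
move=> m0 s0; rewrite cmodM cmod_expc max_l//.
rewrite mulrCA ler_wpM2l ?expR_ge0//; exact: orbit_le.
Qed.

Lemma cintble_resolvent (mu : R[i]) z : 0 <= complex.Re mu ->
  cintble lmu `[0, +oo[ (fun s => cexp (- (mu * s%:C)) * psi (T (Num.max s 0) z)).
Proof.
move=> m0; apply: (cintble_le _ _ (integrable_realZ _ (P * M0 * rnorm z) (integrable_expM omega0))) => //.
  apply: cmeasM; first exact: ccontinuous_cmeas (ccontinuous_expc mu).
  exact: ccontinuous_cmeas (ccontinuous_orbit z).
move=> s /=; rewrite in_itv/= andbT => s0; apply: le_trans (resolvent_integrand_le z m0 s0) _.
rewrite ler_wpM2l ?mulr_ge0 ?(functional_ge0 hpsi) ?rnorm_ge0//.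
by rewrite ler_piMl ?expR_ge0// -expR0 ler_expR oppr_le0 mulr_ge0.
Qed.

(** The scalar form of A (mu - A)^-1 = mu (mu - A)^-1 - 1: integrate the
    derivative of exp(-mu s) psi(T(s)z) over the half-line. *)
Lemma resolvent_identity (mu : R[i]) z : 0 <= complex.Re mu -> DA z ->
  resolvent_functional mu (A z) = mu * resolvent_functional mu z - psi z.
Proof.
move=> m0 Dz.
pose F (s : R) := cexp (- (mu * s%:C)) * psi (T (Num.max s 0) z).
pose f (s : R) := cexp (- (mu * s%:C)) * psi (T (Num.max s 0) (A z)) - mu * F s.
have cF : ccontinuous F by apply: ccontinuousM; [exact: ccontinuous_expc|exact: ccontinuous_orbit].
have cf : ccontinuous f.
  apply: ccontinuousD.
    by apply: ccontinuousM; [exact: ccontinuous_expc|exact: ccontinuous_orbit].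
  rewrite (_ : (fun s => - (mu * F s)) = (fun s => (- mu) * F s)); last by apply/funext => s; rewrite mulNr.
  by apply: ccontinuousM => //; exact: ccontinuous_cst.
have i1 := cintble_resolvent (A z) m0; have i2 := cintble_resolvent z m0.
have [cf1 cf2] := cf; have [cF1 cF2] := cF.
have H : cint lmu `[0, +oo[ f = - F 0.
  apply: cint_FTC_halfline.
  - exact: continuous_subspaceT.
  - exact: continuous_subspaceT.
  - move=> x x0; apply: cderiv_eq (cderivM (cderiv_expc mu x) (cderiv_orbit x0 Dz)).
    by rewrite /f /F !max_l ?(ltW x0)//; ring.
  - by apply: cvg_at_right_filter; exact: cF1.
  - by apply: cvg_at_right_filter; exact: cF2.
  - by apply: cintbleB => //; exact: cintbleZ.
  - have L : (P * M0 * rnorm z * expR (- (omega * n%:R))) @[n --> \oo] --> (0 : R).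
      rewrite -[X in _ --> X](mulr0 (P * M0 * rnorm z)).
      by apply: cvgM; [exact: cvg_cst|exact: cvg_expRM].
    apply: (@squeeze_cvgr _ _ _ _ (fun _ => 0)); [|exact: cvg_cst|exact: L].
    apply: nearW => n; rewrite cmod_ge0/=; apply: le_trans (resolvent_integrand_le z m0 _) _ => //.
    rewrite ler_wpM2l ?mulr_ge0 ?(functional_ge0 hpsi) ?rnorm_ge0//.
    by rewrite ler_piMl ?expR_ge0// -expR0 ler_expR oppr_le0 mulr_ge0.
rewrite /f cintB// in H; last exact: cintbleZ.
rewrite cintZ// in H; move: H.
rewrite -/(resolvent_functional mu (A z)) -/(resolvent_functional mu z).
rewrite /F mulr0 oppr0 cexp0 mul1r max_l// (semigroupT0 hT) => /eqP.
by rewrite subr_eq addrC => /eqP ->.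
Qed.

Lemma resolvent_functional_le (mu : R[i]) z : 0 < complex.Re mu ->
  cmod (resolvent_functional mu z) <= P * M0 * rnorm z / complex.Re mu.
Proof.
move=> m0; apply: le_trans (cmod_cint_le _ (cintble_resolvent z (ltW m0))) _ => //.
rewrite -(Rintegral_expM m0) -RintegralZl//; last exact: integrable_expM.
apply: le_Rintegral => //.
- by apply: cintble_cmod => //; exact: cintble_resolvent (ltW m0).
- by apply: integrable_realZ => //; exact: integrable_expM.
move=> s /=; rewrite in_itv/= andbT => s0; apply: le_trans (resolvent_integrand_le z (ltW m0) s0) _.
rewrite ler_wpM2l ?mulr_ge0 ?(functional_ge0 hpsi) ?rnorm_ge0//.
by rewrite ler_piMr ?expR_ge0// -expR0 ler_expR oppr_le0 mulr_ge0// ltW.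
Qed.

Lemma resolvent_functional_lin (mu : R[i]) : 0 <= complex.Re mu -> clinear (resolvent_functional mu).
Proof.
move=> m0 k x y; rewrite /resolvent_functional -cintZ//; last exact: cintble_resolvent.
rewrite -cintD//; last 2 first.
- by apply: cintbleZ => //; exact: cintble_resolvent.
- exact: cintble_resolvent.
by apply: eq_cint => s _; rewrite linearP/= (functional_lin hpsi); ring.
Qed.

End StableSemigroup.

Section DualObservation.
Context {R : realType} {X Y : normedModType R[i]}.
Notation lmu := (@lebesgue_measure R).
Context (DA : set X) (A : X -> X) (T : R -> {linear X -> X}).
Context (hT : generates DA A T).
Context (M0 omega : R) (M0ge : 0 <= M0) (omega0 : 0 < omega).
Context (T_le : forall t x, 0 <= t -> rnorm (T t x) <= M0 * expR (- (omega * t)) * rnorm x).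

(** Exponential stability makes 0 a point of the resolvent set: at mu = 0 the
    resolvent identity bounds x by its image under the generator. *)
Lemma generator_bounded_below x : DA x -> rnorm x <= M0 / omega * rnorm (A x).
Proof.
move=> Dx; have [phi [philin phile phix]] := norming_functional x.
have hphi : bounded_functional phi 1.
  by split => // y; rewrite mul1r.
have mu0 : 0 <= complex.Re (0 : R[i]) by [].
have := resolvent_identity hT M0ge omega0 T_le hphi mu0 Dx.
rewrite mul0r sub0r phix => E.
have -> : rnorm x = cmod (resolvent_functional T phi 0 (A x)).
  by rewrite E cmodN cmod_real// rnorm_ge0.
have i0 := cintble_resolvent hT M0ge omega0 T_le hphi (A x) mu0.
apply: le_trans (cmod_cint_le _ i0) _ => //.
have -> : M0 / omega * rnorm (A x) = 1 * M0 * rnorm (A x) * omega^-1 by ring.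
rewrite -(Rintegral_expM omega0) -RintegralZl//; last exact: integrable_expM.
apply: le_Rintegral => //.
- exact: cintble_cmod.
- by apply: integrable_realZ => //; exact: integrable_expM.
move=> s /=; rewrite in_itv/= andbT => s0.
apply: le_trans (resolvent_integrand_le T_le hphi (A x) mu0 s0) _.
by rewrite (_ : complex.Re (0 : R[i]) = 0)// mul0r oppr0 expR0 [1 * expR _]mul1r.
Qed.

(** The operator C is continuous for the graph norm only, but phi o C is phi o
    C o A^-1 o A, and the generator is bounded below, so phi o C o A^-1 is
    bounded on the range of A for the norm of X; it extends to X by the
    Hahn-Banach theorem. Scalar observations thus become bounded functionals of
    A x. *)
Lemma dual_observation (C : X -> Y) (phi : Y -> R[i]) (Q : R) :
  bounded_linear_on_X1 DA A C -> bounded_functional phi Q ->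
  exists psi P, bounded_functional psi P /\ forall x, DA x -> psi (A x) = phi (C x).
Proof.
move=> [Clin [M CM]] hphi.
have [D0 A0] : DA 0 /\ A 0 = 0.
  have [_ hD hA] := hT.
  have L : (h^-1)%:C *: (T h 0 - 0) @[h --> (0 : R)^'+] --> (0 : X).
    apply: cvg_near_cst; apply: nearW => h; by rewrite linear0 subrr scaler0.
  have D : DA 0 by apply/hD/cvg_ex; exists 0.
  by split => //; apply: (cvg_unique _ (hA _ D) L).
have inj x y : DA x -> DA y -> A x = A y -> x = y.
  move=> Dx Dy Exy; have [D E] := generator_lin hT (-1) Dx Dy.
  have := generator_bounded_below D; rewrite E Exy !scaleN1r addNr rnorm0 mulr0.
  move=> h; have /eqP : rnorm (- x + y) = 0 by apply/eqP; rewrite eq_le h rnorm_ge0.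
  by rewrite rnorm_eq0 addrC subr_eq0 => /eqP.
(* phi o C o A^-1 on the range of A, where the generator is injective *)
pose f0 v := phi (C (xget 0 [set x | DA x /\ A x = v])).
have f0E x : DA x -> f0 (A x) = phi (C x).
  move=> Dx; rewrite /f0; case: xgetP => [y _ /= [Dy Exy]|/(_ x)/=].
    by rewrite (inj _ _ Dy Dx Exy).
  by move=> H; exfalso; exact: H.
pose Mb := Q * (`|M| * (M0 / omega + 1)).
have Mo : 0 <= M0 / omega by rewrite divr_ge0// ltW.
have Mb0 : 0 <= Mb by rewrite !mulr_ge0 ?(functional_ge0 hphi)// addr_ge0.
have [||||psi [plin ple pE]] := @hahn_banach _ _ [set v | exists2 x, DA x & v = A x] f0 Mb Mb0.
- by exists 0.
- move=> k _ _ [x Dx ->] [y Dy ->]; have [D E] := generator_lin hT k Dx Dy.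
  by exists (k *: x + y).
- move=> k _ _ [x Dx ->] [y Dy ->]; have [D E] := generator_lin hT k Dx Dy.
  by rewrite -E !f0E// Clin// (functional_lin hphi).
- move=> _ [x Dx ->]; rewrite f0E//; apply: le_trans (functional_le hphi _) _.
  rewrite /Mb -mulrA ler_wpM2l ?(functional_ge0 hphi)//.
  apply: le_trans (CM x Dx) _; rewrite -mulrA.
  apply: (@le_trans _ _ (`|M| * (rnorm x + rnorm (A x)))).
    by rewrite ler_wpM2r ?addr_ge0 ?rnorm_ge0// ler_norm.
  rewrite ler_wpM2l// mulrDl mul1r lerD2r; exact: generator_bounded_below.
exists psi, Mb; split; first by split.
by move=> x Dx; rewrite pE ?f0E//; exists x.
Qed.

End DualObservation.

(** * Scalar Volterra equations on a bounded interval *)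

Section TruncatedVolterra.
Context {R : realType}.
Notation lmu := (@lebesgue_measure R).
Context (a : R -> R[i]) (sa : subexp a) (tau : R) (tau0 : 0 < tau).

Definition causal (b : R -> R[i]) (t : R) : R[i] :=
  if t \in (`[0, +oo[%classic : set R) then b t else 0.
Definition truncate (b : R -> R[i]) (t : R) : R[i] :=
  if t \in (`[0, tau]%classic : set R) then b t else 0.

(** The abscissa 1 lies to the left of all z considered, which makes the error
    estimates uniform in z. *)
Definition kernel_mass : R := \int[lmu]_(t in `[0%R, +oo[) (expR (- (1 * t)) * cmod (a t)).

Lemma causalE b t : causal b t = if 0 <= t then b t else 0.
Proof.
rewrite /causal; have -> : (t \in (`[0%R, +oo[%classic : set R)) = (0 <= t) => //.
by apply/idP/idP; rewrite inE/= in_itv/= andbT.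
Qed.

Lemma truncateE b t : truncate b t = if 0 <= t <= tau then b t else 0.
Proof.
rewrite /truncate; have -> : (t \in (`[0%R, tau]%classic : set R)) = (0 <= t <= tau) => //.
by apply/idP/idP; rewrite inE/= in_itv/=.
Qed.

Lemma cintble_truncate (b : R -> R[i]) (M : R) : cmeas setT b ->
  (forall t, 0 <= t <= tau -> cmod (b t) <= M) -> cintble lmu setT (truncate b).
Proof.
move=> mb bM; apply: (cintble_mkcond lmu (D := `[0, tau]%classic) b _).1 => //.
apply: (@cintble_le _ _ _ lmu `[0, tau]%classic b (fun _ => M)) => //.
- by apply: cmeasS mb.
- apply: continuous_compact_integrable; first exact: segment_compact.
  by apply: continuous_subspaceT; exact: cst_continuous.
Qed.

Lemma cmeas_truncate (b : R -> R[i]) : cmeas setT b -> cmeas setT (truncate b).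
Proof. by move=> mb; apply: cmeas_mkcond => //; apply: cmeasS mb. Qed.

(** Take the Laplace transform of the equation for the truncated forcing: the
    convolution of a with it agrees with the equation up to tau, and beyond tau
    it is at most exp(-tau(Re z - 1)) times an integrable function. As a^(z) mu
    = 1, the two terms with the transform of u cancel and the transform of sg
    remains. *)
Lemma truncated_volterra (z mu u0 : R[i]) (u sg : R -> R[i]) (Gm : R) :
  1 < complex.Re z -> laplace a z * mu = 1 -> ccontinuous u -> ccontinuous sg ->
  (forall r, 0 <= r <= tau -> cmod (mu * u r - sg r) <= Gm) ->
  (forall t, 0 <= t <= tau ->
     u t = u0 + cint lmu `[0, t] (fun r => a (t - r) * (mu * u r - sg r))) ->
  exists2 E : R[i],
    cint lmu setT (fun r => cexp (- (z * r%:C)) * truncate sg r) = mu / z * u0 + mu * E &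
    cmod E <= (cmod u0 + Gm * kernel_mass) * expR tau * expR (- (tau * complex.Re z)).
Proof.
move=> z1 amu cu csg GM eq_u.
have z0 : 0 < complex.Re z by exact: lt_trans z1.
pose ez t := cexp (- (z * t%:C)).
have ezD s t : ez (s + t) = ez s * ez t by rewrite /ez -cexpD rmorphD/= mulrDr opprD.
have mez : cmeas setT ez by exact: ccontinuous_cmeas (ccontinuous_expc z).
have ez_le t : 0 <= t -> cmod (ez t) <= 1.
  by move=> t0; rewrite cmod_expc -expR0 ler_expR oppr_le0 mulr_ge0// ltW.
have mu_ : cmeas setT u by exact: ccontinuous_cmeas.
have msg : cmeas setT sg by exact: ccontinuous_cmeas.
pose G r := mu * u r - sg r.
have mG : cmeas setT G by apply: cmeasB msg; apply: cmeasM mu_; exact: cmeas_cst.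
have Gm0 : 0 <= Gm by apply: le_trans (cmod_ge0 _) (GM 0 _); rewrite lexx ltW.
have iL b (M : R) : cmeas setT b -> (forall t, 0 <= t <= tau -> cmod (b t) <= M) ->
    cintble lmu setT (fun t => ez t * truncate b t).
  move=> mb bM; have -> : (fun t => ez t * truncate b t) = truncate (fun t => ez t * b t).
    by apply/funext => t; rewrite !truncateE; case: ifP; rewrite ?mulr0.
  apply: (cintble_truncate (M := M)); first exact: cmeasM.
  move=> t tI; rewrite cmodM -[M]mul1r; apply: ler_pM; rewrite ?cmod_ge0//; last exact: bM.
  by apply: ez_le; case/andP: tI.
have bounded (b : R -> R[i]) : ccontinuous b -> exists M, forall t, 0 <= t <= tau -> cmod (b t) <= M.
  move=> [bR bI].
  have cb : {within `[0, tau], continuous (fun t => `|complex.Re (b t)| + `|complex.Im (b t)|)}.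
    apply: continuous_subspaceT => t; apply: cvgD.
      by apply: cvg_norm; exact: bR.
    by apply: cvg_norm; exact: bI.
  have [c _ Hc] := EVT_max (ltW tau0) cb; exists (`|complex.Re (b c)| + `|complex.Im (b c)|).
  by move=> t tI; apply: le_trans (cmod_le _) _; apply: Hc; rewrite in_itv.
have [Mu HMu] := bounded _ cu; have [Ms HMs] := bounded _ csg.
have iu := iL _ _ mu_ HMu; have is_ := iL _ _ msg HMs; have iG := iL _ _ mG GM.
pose al t := ez t * causal a t.
have alE t : al t = if t \in (`[0, +oo[%classic : set R) then ez t * a t else 0.
  by rewrite /al /causal; case: ifP; rewrite ?mulr0.
have ial : cintble lmu setT al.
  have := (cintble_mkcond lmu (D := `[0, +oo[%classic) _ _).1 (laplace_cintble sa z0).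
  by move=> /(_ (measurable_itv _)); apply: eq_cintble => // t _; rewrite alE.
have cal : cint lmu setT al = laplace a z.
  rewrite /laplace -/(cint _ _ _) [RHS]cint_mkcond; apply: eq_cint => t _; exact: alE.
pose g r := ez r * truncate G r.
have cg : cint lmu setT g = mu * cint lmu setT (fun t => ez t * truncate u t) -
    cint lmu setT (fun t => ez t * truncate sg t).
  rewrite -cintZ// -cintB//; last exact: cintbleZ.
  apply: eq_cint => t _; rewrite /g /G !truncateE; case: ifP => _; last by rewrite !mulr0 subr0.
  by ring.
pose c t := cint lmu setT (fun r => al (t - r) * g r).
have ic : cintble lmu setT c.
  exact: (cintble_plane1 (f := fun t r => al (t - r) * g r) (cintble_conv ial iG)).
have cc : cint lmu setT c = laplace a z * cint lmu setT g.
  by rewrite /c cint_conv// cal.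
have ipt (f h : R -> R[i]) (M t : R) : cintble lmu setT f -> cmeas setT h ->
    (forall r, cmod (h r) <= M) -> cintble lmu setT (fun r => f (t - r) * h r).
  move=> if_ mh hM; have := cintbleM_bounded measurableT (cintble_reflect t if_) mh (fun r _ => hM r).
  by apply: eq_cintble => // r _; rewrite mulrC.
have g_le r : cmod (g r) <= Gm.
  rewrite /g truncateE; case: ifP => rI; last by rewrite mulr0 cmod0.
  by rewrite cmodM -[Gm]mul1r; apply: ler_pM; rewrite ?cmod_ge0 ?GM// ez_le//; case/andP: rI.
have mg : cmeas setT g by apply: cmeasM => //; exact: cmeas_truncate.
have al_g t r : al (t - r) * g r = ez t * (causal a (t - r) * truncate G r).
  have -> : ez t = ez (t - r) * ez r by rewrite -ezD subrK.
  by rewrite /al /g; ring.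
(* on [0, tau] the convolution is the right-hand side of the equation *)
have cE t : 0 <= t <= tau -> c t = ez t * (u t - u0).
  move=> /andP[t0 tt]; rewrite eq_u ?t0// addrC addKr cint_mkcond /c.
  have E r : causal a (t - r) * truncate G r =
     (if r \in (`[0, t]%classic : set R) then a (t - r) * (mu * u r - sg r) else 0).
    have -> : (r \in (`[0%R, t]%classic : set R)) = (0 <= r <= t).
      by apply/idP/idP; rewrite inE/= in_itv/=.
    rewrite causalE truncateE subr_ge0.
    have [rt|rt] := leP r t; last by rewrite mul0r andbF.
    by rewrite (le_trans rt tt) !andbT; case: ifP => // _; rewrite mulr0.
  have ih : cintble lmu setT (fun r => causal a (t - r) * truncate G r).
    have := cintbleZ (ez (- t)) measurableT (ipt al g Gm t ial mg g_le).
    apply: eq_cintble => // r _; rewrite al_g mulrA -ezD addNr.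
    by rewrite /ez mulr0 oppr0 cexp0 mul1r.
  rewrite -cintZ//; last by apply: eq_cintble ih => // r _; rewrite E.
  by apply: eq_cint => r _; rewrite al_g E.
pose al1 t := (expR (- (1 * t)) * cmod (causal a t))%:C.
pose g1 r := (truncate (fun r => (expR (- r) * Gm)%:C) r) : R[i].
have al1E t : al1 t = if t \in (`[0, +oo[%classic : set R) then (expR (- (1 * t)) * cmod (a t))%:C else 0.
  by rewrite /al1 /causal; case: ifP => _ //; rewrite cmod0 mulr0.
have ial1 : cintble lmu setT al1.
  have := (cintble_mkcond lmu (D := `[0, +oo[%classic) _ _).1 (cintble_real (sa.2 1 ltr01)).
  by move=> /(_ (measurable_itv _)); apply: eq_cintble => // t _; rewrite al1E.
have mg1 : cmeas setT g1.
  apply: cmeas_truncate; apply: cmeas_real; apply: measurable_funM; last exact: measurable_cst.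
  by have := continuous_measurable_fun (@continuous_expM R 1); under eq_fun do rewrite mul1r.
have g1_le r : cmod (g1 r) <= Gm.
  rewrite /g1 truncateE; case: ifP => rI; last by rewrite cmod0.
  rewrite cmod_real; last by rewrite mulr_ge0 ?expR_ge0.
  by rewrite ler_piMl// -expR0 ler_expR oppr_le0; case/andP: rI.
have cint_half (b : R -> R[i]) : (forall t, t < 0 -> b t = 0) -> cint lmu setT b = cint lmu `[0, +oo[ b.
  move=> b0; rewrite [RHS]cint_mkcond; apply: eq_cint => t _; rewrite -/(causal b t) causalE.
  by case: leP => // t0; rewrite b0.
have cintble_half (b : R -> R[i]) : cintble lmu setT b -> cintble lmu `[0, +oo[ b.
  by move=> ib; apply: cintbleS ib.
have g1_0 t : t < 0 -> g1 t = 0 by move=> t0; rewrite /g1 truncateE leNgt t0.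
have ig1 : cintble lmu setT g1.
  apply: (cintble_truncate (M := Gm)).
    apply: cmeas_real; apply: measurable_funM; last exact: measurable_cst.
    by have := continuous_measurable_fun (@continuous_expM R 1); under eq_fun do rewrite mul1r.
  move=> r rI; have := g1_le r; by rewrite /g1 truncateE rI.
have m1 : cmod (cint lmu setT al1 * cint lmu setT g1) <= Gm * kernel_mass.
  have -> : cint lmu setT al1 = kernel_mass%:C.
    by rewrite /kernel_mass -cint_real [RHS]cint_mkcond; apply: eq_cint => t _; rewrite al1E.
  rewrite cmodM cmod_real; last first.
    by apply: Rintegral_ge0 => t _; rewrite mulr_ge0 ?expR_ge0 ?cmod_ge0.
  rewrite mulrC ler_wpM2r//; first by apply: Rintegral_ge0 => t _; rewrite mulr_ge0 ?expR_ge0 ?cmod_ge0.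
  rewrite cint_half//; apply: le_trans (cmod_cint_le _ (cintble_half _ ig1)) _ => //.
  have -> : Gm = \int[lmu]_(t in `[0%R, +oo[) (Gm * expR (- (1 * t))).
    by rewrite RintegralZl ?Rintegral_expM ?invr1 ?mulr1//; exact: integrable_expM.
  apply: le_Rintegral => //.
  - by apply: cintble_cmod => //; exact: cintble_half.
  - by apply: integrable_realZ => //; exact: integrable_expM.
  move=> t _; rewrite /g1 truncateE mul1r; case: ifP => _; last by rewrite cmod0 mulr_ge0 ?expR_ge0.
  by rewrite cmod_real ?mulr_ge0 ?expR_ge0// mulrC.
pose dec := expR tau * expR (- (tau * complex.Re z)).
have dec0 : 0 <= dec by rewrite mulr_ge0 ?expR_ge0.
have decay t : tau <= t -> expR (- (complex.Re z * t)) <= dec * expR (- (1 * t)).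
  move=> tt; rewrite /dec -!expRD ler_expR -subr_ge0.
  have -> : tau + - (tau * complex.Re z) + - (1 * t) - - (complex.Re z * t) = (complex.Re z - 1) * (t - tau) by ring.
  by rewrite mulr_ge0// subr_ge0// ltW.
pose c2 t := if 0 <= t <= tau then 0 else c t.
pose K1 t := complex.Re (cint lmu setT (fun r => al1 (t - r) * g1 r)).
have K1_ge0 t r : 0 <= complex.Re (al1 (t - r) * g1 r).
  rewrite /al1 /g1 truncateE; case: ifP => _; last by rewrite mulr0.
  by rewrite -rmorphM/= !mulr_ge0 ?expR_ge0 ?cmod_ge0.
have c2_le t : cmod (c2 t) <= dec * K1 t.
  have K0 : 0 <= K1 t by rewrite /K1 /=; apply: Rintegral_ge0 => r _; exact: K1_ge0.
  rewrite /c2; case: ifPn => tI; first by rewrite cmod0 mulr_ge0.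
  apply: le_trans (cmod_cint_le _ (ipt al g Gm t ial mg g_le)) _ => //.
  have iK := ipt al1 g1 Gm t ial1 mg1 g1_le.
  rewrite /K1 /= -RintegralZl//; last by case: iK.
  apply: le_Rintegral => //.
  - by apply: cintble_cmod => //; exact: ipt.
  - by apply: integrable_realZ => //; case: iK.
  move=> r _; rewrite al_g /al1 /g1 causalE !truncateE.
  have [tr|tr] := leP 0 (t - r); last first.
    by rewrite mul0r mulr0 !cmod0 mulr0 mul0r/= mulr0.
  case: (boolP (0 <= r <= tau)) => rI; last by rewrite mulr0 mulr0 cmod0 mulr0 mulr0.
  have t0 : 0 <= t by case/andP: rI => r0 _; rewrite (le_trans r0)// -subr_ge0.
  have tt : tau <= t by move: tI; rewrite t0/= -ltNge => /ltW.
  rewrite -rmorphM/= cmodM cmod_expc.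
  have -> : dec * (expR (- (1 * (t - r))) * cmod (a (t - r)) * (expR (- r) * Gm)) =
     dec * expR (- (1 * t)) * (cmod (a (t - r)) * Gm).
    have -> : expR (- (1 * t)) = expR (- (1 * (t - r))) * expR (- r) by rewrite -expRD; congr expR; ring.
    by ring.
  apply: ler_pM; rewrite ?expR_ge0 ?cmod_ge0 ?decay//.
  by rewrite cmodM ler_wpM2l ?cmod_ge0 ?GM.
have E2 t : c2 t = c t - truncate c t.
  by rewrite /c2 truncateE; case: ifP => _; rewrite ?subrr ?subr0.
have itc : cintble lmu setT (truncate c).
  by apply: (cintble_mkcond lmu (D := `[0, tau]%classic) c _).1 => //; apply: cintbleS ic.
have ic2 : cintble lmu setT c2.
  by apply: eq_cintble (cintbleB measurableT ic itc) => // t _; rewrite E2.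
pose rem t := causal ez t - truncate ez t.
have ice : cintble lmu setT (causal ez).
  exact: (cintble_mkcond lmu (D := `[0, +oo[%classic) _ (measurable_itv _)).1 (cintble_expc z0).
have ite : cintble lmu setT (truncate ez).
  by apply: (cintble_truncate (M := 1)) => // t /andP[t0 _]; exact: ez_le.
have irem : cintble lmu setT rem by exact: cintbleB.
have rem0 t : t < 0 -> rem t = 0.
  by move=> t0; rewrite /rem causalE truncateE leNgt t0/= subr0.
have rem_le : cmod (cint lmu setT rem) <= dec.
  rewrite cint_half//; apply: le_trans (cmod_cint_le _ (cintble_half _ irem)) _ => //.
  have -> : dec = \int[lmu]_(t in `[0%R, +oo[) (dec * expR (- (1 * t))).
    by rewrite RintegralZl ?Rintegral_expM ?invr1 ?mulr1//; exact: integrable_expM.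
  apply: le_Rintegral => //.
  - by apply: cintble_cmod => //; exact: cintble_half.
  - by apply: integrable_realZ => //; exact: integrable_expM.
  move=> t /=; rewrite in_itv/= andbT => t0; rewrite /rem causalE truncateE t0/=.
  have [tt|tt] := leP t tau; first by rewrite subrr cmod0 mulr_ge0 ?expR_ge0.
  by rewrite subr0 cmod_expc decay// ltW.
have cu_ : cint lmu setT (truncate c) =
    cint lmu setT (fun t => ez t * truncate u t) - cint lmu setT (truncate ez) * u0.
  rewrite -cintZr// -cintB//; last first.
    by have := cintbleZ u0 measurableT ite; apply: eq_cintble => // t _; rewrite mulrC.
  apply: eq_cint => t _; rewrite !truncateE; case: ifP => tI; last by rewrite mulr0 mul0r subr0.
  by rewrite cE//; ring.
have ce_ : cint lmu setT (truncate ez) = z^-1 - cint lmu setT rem.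
  have -> : z^-1 = cint lmu setT (causal ez).
    by rewrite -(cint_expc z0) cint_mkcond.
  by rewrite -cintB//; apply: eq_cint => t _; rewrite /rem subKr.
have c2_ : cint lmu setT c = cint lmu setT c2 + cint lmu setT (truncate c).
  by rewrite -cintD//; apply: eq_cint => t _; rewrite E2 subrK.
exists (- (u0 * cint lmu setT rem + cint lmu setT c2)).
  move: c2_; rewrite cc cg cu_ ce_.
  move: (cint lmu setT c2) (cint lmu setT rem) (cint lmu setT (fun t => ez t * truncate u t)).
  rewrite -/(cint lmu setT (fun t => ez t * truncate sg t)).
  move: (cint lmu setT _) (laplace a z) amu => Ls ah amu C2 Rm Lu H.
  have H2 : ah * Ls = u0 * z^-1 - u0 * Rm - C2.
    have -> : ah * Ls = (ah * mu) * Lu - ah * (mu * Lu - Ls) by ring.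
    by rewrite H amu; ring.
  have -> : Ls = (ah * mu) * Ls by rewrite amu mul1r.
  by rewrite mulrAC H2; ring.
rewrite cmodN (le_trans (cmodD _ _))// -mulrA -/dec mulrDl lerD//.
  by rewrite cmodM ler_wpM2l// cmod_ge0.
apply: le_trans (cmod_cint_le _ ic2) _ => //.
have iK := cintble_plane1 (f := fun t r => al1 (t - r) * g1 r) (cintble_conv ial1 ig1).
apply: (@le_trans _ _ (\int[lmu]_t (dec * K1 t))).
  apply: le_Rintegral => //; first exact: cintble_cmod.
  by apply: integrable_realZ => //; case: iK.
rewrite RintegralZl//; last by case: iK.
rewrite mulrC ler_wpM2r//; apply: le_trans m1.
by rewrite -(cint_conv ial1 ig1); apply: le_trans (Re_le_cmod _).
Qed.

End TruncatedVolterra.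

(** * Bochner integrals seen through bounded functionals *)

Section BochnerFunctional.
Context {R : realType} {X : normedModType R[i]}.
Notation lmu := (@lebesgue_measure R).

(** The integral of a nonnegative function is a supremum over simple functions
    below it, so it is monotone without any measurability of the larger one. *)
Lemma ge0_le_integral_nomeas (D : set R) (f g : R -> \bar R) :
  (forall x, D x -> (0 <= f x)%E) -> (forall x, D x -> (f x <= g x)%E) ->
  (\int[lmu]_(x in D) f x <= \int[lmu]_(x in D) g x)%E.
Proof.
move=> f0 fg; rewrite !ge0_integralE//; last by move=> x Dx; apply: le_trans (f0 x Dx) (fg x Dx).
apply: ge_ereal_sup => _ [h /= hf <-]; apply: ereal_sup_ubound; exists h => //= x.
apply: le_trans (hf x) _.
by rewrite !patchE; case: ifPn => // xD; apply: fg; rewrite inE in xD.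
Qed.

Context (D : set R) (mD : measurable (D : set (measurableTypeR R))) (psi : X -> R[i]) (P : R).
Context (hpsi : bounded_functional psi P).

Lemma step_fun_functional (s : seq (set R * X)) : step_fun_on D s ->
  cintble lmu D (fun r => psi (step_fun s r)) /\
  cint lmu D (fun r => psi (step_fun s r)) = psi (step_integral s).
Proof.
elim: s => [_|[B v] s IH hs].
  rewrite /step_integral big_nil (functional0 hpsi).
  have -> : (fun r => psi (step_fun [::] r)) = (fun _ => 0).
    by apply/funext => r; rewrite /step_fun big_nil (functional0 hpsi).
  split; first by split; exact: integrable0.
  by apply: complex_ext; rewrite /= /Rintegral integral0.
have [|iS ES] := IH; first by move=> p ps; apply: hs; rewrite inE ps orbT.
have [mB BD Boo] := hs (B, v) (mem_head _ _).
have E r : psi (step_fun ((B, v) :: s) r) = (\1_B r)%:C * psi v + psi (step_fun s r).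
  by rewrite /step_fun big_cons/= (functional_lin hpsi).
have BDB : B `&` D = B by apply/setIidPl.
have iB : lmu.-integrable D (EFin \o \1_B).
  apply/integrableP; split.
    by apply/measurable_EFinP; apply: measurable_funTS; exact: measurable_indic.
  under eq_integral do rewrite /= ger0_norm//.
  by rewrite integral_indic// BDB.
have EB : \int[lmu]_(r in D) \1_B r = fine (lmu B).
  by rewrite /Rintegral integral_indic// BDB.
have iBv : cintble lmu D (fun r => (\1_B r)%:C * psi v).
  have := cintbleZ (psi v) mD (cintble_real iB).
  by apply: eq_cintble => // r _; rewrite mulrC.
split.
  by apply: eq_cintble (cintbleD mD iBv iS) => // r _; rewrite E.
rewrite /step_integral big_cons/= (functional_lin hpsi) -/(step_integral s) -ES -EB -cint_real -cintZr//; last exact: cintble_real.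
by rewrite -cintD//; apply: eq_cint => r _; rewrite E.
Qed.

(** Both sides are limits of the same quantities along the step functions of
    the Bochner integral. The integrability of psi o f is a hypothesis, which
    is easily checked where f is explicit and spares the measurability theory
    of f. *)
Lemma bochner_functional (f : R -> X) v : is_bochner_integral D f v ->
  cintble lmu D (fun r => psi (f r)) ->
  cint lmu D (fun r => psi (f r)) = psi v.
Proof.
move=> [s [sD _ Ls Lv]] if_.
apply/eqP; rewrite -subr_eq0 -cmod_eq0 eq_le cmod_ge0 andbT; apply/ler_addgt0Pl => e e0.
rewrite addr0.
have P1 : 0 < P + 1 by rewrite ltr_wpDl// (functional_ge0 hpsi).
pose e1 := e / 2 / (P + 1); have e10 : 0 < e1 by rewrite !divr_gt0.
move/fine_cvgP : Ls => [Lfin /cvgrPdist_le /(_ e1 e10) Ls].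
move/cvgrPdist_le : Lv => /(_ e1%:C); rewrite ltcR => /(_ e10) Lv.
have [n [/= nfin [nLs nLv]]] := @filter_ex _ _ _ _ (filterI Lfin (filterI Ls Lv)).
have [is_ Es] := step_fun_functional (sD n).
pose I := (\int[lmu]_(r in D) (rnorm (f r - step_fun (s n) r))%:E)%E.
have iB : cintble lmu D (fun r => psi (f r) - psi (step_fun (s n) r)) by exact: cintbleB.
have H1 : cmod (cint lmu D (fun r => psi (f r)) - psi (step_integral (s n))) <= (P + 1) * e1.
  rewrite -Es -cintB//; apply: le_trans (cmod_cint_le mD iB) _.
  rewrite -ler_pdivrMl// -RintegralZl//; last exact: cintble_cmod.
  have nI : fine I <= e1 by apply: le_trans nLs; rewrite sub0r normrN ler_norm.
  apply: le_trans nI; rewrite -lee_fin /I (fineK nfin) EFin_Rintegral//; last first.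
    by apply: integrable_realZ => //; exact: cintble_cmod.
  apply: ge0_le_integral_nomeas => r Dr; rewrite lee_fin.
    by rewrite mulr_ge0 ?cmod_ge0// invr_ge0 ltW.
  rewrite ler_pdivrMl// -(functionalB hpsi) (le_trans (functional_le hpsi _))//.
  by rewrite ler_wpM2r ?rnorm_ge0// lerDl.
have H2 : cmod (psi (step_integral (s n)) - psi v) <= (P + 1) * e1.
  rewrite -(functionalB hpsi); apply: le_trans (functional_le hpsi _) _.
  apply: ler_pM; rewrite ?(functional_ge0 hpsi) ?rnorm_ge0// ?lerDl//.
  by rewrite -lecR rnormC distrC.
have -> : cint lmu D (fun r => psi (f r)) - psi v =
  (cint lmu D (fun r => psi (f r)) - psi (step_integral (s n))) + (psi (step_integral (s n)) - psi v).
  by rewrite addrA subrK.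
apply: le_trans (cmodD _ _) _; apply: le_trans (lerD H1 H2) _.
by rewrite le_eqVlt; apply/orP; left; apply/eqP; rewrite /e1; field; rewrite gt_eqF.
Qed.

End BochnerFunctional.

(** * Admissibility of an exponentially stable semigroup on the half-line *)

Section HalflineAdmissibility.
Context {R : realType} {X Y : normedModType R[i]}.
Notation lmu := (@lebesgue_measure R).
Context (DA : set X) (A : X -> X) (C : X -> Y).
Context (hC : bounded_linear_on_X1 DA A C).

Lemma observation_sub x y : DA x -> DA y -> DA (x - y) -> C (x - y) = C x - C y.
Proof.
move=> Dx Dy Dxy; have := X1_linear hC 1 Dxy Dy; rewrite !scale1r subrK => ->.
by rewrite addrK.
Qed.

(** C is bounded for the graph norm, in which the orbit is continuous because A
    commutes with U. *)
Lemma observation_orbit (U : R -> X -> X) x :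
  (forall y z, DA y -> DA z -> DA (y - z) /\ A (y - z) = A y - A z) ->
  {within `[0, +oo[, continuous (fun t => U t x)} ->
  {within `[0, +oo[, continuous (fun t => U t (A x))} ->
  (forall t, 0 <= t -> DA (U t x) /\ A (U t x) = U t (A x)) ->
  continuous (fun t : R => rnorm (C (U (Num.max t 0) x))).
Proof.
move=> DB c1 c2 hU t; apply/cvgrPdist_le => e e0.
have [_ [M CM]] := hC.
have max0 (s : R) : 0 <= Num.max s 0 by rewrite le_max lexx orbT.
have M1 : 0 < 2 * (`|M| + 1) by rewrite mulr_gt0// ltr_wpDl.
pose e1 := e / (2 * (`|M| + 1)); have e10 : 0 < e1 by rewrite divr_gt0.
have [d1 d10 H1] := within_epsdelta c1 (max0 t) e10.
have [d2 d20 H2] := within_epsdelta c2 (max0 t) e10.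
apply/nbhs_ballP; exists (Num.min d1 d2) => /=; first by rewrite lt_min d10.
move=> s; rewrite /ball/= distrC lt_min => /andP[sd1 sd2].
have [Ds As] := hU _ (max0 s); have [Dt At] := hU _ (max0 t).
have [Dst Ast] := DB _ _ Ds Dt.
rewrite distrC; apply: le_trans (rnorm_dist _ _) _.
rewrite -observation_sub//; apply: le_trans (CM _ Dst) _.
rewrite Ast As At.
have h1 := H1 _ (max0 s) (le_lt_trans (max0_dist _ _) sd1).
have h2 := H2 _ (max0 s) (le_lt_trans (max0_dist _ _) sd2).
apply: (@le_trans _ _ ((`|M| + 1) * (e1 + e1))).
  apply: (@le_trans _ _ (`|M| * (rnorm (U (Num.max s 0) x - U (Num.max t 0) x) +
     rnorm (U (Num.max s 0) (A x) - U (Num.max t 0) (A x))))).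
    by rewrite ler_wpM2r ?addr_ge0 ?rnorm_ge0// ler_norm.
  by apply: ler_pM; rewrite ?addr_ge0 ?rnorm_ge0// ?lerDl// lerD.
rewrite le_eqVlt; apply/orP; left; apply/eqP; rewrite /e1; field.
by rewrite gt_eqF// ltr_wpDl.
Qed.

Context (T : R -> {linear X -> X}) (hT : generates DA A T).
Context (M0 omega : R) (M0ge : 0 <= M0) (omega0 : 0 < omega).
Context (T_le : forall t x, 0 <= t -> rnorm (T t x) <= M0 * expR (- (omega * t)) * rnorm x).

Lemma generator_sub x y : DA x -> DA y -> DA (x - y) /\ A (x - y) = A x - A y.
Proof.
by move=> Dx Dy; have := generator_lin hT (-1) Dy Dx; rewrite !scaleN1r ![- _ + _]addrC.
Qed.

Definition semigroup_energy (tau : R) (x : X) : \bar R :=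
  (\int[lmu]_s (if 0 <= s <= tau then rnorm (C (T s x)) ^+ 2 else 0)%:E)%E.

Lemma continuous_semigroup_observation x : DA x ->
  continuous (fun t : R => rnorm (C (T (Num.max t 0) x))).
Proof.
move=> Dx; apply: (@observation_orbit (fun t => T t)).
- exact: generator_sub.
- exact: (semigroup_orbit hT (x := x)).
- exact: (semigroup_orbit hT (x := A x)).
- by move=> t t0; exact: (generator_orbit hT t0 Dx).
Qed.

Lemma measurable_window (tau : R) x : DA x ->
  measurable_fun setT (fun s : R => if 0 <= s <= tau then rnorm (C (T s x)) ^+ 2 else 0).
Proof.
move=> Dx; have -> : (fun s : R => if 0 <= s <= tau then rnorm (C (T s x)) ^+ 2 else 0) =
    (fun s => \1_(`[0, tau]%classic) s * rnorm (C (T (Num.max s 0) x)) ^+ 2).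
  apply/funext => s; rewrite indicE.
  have -> : (s \in (`[0%R, tau]%classic : set R)) = (0 <= s <= tau).
    by apply/idP/idP; rewrite inE/= in_itv/=.
  case: (boolP (0 <= s <= tau)) => [/andP[s0 _]|_]; last by rewrite mul0r.
  by rewrite mul1r max_l.
apply: measurable_funM; first exact: measurable_indic.
apply: measurable_funX; apply: continuous_measurable_fun.
exact: continuous_semigroup_observation.
Qed.

(** The window [L, L + tau] of the orbit of x is the window [0, tau] of the
    orbit of T(L) x. *)
Lemma semigroup_energyD (L tau : R) x : 0 <= L -> 0 <= tau -> DA x ->
  (semigroup_energy (L + tau) x <= semigroup_energy L x + semigroup_energy tau (T L x))%E.
Proof.
move=> L0 tau0 Dx; have [DL _] := generator_orbit hT L0 Dx.
have mL := measurable_window tau DL; have mx := measurable_window L Dx.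
have f0 (t : R) z s : 0 <= (if 0 <= s <= t then rnorm (C (T s z)) ^+ 2 else 0).
  by case: ifP => _ //; rewrite sqr_ge0.
have -> : semigroup_energy tau (T L x) =
   (\int[lmu]_s (if 0 <= s - L <= tau then rnorm (C (T (s - L) (T L x))) ^+ 2 else 0)%:E)%E.
  symmetry; apply: (ge0_integral_shift (- L)
    (f := fun s => (if 0 <= s <= tau then rnorm (C (T s (T L x))) ^+ 2 else 0)%:E)).
    by apply/measurable_EFinP.
  by move=> s; rewrite lee_fin.
have msh : measurable_fun setT (fun s : R =>
    (if 0 <= s - L <= tau then rnorm (C (T (s - L) (T L x))) ^+ 2 else 0)%:E).
  have ms : measurable_fun setT (fun s : R => s - L).
    by apply: measurable_funB; [exact: measurable_id|exact: measurable_cst].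
  by apply/measurable_EFinP; exact: (measurableT_comp mL ms).
have mxE : measurable_fun setT (fun s : R => (if 0 <= s <= L then rnorm (C (T s x)) ^+ 2 else 0)%:E).
  by apply/measurable_EFinP.
rewrite /semigroup_energy -(ge0_integralD lmu measurableT _ mxE _ msh);
  try by move=> s _; rewrite lee_fin.
apply: ge0_le_integral_nomeas => s _; first by rewrite lee_fin.
rewrite -EFinD lee_fin; case: ifP => [/andP[s0 sL]|_]; last by rewrite addr_ge0.
have [sl|sl] := leP s L; first by rewrite s0/= lerDl.
rewrite s0/= subr_ge0 (ltW sl)/= lerBlDl sL add0r.
by rewrite -(semigroupD hT)// ?subrK// subr_ge0 ltW.
Qed.

(** Choose L with the norm of T(L) at most 1/2; the energy over n windows of
    length L is then bounded by a geometric series. *)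
Lemma halfline_energy : finite_time_admissible DA C T ->
  exists2 q : R, 0 < q & forall x, DA x ->
    (\int[lmu]_(s in `[0%R, +oo[) (rnorm (C (T (Num.max s 0) x)) ^+ 2)%:E <= (q * rnorm x ^+ 2)%:E)%E.
Proof.
move=> [eta [K [eta0 K0 HK]]].
(* beyond L the norms of the semigroup are halved, so energies are divided by 4 *)
have [L L0 HL] : exists2 L : R, 0 < L & M0 * expR (- (omega * L)) <= 2^-1.
  have M1 : 0 < M0 + 1 by rewrite ltr_wpDl.
  have k1 : 1 < 2 * (M0 + 1) by rewrite mulrDr mulr1 ltr_wpDl ?mulr_ge0// ltr1n.
  exists (ln (2 * (M0 + 1)) / omega); first by rewrite divr_gt0// ln_gt0.
  rewrite mulrCA divff ?gt_eqF// mulr1 expRN lnK; last by rewrite posrE mulr_gt0.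
  by rewrite ler_pdivrMr ?mulr_gt0// mulrA mulVf// mul1r lerDl.
pose c := (K * expR (eta * L)) ^+ 2.
have c0 : 0 < c by rewrite exprn_gt0// mulr_gt0// expR_gt0.
have one x : DA x -> (semigroup_energy L x <= (c * rnorm x ^+ 2)%:E)%E.
  move=> Dx; have := HK L x (ltW L0) Dx.
  have -> : (\int[lmu]_(r in `[0%R, L]) (rnorm (C (T r x)) ^+ 2)%:E)%E = semigroup_energy L x.
    rewrite integral_mkcond /semigroup_energy; apply: eq_integral => s _; rewrite patchE.
    have -> : (s \in (`[0%R, L]%classic : set R)) = (0 <= s <= L).
      by apply/idP/idP; rewrite inE/= in_itv/=.
    by case: ifP.
  have J0 : (0 <= semigroup_energy L x)%E.
    by apply: integral_ge0 => s _; rewrite lee_fin; case: ifP => _ //; rewrite sqr_ge0.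
  move: J0; case: (semigroup_energy L x) => [j| |]//; last by rewrite poweRyr// leye_eq.
  rewrite poweR_EFin !lee_fin => j0 h.
  have -> : j = (j `^ 2^-1) ^+ 2 by rewrite powR12_sqrt// sqr_sqrtr.
  rewrite /c -exprMn; apply: lerXn2r; rewrite ?nnegrE ?powR_ge0//.
  by rewrite !mulr_ge0 ?expR_ge0 ?rnorm_ge0// ltW.
have many n x : DA x -> (semigroup_energy (n%:R * L) x <= (4 / 3 * c * rnorm x ^+ 2)%:E)%E.
  have nL (k : nat) : 0 <= k%:R * L by rewrite mulr_ge0// ltW.
  elim: n x => [|n IH] x Dx.
    rewrite mul0r; apply: le_trans (le_trans _ (one x Dx)) _.
      apply: ge0_le_integral_nomeas => s _; rewrite lee_fin.
        by case: ifP => _ //; rewrite sqr_ge0.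
      case: ifP => [/andP[s0 s1]|_]; last by case: ifP => _ //; rewrite sqr_ge0.
      by rewrite s0 (le_trans s1 (ltW L0)).
    by rewrite lee_fin ler_wpM2r ?sqr_ge0// ler_peMl ?(ltW c0)//; lra.
  have -> : n.+1%:R * L = L + n%:R * L by rewrite -natr1 mulrDl mul1r addrC.
  apply: le_trans (semigroup_energyD (ltW L0) (nL n) Dx) _.
  have [DL _] := generator_orbit hT (ltW L0) Dx.
  apply: le_trans (leeD (one x Dx) (IH _ DL)) _; rewrite -EFinD lee_fin.
  have tl : rnorm (T L x) ^+ 2 <= rnorm x ^+ 2 / 4.
    have -> : rnorm x ^+ 2 / 4 = (2^-1 * rnorm x) ^+ 2 by field.
    apply: lerXn2r; rewrite ?nnegrE ?mulr_ge0 ?rnorm_ge0//.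
    by apply: le_trans (T_le x (ltW L0)) _; rewrite ler_wpM2r// rnorm_ge0.
  have : 4 / 3 * c * rnorm (T L x) ^+ 2 <= 4 / 3 * c * (rnorm x ^+ 2 / 4).
    by rewrite ler_wpM2l// !mulr_ge0// ltW.
  have -> : 4 / 3 * c * (rnorm x ^+ 2 / 4) = 4 / 3 * c * rnorm x ^+ 2 - c * rnorm x ^+ 2 by field.
  by rewrite lerBrDl.
exists (4 / 3 * c); first by apply: mulr_gt0 c0; rewrite divr_gt0.
move=> x Dx; rewrite ge0_integral_ereal_sup; last 2 first.
- by move=> s; rewrite sqr_ge0.
- by apply: measurable_funX; apply: continuous_measurable_fun; exact: continuous_semigroup_observation.
apply: ge_ereal_sup => _ [n _ <-].
have [k kn] : exists k : nat, n.+1%:R <= k%:R * L.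
  exists (Num.truncn (n.+1%:R / L)).+1; rewrite -ler_pdivrMr// ltW//; exact: truncnS_gt.
apply: le_trans (many k x Dx); rewrite integral_mkcond.
apply: ge0_le_integral_nomeas => s _; rewrite patchE.
  by case: ifP => _ //; rewrite lee_fin sqr_ge0.
have -> : (s \in (`[0%R, n.+1%:R]%classic : set R)) = (0 <= s <= n.+1%:R).
  by apply/idP/idP; rewrite inE/= in_itv/=.
case: ifP => [/andP[s0 sn]|_]; last by rewrite lee_fin; case: ifP => _ //; rewrite sqr_ge0.
by rewrite s0 (le_trans sn kn)/= max_l.
Qed.

End HalflineAdmissibility.

(** * The solution family *)

Section VolterraLaplace.
Context {R : realType} {X : normedModType R[i]}.
Notation lmu := (@lebesgue_measure R).
Context (DA : set X) (A : X -> X) (T : R -> {linear X -> X}).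
Context (hT : generates DA A T).
Context (M0 omega : R) (M0ge : 0 <= M0) (omega0 : 0 < omega).
Context (T_le : forall t x, 0 <= t -> rnorm (T t x) <= M0 * expR (- (omega * t)) * rnorm x).
Context (a : R -> R[i]) (S : R -> {linear X -> X}) (hS : solution_family a DA A S).
Context (ha : L1loc a) (sa : subexp a).
Context (psi : X -> R[i]) (P : R) (hpsi : bounded_functional psi P).

Lemma orbit_bounded (v : R -> X) (tau : R) : 0 < tau ->
  {within `[0, +oo[, continuous v} ->
  exists2 M, 0 <= M & forall r, 0 <= r <= tau -> rnorm (v r) <= M.
Proof.
move=> tau0 cv.
have cn : continuous (fun r : R => rnorm (v (Num.max r 0))).
  move=> r; apply/cvgrPdist_le => e e0.
  have max0 (s : R) : 0 <= Num.max s 0 by rewrite le_max lexx orbT.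
  have [d d0 Hd] := within_epsdelta cv (max0 r) e0.
  apply/nbhs_ballP; exists d => //= s; rewrite /ball/= distrC => sd.
  rewrite distrC; apply: le_trans (rnorm_dist _ _) (Hd _ (max0 s) _).
  exact: le_lt_trans (max0_dist _ _) sd.
have [c _ Hc] := EVT_max (ltW tau0) (continuous_subspaceT cn).
exists (rnorm (v (Num.max c 0))); first exact: rnorm_ge0.
move=> r rI; have := Hc r; rewrite in_itv/= => /(_ rI); rewrite [Num.max r 0]max_l//.
by case/andP: rI.
Qed.

(** The functional psi o A (mu - A)^-1 in a form without the unbounded
    operator: it is bounded on X, so it applies to the solution equation. *)
Definition yosida_functional (mu : R[i]) (y : X) : R[i] :=
  mu * resolvent_functional T psi mu y - psi y.

Lemma yosida_bounded (mu : R[i]) : 0 < complex.Re mu ->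
  bounded_functional (yosida_functional mu) (cmod mu * (P * M0 / complex.Re mu) + P).
Proof.
move=> m0; have P0 := functional_ge0 hpsi.
split.
- move=> k x y; rewrite /yosida_functional.
  rewrite (resolvent_functional_lin hT M0ge omega0 T_le hpsi (ltW m0)) (functional_lin hpsi).
  by ring.
- by rewrite addr_ge0// mulr_ge0 ?cmod_ge0// divr_ge0 ?mulr_ge0// ltW.
- move=> y; apply: le_trans (cmod_sub_le _ _) _; rewrite mulrDl.
  apply: lerD (functional_le hpsi y); rewrite cmodM -mulrA ler_wpM2l ?cmod_ge0//.
  apply: le_trans (resolvent_functional_le hT M0ge omega0 T_le hpsi y m0) _.
  by rewrite mulrAC.
Qed.

(** A bounded functional passes through the Bochner integral of the solution
    equation; S commutes with A, so the integrand involves the orbit of A x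
    only. *)
Lemma volterra_functional (Phi : X -> R[i]) (Q : R) (x : X) (t : R) :
  bounded_functional Phi Q -> DA x -> 0 <= t ->
  Phi (S t x) = Phi x + cint lmu `[0, t] (fun r => a (t - r) * Phi (S (Num.max r 0) (A x))).
Proof.
move=> hPhi Dx t0.
have [v hv ->] := solution_family_equation hS t0 Dx.
rewrite (functionalD hPhi); congr (_ + _).
have E (r : R) : r \in (`[0, t]%classic : set R) ->
    Phi (a (t - r) *: A (S r x)) = a (t - r) * Phi (S (Num.max r 0) (A x)).
  rewrite inE/= in_itv/= => /andP[r0 _].
  by rewrite (functionalZ hPhi) max_l// (solution_family_commute hS).
have cPhi : ccontinuous (fun r => Phi (S (Num.max r 0) (A x))).
  exact: (functional_orbit hPhi (v := fun t => S t (A x)) (solution_family_strongly_continuous hS (x := A x))).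
have [MA MA0 HMA] := orbit_bounded (ltr_wpDr t0 ltr01 : 0 < 1 + t)
   (solution_family_strongly_continuous hS (x := A x)).
have ia : cintble lmu `[0, t] (fun r => a (t - r)).
  have := (cintble_mkcond lmu (D := `[0, t]%classic) a (measurable_itv _)).1 (ha t0).
  move=> /(cintble_reflect t) H; apply: (cintble_mkcond lmu (D := `[0, t]%classic) _ (measurable_itv _)).2.
  apply: eq_cintble H => // r _.
  have Em (s : R) : (s \in (`[0%R, t]%classic : set R)) = (0 <= s <= t).
    by apply/idP/idP; rewrite inE/= in_itv/=.
  by rewrite !Em subr_ge0 lerBlDr lerDl andbC.
have i2 : cintble lmu `[0, t] (fun r => a (t - r) * Phi (S (Num.max r 0) (A x))).
  have mD : measurable (`[0, t]%classic : set (measurableTypeR R)) by exact: measurable_itv.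
  have H := cintbleM_bounded (M := Q * MA) mD ia (ccontinuous_cmeas mD cPhi).
  apply: eq_cintble (H _) => //; first by move=> r _; rewrite mulrC.
  move=> r /=; rewrite in_itv/= => /andP[r0 rt]; apply: le_trans (functional_le hPhi _) _.
  rewrite ler_wpM2l ?(functional_ge0 hPhi)// HMA// max_l// r0/=.
  by rewrite (le_trans rt)// lerDr.
rewrite -(bochner_functional (measurable_itv _) hPhi hv).
  by apply: eq_cint => r rI; exact: E.
by apply: eq_cintble i2 => // r rI; rewrite E.
Qed.

Context (m' : R[i] -> R[i]) (kappa K B rho : R).
Context (hm : sublinear_symbol (fun z => (laplace a z)^-1) m' kappa K B rho).

(** Apply psi o A (mu - A)^-1 with mu = 1/a^(z) to the solution equation. Since
    A (mu - A)^-1 A = mu A (mu - A)^-1 - A on the domain, this gives a scalar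
    Volterra equation forced by psi(S(r) A x) alone, whose truncated Laplace
    transform is known. Its initial value is psi (mu - A)^-1 A x, which is the
    Laplace transform at mu of the semigroup orbit. Sectoriality makes |mu|/Re
    mu bounded, and the functionals with it, so that the error is uniform in z.
    *)
Lemma volterra_laplace (x : X) (tau : R) : DA x -> 0 < tau ->
  exists E M,
    (forall z, 1 < complex.Re z ->
      cint lmu setT (fun r => cexp (- (z * r%:C)) *
        truncate tau (fun r => psi (S (Num.max r 0) (A x))) r) =
      (laplace a z)^-1 / z * cint lmu setT (fun s => cexp (- ((laplace a z)^-1 * s%:C)) *
        causal (fun s => psi (T (Num.max s 0) (A x))) s) + (laplace a z)^-1 * E z) /\
    (forall z, 1 < complex.Re z -> cmod (E z) <= M * expR (- (tau * complex.Re z))).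
Proof.
move=> Dx tau0; have P0 := functional_ge0 hpsi; have k0 := symbol_kappa hm.
have [MA MA0 HMA] := orbit_bounded tau0 (solution_family_strongly_continuous hS (x := A x)).
pose cst := P * M0 / kappa + P.
have cst0 : 0 <= cst by rewrite addr_ge0// divr_ge0 ?mulr_ge0// ltW.
pose Gm := cst * MA.
pose M := (cst * rnorm x + Gm * kernel_mass a) * expR tau.
have main z : 1 < complex.Re z -> exists2 E : R[i],
    cint lmu setT (fun r => cexp (- (z * r%:C)) *
      truncate tau (fun r => psi (S (Num.max r 0) (A x))) r) =
    (laplace a z)^-1 / z * cint lmu setT (fun s => cexp (- ((laplace a z)^-1 * s%:C)) *
      causal (fun s => psi (T (Num.max s 0) (A x))) s) + (laplace a z)^-1 * E &
    cmod E <= M * expR (- (tau * complex.Re z)).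
  move=> z1; set mu := (laplace a z)^-1.
  have mu0 : 0 < complex.Re mu := symbol_re hm z1.
  have mun0 : mu != 0 := symbol_neq0 hm z1.
  have cm0 : 0 < cmod mu by rewrite cmod_gt0.
  have an0 : laplace a z != 0 by rewrite -invr_eq0.
  have sec : kappa * cmod mu <= complex.Re mu := symbol_sector hm z1.
  have hY := yosida_bounded mu0.
  have ratio : cmod mu * (P * M0 / complex.Re mu) <= P * M0 / kappa.
    rewrite mulrCA ler_wpM2l ?mulr_ge0// ler_pdivrMr//.
    by rewrite ler_pdivlMl.
  have Yle y : cmod (yosida_functional mu y) <= cst * rnorm y.
    apply: le_trans (functional_le hY y) _; rewrite ler_wpM2r ?rnorm_ge0//.
    by rewrite /cst lerD2r.
  have YA y : DA y -> yosida_functional mu y = resolvent_functional T psi mu (A y).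
    by move=> Dy; rewrite (resolvent_identity hT M0ge omega0 T_le hpsi (ltW mu0) Dy).
  have YS (r : R) : 0 <= r -> mu * yosida_functional mu (S r x) - psi (S r (A x)) =
      yosida_functional mu (S r (A x)).
    move=> r0; rewrite YA; last exact: (solution_family_domain hS).
    by rewrite (solution_family_commute hS).
  have max0 (s : R) : 0 <= Num.max s 0 by rewrite le_max lexx orbT.
  have amu : laplace a z * mu = 1 by rewrite divff.
  have cu : ccontinuous (fun r => yosida_functional mu (S (Num.max r 0) x)).
    exact: (functional_orbit hY (v := fun t => S t x) (solution_family_strongly_continuous hS (x := x))).
  have csg : ccontinuous (fun r => psi (S (Num.max r 0) (A x))).
    exact: (functional_orbit hpsi (v := fun t => S t (A x)) (solution_family_strongly_continuous hS (x := A x))).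
  have GM r : 0 <= r <= tau ->
      cmod (mu * yosida_functional mu (S (Num.max r 0) x) - psi (S (Num.max r 0) (A x))) <= Gm.
    move=> rI; rewrite YS//; apply: le_trans (Yle _) _.
    by rewrite ler_wpM2l// max_l ?HMA//; case/andP: rI.
  have eq_u t : 0 <= t <= tau -> yosida_functional mu (S (Num.max t 0) x) =
      yosida_functional mu x + cint lmu `[0, t] (fun r => a (t - r) *
       (mu * yosida_functional mu (S (Num.max r 0) x) - psi (S (Num.max r 0) (A x)))).
    move=> /andP[t0 _]; rewrite max_l// (volterra_functional hY Dx t0); congr (_ + _).
    by apply: eq_cint => r _; rewrite YS.
  have [E E1 E2] := truncated_volterra sa tau0 z1 amu cu csg GM eq_u.
  exists E; last first.
    apply: le_trans E2 _; rewrite ler_wpM2r ?expR_ge0// ler_wpM2r ?expR_ge0//.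
    by rewrite lerD2r; exact: Yle.
  rewrite E1 YA// /resolvent_functional [in LHS]cint_mkcond; congr (_ * _ + _).
  by apply: eq_cint => s _; rewrite /causal; case: ifP; rewrite ?mulr0.
have main' z : exists E : R[i], 1 < complex.Re z ->
    cint lmu setT (fun r => cexp (- (z * r%:C)) *
      truncate tau (fun r => psi (S (Num.max r 0) (A x))) r) =
    (laplace a z)^-1 / z * cint lmu setT (fun s => cexp (- ((laplace a z)^-1 * s%:C)) *
      causal (fun s => psi (T (Num.max s 0) (A x))) s) + (laplace a z)^-1 * E /\
    cmod E <= M * expR (- (tau * complex.Re z)).
  have [z1|nz1] := boolP (1 < complex.Re z); last by exists 0.
  by have [E E1 E2] := main z z1; exists E.
have [E HE] := choice main'.
by exists E, M; split=> z /HE[].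
Qed.

End VolterraLaplace.

Section SolutionEnergy.
Context {R : realType} {X Y : normedModType R[i]}.
Notation lmu := (@lebesgue_measure R).
Context (DA : set X) (A : X -> X) (T : R -> {linear X -> X}).
Context (hT : generates DA A T).
Context (M0 omega : R) (M0ge : 0 <= M0) (omega0 : 0 < omega).
Context (T_le : forall t x, 0 <= t -> rnorm (T t x) <= M0 * expR (- (omega * t)) * rnorm x).
Context (a : R -> R[i]) (S : R -> {linear X -> X}) (hS : solution_family a DA A S).
Context (ha : L1loc a) (sa : subexp a).
Context (C : X -> Y) (hC : bounded_linear_on_X1 DA A C).
Context (m' : R[i] -> R[i]) (kappa K B rho : R).
Context (hm : sublinear_symbol (fun z => (laplace a z)^-1) m' kappa K B rho).

(** Observe C S(t)x through a functional that norms it at the given t, and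
    rewrite that observation as psi(A S(t)x) = psi(S(t) A x) with psi bounded
    on X. The scalar estimate then compares it with psi(T(s) A x), which is the
    same functional of C T(s)x. *)
Lemma solution_pointwise_energy (x : X) (q t : R) : DA x -> 0 < q -> 0 < t ->
  (\int[lmu]_(s in `[0%R, +oo[) (rnorm (C (T (Num.max s 0) x)) ^+ 2)%:E <= q%:E)%E ->
  ((expR (- (4 * t)) * (2 * pi * rnorm (C (S t x))) ^+ 2 / q)%:E <=
     limn_einf (kernel_density (fun z => (laplace a z)^-1)%R ^~ t))%E.
Proof.
move=> Dx q0 t0 hq.
have [phi [lphi phi_le phi_t]] := norming_functional (C (S t x)).
have hphi : bounded_functional phi 1.
  by split=> // y; rewrite mul1r.
have [psi [P [hpsi psiA]]] := dual_observation hT M0ge omega0 T_le hC hphi.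
have P0 := functional_ge0 hpsi.
(* any truncation time after t will do *)
pose tau := t + 1; have tau0 : 0 < tau by rewrite addr_gt0.
have [MA MA0 HMA] := orbit_bounded tau0 (solution_family_strongly_continuous hS (x := A x)).
have max0 (s : R) : 0 <= Num.max s 0 by rewrite le_max lexx orbT.
pose w := causal (fun s => psi (T (Num.max s 0) (A x))).
pose sg (r : R) := psi (S (Num.max r 0) (A x)).
pose sigma := truncate tau sg.
have csg : ccontinuous sg.
  exact: (functional_orbit hpsi (v := fun t => S t (A x)) (solution_family_strongly_continuous hS (x := A x))).
have sg_le r : 0 <= r <= tau -> cmod (sg r) <= P * MA.
  move=> /andP[r0 r1]; apply: le_trans (functional_le hpsi _) _.
  by rewrite ler_wpM2l// max_l// HMA// r0.
have sigma_t : sigma t = (rnorm (C (S t x)))%:C.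
  rewrite /sigma truncateE (ltW t0) lerDl ler01/= /sg max_l ?(ltW t0)//.
  rewrite -(solution_family_commute hS (ltW t0) Dx) psiA//.
  exact: (solution_family_domain hS (ltW t0) Dx).
have wE s : w s = if 0 <= s then phi (C (T (Num.max s 0) x)) else 0.
  rewrite /w causalE; case: (boolP (0 <= s)) => // s0.
  have [DT <-] := generator_orbit hT (max0 s) Dx.
  exact: psiA.
have iw0 : cintble lmu `[0, +oo[ (fun s => psi (T (Num.max s 0) (A x))).
  have := cintble_resolvent hT M0ge omega0 T_le hpsi (A x) (lexx 0 : 0 <= complex.Re (0 : R[i])).
  by apply: eq_cintble => // s _; rewrite mul0r oppr0 cexp0 mul1r.
have iw : cintble lmu setT w.
  exact: (cintble_mkcond lmu (D := `[0, +oo[%classic) _ (measurable_itv _)).1 iw0.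
have w_le s : cmod (w s) <= P * (M0 * rnorm (A x)).
  rewrite /w causalE; case: (boolP (0 <= s)) => s0; last by rewrite cmod0 !mulr_ge0 ?rnorm_ge0.
  apply: le_trans (functional_le hpsi _) _; rewrite ler_wpM2l//.
  apply: le_trans (T_le _ (max0 s)) _; rewrite ler_wpM2r ?rnorm_ge0// ler_piMr//.
  by rewrite -expR0 ler_expR oppr_le0 mulr_ge0// ltW.
have mw := cintble_meas iw.
have iw2 : lmu.-integrable setT (fun s => (cmod (w s) ^+ 2)%:E).
  apply: (@le_integrable _ _ _ lmu setT measurableT _
    (fun s => (P * (M0 * rnorm (A x)))%:E * (cmod (w s))%:E)%E).
  - by apply/measurable_EFinP; exact: cmeas_sqr_cmod.
  - move=> s _; rewrite -EFinM !abse_EFin lee_fin !ger0_norm ?sqr_ge0//.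
      by rewrite expr2 ler_wpM2r ?cmod_ge0.
    by rewrite mulr_ge0 ?cmod_ge0// !mulr_ge0 ?rnorm_ge0.
  - by apply: integrableZl => //; exact: cintble_cmod.
have w2q : \int[lmu]_s cmod (w s) ^+ 2 <= q.
  rewrite -lee_fin fineK; last exact: integrable_fin_num.
  apply: le_trans hq; rewrite [leRHS]integral_mkcond.
  apply: ge0_le_integral_nomeas => s _; first by rewrite lee_fin sqr_ge0.
  rewrite patchE; have -> : (s \in (`[0%R, +oo[%classic : set R)) = (0 <= s).
    by apply/idP/idP; rewrite inE/= in_itv/= andbT.
  rewrite wE; case: ifP => s0; last by rewrite cmod0 expr0n.
  by rewrite lee_fin; apply: lerXn2r; rewrite ?nnegrE ?cmod_ge0 ?rnorm_ge0.
have [E [M [E1 E2]]] := volterra_laplace hT M0ge omega0 T_le hS ha sa hpsi hm Dx tau0.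
have -> : rnorm (C (S t x)) = cmod (sigma t) by rewrite sigma_t cmod_real// rnorm_ge0.
apply: (pointwise_energy hm (w := w) (sigma := sigma) (E := E) (tau := tau) (M := M) (Ms := P * MA)) => //.
- by move=> s s0; rewrite wE leNgt s0.
- by apply: cintble_truncate sg_le; exact: ccontinuous_cmeas.
- by move=> r r0; rewrite /sigma truncateE leNgt r0.
- by rewrite ltrDl.
- move=> r; rewrite /sigma truncateE; case: ifP => rI; first exact: sg_le.
  by rewrite cmod0 mulr_ge0.
- move=> e e0.
  have [d d0 Hd] : exists2 d : R, 0 < d & forall r, `|r - t| < d -> cmod (sg r - sg t) <= e.
    have [cR cI] := csg; have e2 : 0 < e / 2 by rewrite divr_gt0.
    have := cR t => /cvgrPdist_le/(_ _ e2)/nbhs_ballP[d1 /= d10 H1].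
    have := cI t => /cvgrPdist_le/(_ _ e2)/nbhs_ballP[d2 /= d20 H2].
    exists (Num.min d1 d2); first by rewrite lt_min d10 d20.
    move=> r; rewrite lt_min => /andP[r1 r2]; apply: le_trans (cmod_le _) _.
    rewrite [leRHS](splitr e); apply: lerD.
      by have := H1 r; rewrite /ball/= distrC => /(_ r1); rewrite distrC raddfB.
    by have := H2 r; rewrite /ball/= distrC => /(_ r2); rewrite distrC raddfB.
  have d'0 : 0 < Num.min d (Num.min t 1) by rewrite !lt_min d0 t0 ltr01.
  exists (Num.min d (Num.min t 1)) => // r; rewrite !lt_min => /and3P[rd rt r1].
  have rI : 0 <= r <= tau.
    move: rt r1; rewrite !ltr_distl => /andP[+ _] /andP[_ +]; rewrite subrr => h1 h2.
    by rewrite (ltW h1) (ltW h2).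
  by rewrite /sigma !truncateE rI (ltW t0) lerDl ler01/=; exact: Hd.
Qed.

End SolutionEnergy.

Theorem theorem3p1 (R : realType) (X Y : completeNormedModType R[i])
  (DA : set X) (A : X -> X) (T : R -> {linear X -> X})
  (C : X -> Y) (a : R -> R[i]) (theta : R) (S : R -> {linear X -> X})
  (hT : generates DA A T) (hTstable : exponentially_stable T)
  (hC : bounded_linear_on_X1 DA A C)
  (ha : L1loc a) (ha_growth : subexponential_growth a)
  (ha_regular : regular_kernel 1 a)
  (ha_sectorial : sectorial_kernel a theta) (htheta : theta < pi / 2)
  (hS : solution_family a DA A S) :
  finite_time_admissible DA C T -> finite_time_admissible DA C S.
Proof.
move=> hadm; have [M [omega [omega0 HM]]] := hTstable.
have T_le t x : 0 <= t -> rnorm (T t x) <= `|M| * expR (- (omega * t)) * rnorm x.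
  move=> t0; apply: le_trans (HM t x t0) _.
  by rewrite ler_wpM2r ?rnorm_ge0// ler_wpM2r ?expR_ge0// ler_norm.
have M0 := normr_ge0 M.
have [m' [kappa [K [B [rho hm]]]]] := kernel_symbol ha ha_growth ha_regular ha_sectorial htheta.
have sa := subexp_kernel ha ha_growth.
have [q0 q00 Hq] := halfline_energy hC hT M0 omega0 T_le hadm.
have p2 : 0 < (2 * pi : R) ^+ 2 by rewrite exprn_gt0// mulr_gt0// pi_gt0.
(* the absolute value and the 1 only serve to make the constant positive *)
pose c := `|q0 / (2 * pi) ^+ 2 * kernel_energy kappa B rho| + 1.
have c0 : 0 < c by rewrite ltr_wpDl.
(* the energy up to time t is at most c exp(4t), since the weight exp(-4t) belongs
   to the line Re z = 2; the square root halves the exponent *)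
exists 2, (Num.sqrt c); split=> //; first by rewrite sqrtr_gt0.
move=> t x t0 Dx.
have SD r : 0 <= r -> DA (S r x) /\ A (S r x) = S r (A x).
  by move=> r0; split; [exact: (solution_family_domain hS)|exact: (solution_family_commute hS)].
pose f (r : R) := rnorm (C (S (Num.max r 0) x)) ^+ 2.
have -> : (\int[lebesgue_measure]_(r in `[0%R, t]) (rnorm (C (S r x)) ^+ 2)%:E =
    \int[lebesgue_measure]_(r in `[0%R, t]) (f r)%:E)%E.
  by apply: eq_integral => r; rewrite inE/= in_itv/= => /andP[r0 _]; rewrite /f max_l.
have C0 : C 0 = 0.
  have [D0 _] := generator_sub hT Dx Dx.
  by rewrite -(subrr x) (observation_sub hC Dx Dx D0) subrr.
have f_ge0 r : 0 <= f r by exact: sqr_ge0.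
have key : (\int[lebesgue_measure]_(r in `[0%R, t]) (f r)%:E <= (c * expR (4 * t) * rnorm x ^+ 2)%:E)%E.
  have [x0|xn0] := eqVneq (rnorm x) 0.
    have f0 r : f r = 0.
      rewrite /f; move/eqP: x0; rewrite rnorm_eq0 => /eqP ->; by rewrite linear0 C0 rnorm0 expr0n.
    rewrite (eq_integral (fun=> 0%E)); last by move=> r _; rewrite f0.
    by rewrite integral0 x0 expr0n mulr0.
  have xp : 0 < rnorm x by rewrite lt_def xn0 rnorm_ge0.
  have qp : 0 < q0 * rnorm x ^+ 2 by rewrite mulr_gt0// exprn_gt0.
  have mf : measurable_fun `[0, t] f.
    apply: measurable_funX; apply: measurable_funTS; apply: continuous_measurable_fun.
    apply: (observation_orbit hC (U := fun t => S t) (x := x)) => //.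
    - exact: generator_sub hT.
    - exact: (solution_family_strongly_continuous hS).
    - exact: (solution_family_strongly_continuous hS).
  have low r : 0 < r -> r <= t ->
      ((expR (- (4 * r)) * (2 * pi) ^+ 2 * f r / (q0 * rnorm x ^+ 2))%:E <=
       limn_einf (kernel_density (fun z => (laplace a z)^-1)%R ^~ r))%E.
    move=> r0 _; rewrite -[_ * f r]mulrA -exprMn /f max_l ?(ltW r0)//.
    exact: (solution_pointwise_energy hT M0 omega0 T_le hS ha sa hC hm Dx qp r0 (Hq x Dx)).
  apply: le_trans (integral_le_kernel_energy hm qp mf (fun r _ => f_ge0 r) low) _.
  rewrite lee_fin.
  have -> : q0 * rnorm x ^+ 2 / (2 * pi) ^+ 2 * expR (4 * t) * kernel_energy kappa B rho =
    (q0 / (2 * pi) ^+ 2 * kernel_energy kappa B rho) * (expR (4 * t) * rnorm x ^+ 2).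
    by ring.
  rewrite -[leRHS]mulrA ler_wpM2r//.
    by exact: mulr_ge0 (expR_ge0 _) (sqr_ge0 _).
  by apply: le_trans (ler_norm _) _; rewrite /c lerDl ler01.
have bound0 : 0 <= Num.sqrt c * expR (2 * t) * rnorm x.
  by rewrite !mulr_ge0 ?sqrtr_ge0 ?expR_ge0 ?rnorm_ge0.
have -> : Num.sqrt c * expR (2 * t) * rnorm x = Num.sqrt (c * expR (4 * t) * rnorm x ^+ 2).
  rewrite -[LHS]ger0_norm// -sqrtr_sqr; congr Num.sqrt.
  rewrite !exprMn sqr_sqrtr ?(ltW c0)//; congr (_ * _ * _).
  by rewrite expr2 -expRD; congr expR; ring.
move: key; have : (0 <= \int[lebesgue_measure]_(r in `[0%R, t]) (f r)%:E)%E.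
  by apply: integral_ge0 => r _; rewrite lee_fin.
case: (\int[lebesgue_measure]_(r in `[0%R, t]) (f r)%:E)%E => [j| |]//.
rewrite poweR_EFin !lee_fin => j0 h.
by rewrite powR12_sqrt// ler_wsqrtr.
Qed.
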